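(* Let $V$ be an $n$-dimensional left vector space over a division ring $R$ of characteristic not equal to $2$, $n\ge 3$, and let $1\le k\le n-1$ with $n\ne 2k$. Then any commutativity preserving bijection $f:\mathfrak{I}_k\to\mathfrak{I}_k$ can be extended to an automorphism of the group $\mathrm{GL}(V)$.
   Context: Since the characteristic of $R$ is not $2$, for every involution $u\in\mathrm{GL}(V)$ there are subspaces $S_+(u)=\{x\in V:u(x)=x\}$ and $S_-(u)=\{x\in V:u(x)=-x\}$ with $V=S_+(u)+S_-(u)$. The involution $u$ is called a $(k,n-k)$-involution if $\dim S_+(u)=k$ and $\dim S_-(u)=n-k$. $\mathfrak{I}_k$ denotes the set of all $(k,n-k)$-involutions. A bijection $f:\mathfrak{I}_k\to\mathfrak{I}_k$ is commutativity preserving if both $f$ and $f^{-1}$ map commuting involutions to commuting involutions, i.e. $uv=vu$ if and only if $f(u)f(v)=f(v)f(u)$ for all $u,v\in\mathfrak{I}_k$. *)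

(* Defs.v *)
From HB Require Import structures.
From mathcomp Require Import all_boot all_algebra.
From mathcomp Require Import boolp classical_sets.

Set Implicit Arguments.
Unset Strict Implicit.
Unset Printing Implicit Defensive.

Import GRing.Theory.

Local Open Scope classical_set_scope.
Local Open Scope ring_scope.

(* [R] is a possibly non-commutative ring; scalars act on the left, and an
   element of ['End(V)] acts on coordinate row vectors by right multiplication
   with its matrix, so it is left [R]-linear. *)
Record GL (R : nzRingType) (V : vectType R) := MkGL {
  GL_val :> 'End(V);
  GL_valP : `[< bijective GL_val >] }.

HB.instance Definition _ (R : nzRingType) (V : vectType R) :=
  [isSub for @GL_val R V].
HB.instance Definition _ (R : nzRingType) (V : vectType R) :=
  [Choice of GL V by <:].

Section GeneralLinearGroup.
Variables (R : nzRingType) (V : vectType R).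
Implicit Types u v w : GL V.

Lemma GL_bijective u : bijective u.
Proof. exact/asboolP/GL_valP. Qed.

Fact GL_one_subproof : `[< bijective (\1%VF : 'End(V)) >].
Proof. by apply/asboolP; exists idfun => x /=; rewrite id_lfunE. Qed.

Fact GL_mul_subproof u v : `[< bijective (u \o v)%VF >].
Proof.
apply/asboolP; apply: (eq_bij (bij_comp (GL_bijective u) (GL_bijective v))).
by move=> x; rewrite comp_lfunE.
Qed.

Fact GL_inv_exists u : {w : GL V | cancel u w}.
Proof.
have [g ug gu] := cid2 (let: Bijective g a b := GL_bijective u in
                        ex_intro2 _ _ g a b).
have linear_g : linear g := can2_linear ug gu.
pose gL : {linear V -> V} := HB.pack g (GRing.isLinear.Build _ _ _ _ g linear_g).
have gE : linfun gL =1 g by move=> x; rewrite lfunE.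
have bij_g : `[< bijective (linfun gL : 'End(V)) >].
  by apply/asboolP; exists u => x; rewrite gE.
by exists (MkGL bij_g) => x; rewrite /= gE.
Qed.

Definition GL_one : GL V := MkGL GL_one_subproof.
Definition GL_mul u v : GL V := MkGL (GL_mul_subproof u v).
Definition GL_inv u : GL V := sval (GL_inv_exists u).

Fact GL_mulA : associative GL_mul.
Proof. by move=> u v w; apply: val_inj; rewrite /= comp_lfunA. Qed.

Fact GL_mul1g : left_id GL_one GL_mul.
Proof. by move=> u; apply: val_inj; rewrite /= comp_lfun1l. Qed.

Fact GL_mulg1 : right_id GL_one GL_mul.
Proof. by move=> u; apply: val_inj; rewrite /= comp_lfun1r. Qed.

Fact GL_mulVg : left_inverse GL_one GL_inv GL_mul.
Proof.
move=> u; apply/val_inj/lfunP => x /=; rewrite comp_lfunE id_lfunE.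
exact: (svalP (GL_inv_exists u)).
Qed.

Fact GL_mulgV : right_inverse GL_one GL_inv GL_mul.
Proof.
move=> u; apply/val_inj/lfunP => x /=; rewrite comp_lfunE id_lfunE.
by move: x; apply/bij_can_sym/(svalP (GL_inv_exists u))/(GL_bijective u).
Qed.

HB.instance Definition _ := isGroup.Build (GL V)
  GL_mulA GL_mul1g GL_mulg1 GL_mulVg GL_mulgV.

End GeneralLinearGroup.

Section Involutions.
Variables (R : nzRingType) (V : vectType R).

Definition lincomb k (e : 'I_k -> V) (c : 'rV[R]_k) : V :=
  \sum_(i < k) c 0 i *: e i.

(* The subspaces [{vspace V}] and their dimension need a commutative field of
   scalars; here a dimension is the size of a basis (a free spanning family). *)
Definition has_dim (S : set V) (k : nat) : Prop :=
  exists e : 'I_k -> V,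
    (forall c, lincomb e c = 0 -> c = 0) /\ range (lincomb e) = S.

Definition S_plus (u : GL V) : set V := [set x | u x = x].

Definition S_minus (u : GL V) : set V := [set x | u x = - x].

Definition involution (u : GL V) : Prop := (u * u = 1)%g.

Definition kl_involution (k l : nat) (u : GL V) : Prop :=
  [/\ involution u, has_dim (S_plus u) k & has_dim (S_minus u) l].

Definition involutions (k : nat) : set (GL V) :=
  [set u | kl_involution k (dim V - k) u].

(* Sets coerce to types: [f] is a map on the elements of [I]. *)
Definition commutativity_preserving (I : set (GL V)) (f : I -> I) : Prop :=
  forall u v : I, commute (val u) (val v) <-> commute (val (f u)) (val (f v)).

End Involutions.

Arguments involutions {R} V k.

Definition is_automorphism (G : groupType) (g : G -> G) : Prop :=
  {morph g : x y / (x * y)%g} /\ bijective g.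

(* Main.v *)
(** An involution [u] is determined by the idempotent [A = (u + 1) / 2], and
    involutions commute iff their idempotents do; passing to [1 - A] one may
    assume [2k < n].  A maximal set of commuting idempotents of rank [k] is the
    set of partial sums of [k] members of a frame, i.e. of a decomposition of
    the identity into orthogonal idempotents of rank 1.  So [f] maps frames to
    frames; it permutes the [k]-subsets of the index set, and this permutation
    comes from one of the indices because [f] preserves the relation "disjoint"
    between pairs of indices (expressed by commutation) and [n >= 5] if
    [k >= 2] (Whitney's argument).  Comparing frames which differ by an
    elementary matrix shows that [f] induces a bijection of the idempotents of
    rank 1, that is, of the non-incident pairs (point, hyperplane).  Two such
    pairs which share the point or the hyperplane are mapped to two such pairs,
    and these rook graphs have no automorphisms other than the expected ones:
    the bijection comes from a collineation or from a correlation.  By the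
    fundamental theorem of projective geometry it extends to a ring
    automorphism or anti-automorphism [theta] of the matrix ring, hence so does
    [f], and [u |-> theta u] or [u |-> theta u^-1] is the automorphism of the
    linear group. *)

Require Import Defs.
From mathcomp Require Import boolp classical_sets.
From mathcomp Require Import all_boot all_fingroup all_algebra.
From mathcomp Require Import zify.

Set Implicit Arguments.
Unset Strict Implicit.
Unset Printing Implicit Defensive.

Import GRing.Theory VectorInternalTheory.

Local Open Scope group_scope.
Local Open Scope ring_scope.

(** * Invertible matrices and idempotents over a division ring *)

(** A frame is such a matrix up to a diagonal left factor, and two frames are compared through the
    entries of [E1 *m glmx_inv E]. The recurring tool: an off-diagonal entry at (i, j) vanishes once
    the matrix commutes with one coordinate idempotent whose index set separates i from j. For k > 1
    the idempotents of rank 1 are outside the domain of [f]. The image of one of them is defined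
    through a frame that contains it, and the obstacle is independence of the frame: two frames with
    a common member differ by a block diagonal matrix, and elementary matrices inside the block do
    not affect the image at the common index. The bound 2k < n leaves room for separating sets and
    tells a k-subset from its complement, which cuts the same pairs. For n = 2k commutation could
    not tell u from -u. Transposition reverses products only when it passes to the opposite ring, so
    a correlation is handled as a collineation with values over [R^c]. *)

Record glmx (R : nzRingType) n := Glmx {
  glmx_val :> 'M[R]_n;
  glmx_inv : 'M[R]_n;
  glmxV : glmx_val *m glmx_inv = 1%:M;
  glVmx : glmx_inv *m glmx_val = 1%:M }.

Section Glmx.
Variable R : nzRingType.
Implicit Types n m p : nat.

Definition gl1 n : glmx R n := Glmx (mulmx1 1%:M) (mulmx1 1%:M).

Definition glI n (A : glmx R n) : glmx R n := Glmx (glVmx A) (glmxV A).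

Lemma glmxK m n (A : glmx R n) : cancel (mulmx (m := n) A) (mulmx (p := m) (glmx_inv A)).
Proof. by move=> B; rewrite mulmxA glVmx mul1mx. Qed.
Lemma glmxKV m n (A : glmx R n) : cancel (mulmx (glmx_inv A)) (@mulmx R n n m A).
Proof. by move=> B; rewrite mulmxA glmxV mul1mx. Qed.
Lemma glmxKr m n (A : glmx R n) : cancel (@mulmx R m n n ^~ A) (@mulmx R m n n ^~ (glmx_inv A)).
Proof. by move=> B; rewrite -mulmxA glmxV mulmx1. Qed.
Lemma glmxKVr m n (A : glmx R n) : cancel (@mulmx R m n n ^~ (glmx_inv A)) (@mulmx R m n n ^~ A).
Proof. by move=> B; rewrite -mulmxA glVmx mulmx1. Qed.

Fact glM_subproof n (A B : glmx R n) : (A *m B) *m (glmx_inv B *m glmx_inv A) = 1%:M.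
Proof. by rewrite -mulmxA glmxKV glmxV. Qed.
Fact glM_subproof2 n (A B : glmx R n) : (glmx_inv B *m glmx_inv A) *m (A *m B) = 1%:M.
Proof. by rewrite -mulmxA glmxK glVmx. Qed.
Definition glM n (A B : glmx R n) := Glmx (glM_subproof A B) (glM_subproof2 A B).

Fact gl_perm_subproof n (s : 'S_n) : perm_mx s *m perm_mx s^-1 = 1%:M :> 'M[R]_n.
Proof. by rewrite -perm_mxM mulgV perm_mx1. Qed.
Fact gl_perm_subproof2 n (s : 'S_n) : perm_mx s^-1 *m perm_mx s = 1%:M :> 'M[R]_n.
Proof. by rewrite -perm_mxM mulVg perm_mx1. Qed.
Definition gl_perm n (s : 'S_n) := Glmx (gl_perm_subproof s) (gl_perm_subproof2 s).

Fact gl_block_subproof m n (A A' : 'M[R]_m) (B B' : 'M[R]_n) : A *m A' = 1%:M -> B *m B' = 1%:M ->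
  block_mx A 0 0 B *m block_mx A' 0 0 B' = 1%:M.
Proof.
by move=> HA HB; rewrite mulmx_block HA HB !(mulmx0, mul0mx, addr0, add0r) -scalar_mx_block.
Qed.
Definition gl_block m n (A : glmx R m) (B : glmx R n) : glmx R (m + n) :=
  Glmx (gl_block_subproof (glmxV A) (glmxV B)) (gl_block_subproof (glVmx A) (glVmx B)).

Fact gl_lower_subproof m n (Y Y' : 'M[R]_(n, m)) : Y + Y' = 0 ->
   block_mx 1%:M 0 Y 1%:M *m block_mx 1%:M 0 Y' 1%:M = 1%:M.
Proof.
by move=> H; rewrite mulmx_block !(mulmx0, mul0mx, mulmx1, mul1mx, addr0, add0r) H -scalar_mx_block.
Qed.
Definition gl_lower m n (Y : 'M[R]_(n, m)) : glmx R (m + n) :=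
  Glmx (gl_lower_subproof (subrr Y)) (gl_lower_subproof (addNr Y)).

Fact gl_upper_subproof m n (X X' : 'M[R]_(m, n)) : X' + X = 0 ->
   block_mx 1%:M X 0 1%:M *m block_mx 1%:M X' 0 1%:M = 1%:M.
Proof.
by move=> H; rewrite mulmx_block !(mulmx0, mul0mx, mulmx1, mul1mx, addr0, add0r) H -scalar_mx_block.
Qed.
Definition gl_upper m n (X : 'M[R]_(m, n)) : glmx R (m + n) :=
  Glmx (gl_upper_subproof (addNr X)) (gl_upper_subproof (subrr X)).

Fact gl_elem_subproof n (i j : 'I_n) (a b : R) : i != j -> a + b = 0 ->
  (1%:M + a *: delta_mx i j) *m (1%:M + b *: delta_mx i j) = 1%:M.
Proof.
move=> ij ab; rewrite mulmxDl mul1mx mulmxDr mulmx1.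
suff -> : (a *: delta_mx i j) *m (b *: delta_mx i j) = 0 :> 'M_n.
  by rewrite addr0 -addrA -scalerDl addrC [b + a]addrC ab scale0r add0r.
apply/matrixP=> k l; rewrite !mxE big1 // => q _; rewrite !mxE.
case: eqP => /=; rewrite ?mulr0 ?mul0r // => _.
case: eqP => /=; rewrite ?mulr0 ?mul0r // => ->.
by rewrite eq_sym (negPf ij) /= mulr0n !mulr0.
Qed.
Definition gl_elem n (i j : 'I_n) (a : R) (ij : i != j) : glmx R n :=
  Glmx (gl_elem_subproof ij (subrr a)) (gl_elem_subproof ij (addNr a)).

Lemma glME n (A B : glmx R n) : glmx_val (glM A B) = A *m B. Proof. by []. Qed.
Lemma gl_blockE m n (A : glmx R m) (B : glmx R n) : glmx_val (gl_block A B) = block_mx A 0 0 B.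
Proof. by []. Qed.
Lemma gl_lowerE m n (Y : 'M[R]_(n, m)) : glmx_val (gl_lower Y) = block_mx 1%:M 0 Y 1%:M.
Proof. by []. Qed.
Lemma gl_upperE m n (X : 'M[R]_(m, n)) : glmx_val (gl_upper X) = block_mx 1%:M X 0 1%:M.
Proof. by []. Qed.

End Glmx.

(** * Elimination to rank normal form *)

Section Gauss.
Variable R : unitRingType.
Hypothesis divR : forall x : R, x != 0 -> x \is a GRing.unit.

Fact gl_scal_subproof (a b : R) : a * b = 1 -> a%:M *m b%:M = 1%:M :> 'M_1.
Proof. by move=> H; rewrite -scalar_mxM H. Qed.
Definition gl_scal (a : R) (Ha : a != 0) : glmx R 1 :=
  Glmx (gl_scal_subproof (divrr (divR Ha))) (gl_scal_subproof (mulVr (divR Ha))).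

Lemma nz_entry m p (A : 'M[R]_(m, p)) : A != 0 -> exists i j, A i j != 0.
Proof.
move=> A0; have [[i [j H]]|H] := pselect (exists i j, A i j != 0); first by exists i, j.
case/eqP: A0; apply/matrixP=> i j; rewrite mxE; apply: contrapT => /eqP K.
by apply: H; exists i, j.
Qed.

Lemma gauss m p (A : 'M[R]_(m, p)) :
  exists (L : glmx R m) (U : glmx R p) r,
    [/\ (r <= m)%N, (r <= p)%N & A = L *m pid_mx r *m U].
Proof.
elim: m p A => [|m IH] p A.
  by exists (gl1 R 0), (gl1 R p), 0%N; split=> //; rewrite [A]flatmx0 [RHS]flatmx0.
have [->|/nz_entry [i [j Aij]]] := eqVneq A 0.
  by exists (gl1 R m.+1), (gl1 R p), 0%N; split=> //; rewrite pid_mx_0 mulmx0 mul0mx.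
case: p A j Aij => [|p] A j Aij; first by case: j Aij.
pose B : 'M_(1 + m, 1 + p) := xcol j 0 (xrow i 0 A).
have B00 : ulsubmx B 0 0 != 0.
  by rewrite !mxE !lshift0 !tpermR.
have BA : A = tperm_mx i 0 *m B *m tperm_mx j 0.
  rewrite /B xcolE xrowE /tperm_mx !mulmxA -perm_mxM tperm2 perm_mx1 mul1mx.
  by rewrite -mulmxA -perm_mxM tperm2 perm_mx1 mulmx1.
suff [L [U [r [rm rp BE]]]] : exists (L : glmx R (1 + m)) (U : glmx R (1 + p)) r,
    [/\ (r <= 1 + m)%N, (r <= 1 + p)%N & B = L *m pid_mx r *m U].
  exists (glM (gl_perm R (tperm i 0)) L), (glM U (gl_perm R (tperm j 0))), r.
  by split=> //; rewrite {1}BA BE /= !mulmxA.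
set a := ulsubmx B 0 0 in B00; pose ga := gl_scal B00.
(* The Schur complement of the pivot [a]; the two unitriangular factors below clear the rest of the
   pivot's column and row. *)
have [L [U [r [rm rp S]]]] := IH p (drsubmx B - dlsubmx B *m glmx_inv ga *m ursubmx B).
exists (glM (gl_lower (dlsubmx B *m glmx_inv ga)) (gl_block ga L)).
exists (glM (gl_block (gl1 R 1) U) (gl_upper (glmx_inv ga *m ursubmx B))).
exists r.+1; split=> //; rewrite !glME !mulmxA !gl_blockE gl_lowerE gl_upperE.
have -> : pid_mx r.+1 = block_mx 1%:M 0 0 (pid_mx r) :> 'M[R]_(1 + m, 1 + p).
  apply/matrixP=> u v; rewrite !mxE; case: splitP => u' Hu; rewrite !mxE; case: splitP => v' Hv; rewrite !mxE Hu Hv ?ord1 //=.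
rewrite !mulmx_block !(mulmx0, mul0mx, mulmx1, mul1mx, addr0, add0r).
rewrite !mulmxA -S.
rewrite -[B in LHS]submxK; have -> : ulsubmx B = a%:M by rewrite [LHS]mx11_scalar.
have aV : a%:M *m a^-1%:M = 1%:M :> 'M_1 := glmxV ga.
have Va : a^-1%:M *m a%:M = 1%:M :> 'M_1 := glVmx ga.
congr block_mx => /=.
- by rewrite aV mul1mx.
- by rewrite -mulmxA Va mulmx1.
- by rewrite -(mulmxA _ _ a%:M) Va mulmx1 subrKC.
Qed.

End Gauss.

(** * Coordinate idempotents and their conjugates *)

Section Proj.
Variable R : nzRingType.
Variable n : nat.
Implicit Types (E : glmx R n) (I J : {set 'I_n}) (A B : 'M[R]_n).

Definition set_mx I : 'M[R]_n := diag_mx (\row_j (j \in I)%:R).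
Definition conj_mx E A := glmx_inv E *m A *m E.
(** Matrices act on row vectors: the rows of [E] form a basis, and this is the projection onto the
    span of the rows in [I] along the span of the other rows. *)
Definition proj E I := conj_mx E (set_mx I).

Lemma set_mxE I i j : set_mx I i j = ((i == j) && (i \in I))%:R.
Proof. by rewrite !mxE; case: eqP => //= ->; rewrite mulr1n. Qed.

Lemma mul_mx_set m (A : 'M_(m, n)) I i j : (A *m set_mx I) i j = A i j *+ (j \in I).
Proof. by rewrite mul_mx_diag !mxE mulr_natr. Qed.
Lemma mul_set_mx m (A : 'M_(n, m)) I i j : (set_mx I *m A) i j = A i j *+ (i \in I).
Proof. by rewrite mul_diag_mx !mxE mulr_natl. Qed.

Lemma set_mxM I J : set_mx I *m set_mx J = set_mx (I :&: J).
Proof.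
apply/matrixP=> i j; rewrite mul_set_mx !set_mxE inE.
by case: eqP => [->|_] //=; case: (j \in I); rewrite ?mul0rn ?mulr0n.
Qed.

Lemma set_mxT : set_mx setT = 1%:M.
Proof. by apply/matrixP=> i j; rewrite set_mxE inE andbT mxE. Qed.
Lemma set_mx0 : set_mx set0 = 0.
Proof. by apply/matrixP=> i j; rewrite set_mxE inE andbF mxE. Qed.

Lemma set_mxC I : set_mx (~: I) = 1%:M - set_mx I.
Proof.
apply/matrixP=> i j; rewrite set_mxE !mxE inE.
by case: eqP => [->|_] //=; rewrite ?subr0 //; case: (_ \in _); rewrite ?subrr ?subr0.
Qed.

Lemma comm_set_mx A I :
  A *m set_mx I = set_mx I *m A <-> (forall i j, (i \in I) != (j \in I) -> A i j = 0).
Proof.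
split=> [/matrixP H i j|H].
  move: (H i j); rewrite mul_mx_set mul_set_mx.
  by case: (_ \in _); case: (_ \in _).
apply/matrixP=> i j; rewrite mul_mx_set mul_set_mx; move: (H i j).
by case: (_ \in _); case: (_ \in _) => //= -> //.
Qed.

Lemma conj_mxM E A B : conj_mx E (A *m B) = conj_mx E A *m conj_mx E B.
Proof. by rewrite /conj_mx -!mulmxA glmxKV. Qed.
Lemma conj_mxD E A B : conj_mx E (A + B) = conj_mx E A + conj_mx E B.
Proof. by rewrite /conj_mx mulmxDr mulmxDl. Qed.
Lemma conj_mx1 E : conj_mx E 1%:M = 1%:M.
Proof. by rewrite /conj_mx mulmx1 glVmx. Qed.
Lemma conj_mx0 E : conj_mx E 0 = 0.
Proof. by rewrite /conj_mx mulmx0 mul0mx. Qed.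
Lemma conj_mxB E A B : conj_mx E (A - B) = conj_mx E A - conj_mx E B.
Proof. by rewrite /conj_mx mulmxBr mulmxBl. Qed.
Lemma conj_mxI E A : conj_mx (glI E) (conj_mx E A) = A.
Proof. by rewrite /conj_mx /= !mulmxA glmxV mul1mx -mulmxA glmxV mulmx1. Qed.
Lemma conj_mxIV E A : conj_mx E (conj_mx (glI E) A) = A.
Proof. by rewrite /conj_mx /= !mulmxA glVmx mul1mx -mulmxA glVmx mulmx1. Qed.
Lemma conj_glM E E' A : conj_mx (glM E E') A = conj_mx E' (conj_mx E A).
Proof. by rewrite /conj_mx /= !mulmxA. Qed.
Lemma conj_gl1 A : conj_mx (gl1 R n) A = A.
Proof. by rewrite /conj_mx /= mul1mx mulmx1. Qed.
Lemma conj_mx_inj E : injective (conj_mx E).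
Proof. exact: can_inj (conj_mxI E). Qed.
Lemma conj_comm E A B : conj_mx E A *m conj_mx E B = conj_mx E B *m conj_mx E A
  <-> A *m B = B *m A.
Proof. by rewrite -!conj_mxM; split=> [/conj_mx_inj|->]. Qed.

Lemma proj_glM E E' I : proj (glM E E') I = conj_mx E' (proj E I).
Proof. exact: conj_glM. Qed.
Lemma proj_gl1 I : proj (gl1 R n) I = set_mx I.
Proof. exact: conj_gl1. Qed.

Lemma proj_comm E I J : proj E I *m proj E J = proj E J *m proj E I.
Proof. by apply/conj_comm; rewrite !set_mxM setIC. Qed.
Lemma proj_idem E I : proj E I *m proj E I = proj E I.
Proof. by rewrite /proj -conj_mxM set_mxM setIid. Qed.

Lemma set_mx_inj : injective set_mx.
Proof.
move=> I J /matrixP H; apply/setP=> i; have := H i i; rewrite !set_mxE eqxx /=.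
by case: (_ \in _); case: (_ \in _) => // /eqP; rewrite ?oner_eq0 // eq_sym oner_eq0.
Qed.

Lemma projC E I : proj E (~: I) = 1%:M - proj E I.
Proof. by rewrite /proj set_mxC conj_mxB conj_mx1. Qed.

Lemma conj_perm s A : conj_mx (gl_perm R s) A = \matrix_(i, j) A ((s^-1)%g i) ((s^-1)%g j).
Proof.
rewrite /conj_mx /= -row_permE -{2}[s]invgK -col_permE.
by apply/matrixP=> i j; rewrite !mxE.
Qed.

Lemma proj_perm s I : proj (gl_perm R s) I = set_mx (s @: I).
Proof.
rewrite /proj conj_perm; apply/matrixP=> i j; rewrite mxE !set_mxE (inj_eq perm_inj).
by case: eqP => //= _; rewrite -{2}[i](permKV s) mem_imset //; exact: perm_inj.
Qed.

End Proj.

(** * Invariance of rank and simultaneous diagonalization *)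

Section DivisionRing.
Variable R : unitRingType.
Hypothesis divR : forall x : R, x != 0 -> x \is a GRing.unit.

(** With [A] in rank normal form, a rank [q] below [r] would make a conjugate of the identity have a
    zero row. *)
Lemma mulmx1_leq r s (A : 'M[R]_(r, s)) (B : 'M_(s, r)) : A *m B = 1%:M -> (r <= s)%N.
Proof.
move=> AB; have [L [U [q [qr qs AE]]]] := gauss divR A.
apply: leq_trans qs; rewrite leqNgt; apply/negP => lt_qr.
have H : pid_mx q *m (U *m B *m L) = 1%:M :> 'M_r.
  transitivity (glmx_inv L *m (A *m B) *m L); first by rewrite AE !mulmxA glVmx mul1mx.
  by rewrite AB mulmx1 glVmx.
move/matrixP/(_ (Ordinal lt_qr) (Ordinal lt_qr)): H.
rewrite [RHS]mxE eqxx mxE big1 => [/esym/eqP|j _]; first by rewrite oner_eq0.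
by rewrite mxE /= ltnn andbF mul0r.
Qed.

(** The transition matrix, restricted to rows in [J] and columns in [I], has a right inverse, so
    [mulmx1_leq] applies; exchanging the frames gives the other inequality. *)
Lemma proj_card n (E E' : glmx R n) I J : proj E I = proj E' J -> #|I| = #|J|.
Proof.
suff le : forall (E E' : glmx R n) I J, proj E I = proj E' J -> (#|J| <= #|I|)%N.
  by move=> H; apply/eqP; rewrite eqn_leq (le _ _ _ _ H) (le _ _ _ _ (esym H)).
move=> {}E {}E' {}I {}J H.
have G : E' *m glmx_inv E *m set_mx R I *m (E *m glmx_inv E') = set_mx R J.
  have := congr1 (fun X => E' *m X *m glmx_inv E') H.
  by rewrite /proj /conj_mx !mulmxA glmxV mul1mx -(mulmxA _ E') glmxV mulmx1.
pose A := \matrix_(a < #|J|, b < #|I|) (E' *m glmx_inv E) (enum_val a) (enum_val b).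
pose B := \matrix_(b < #|I|, a < #|J|) (E *m glmx_inv E') (enum_val b) (enum_val a).
apply: (@mulmx1_leq _ _ A B); apply/matrixP=> a c; rewrite !mxE.
have := congr1 (fun X : 'M_n => X (enum_val a) (enum_val c)) G.
rewrite /= set_mxE (inj_eq enum_val_inj) enum_valP andbT => <-.
rewrite mxE (bigID (mem I)) /= [X in _ + X]big1 ?addr0 => [|i /negPf iI]; last first.
  by rewrite mul_mx_set iI mulr0n mul0r.
rewrite (reindex_omap (@enum_val _ (mem I)) (fun i => insub (index i (enum I)))) /=; last first.
  move=> i iI; rewrite insubT ?cardE ?index_mem ?mem_enum // => lt /=.
  by rewrite /enum_val /= nth_index // mem_enum.
apply: eq_big => [i|i _].
  by rewrite enum_valP /enum_val /= index_uniq ?enum_uniq -?cardE // valK eqxx.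
by rewrite mul_mx_set enum_valP mulr1n !mxE.
Qed.

(** Idempotence of L pid U says that the upper left block of M = U L is 1. Then M pid has only one
    further block [Y], which a unitriangular conjugation removes. *)
Lemma idem_block p q (A : 'M[R]_(p + q)) (L U : glmx R (p + q)) :
  A *m A = A -> A = L *m pid_mx p *m U ->
  exists E : glmx R (p + q), A = conj_mx E (block_mx 1%:M 0 0 0).
Proof.
move=> AA AE; pose M : 'M_(p + q) := U *m L.
have ME : pid_mx p *m M *m pid_mx p = pid_mx p :> 'M[R]_(p + q).
  move: AA; rewrite AE => /(congr1 (fun X => glmx_inv L *m X *m glmx_inv U)).
  rewrite /M !mulmxA glVmx mul1mx -!(mulmxA _ U) glmxV !mulmx1.
  by rewrite -!mulmxA !mulmxA.
pose Y := dlsubmx M.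
have Mu : M *m pid_mx p = block_mx 1%:M 0 Y 0 :> 'M_(p + q).
  move: ME; rewrite pid_mx_block -[M]submxK !mulmx_block.
  rewrite !(mulmx0, mul0mx, mulmx1, mul1mx, addr0, add0r).
  by move=> /eq_block_mx[-> _ _ _].
exists (glM (gl_lower (- Y)) U); rewrite conj_glM.
apply: (@conj_mx_inj _ _ (glI U)); rewrite conj_mxI.
rewrite /conj_mx AE [glmx_inv (glI U)]/= !mulmxA -/M Mu /= -mulmxA glmxV mulmx1.
by rewrite !mulmx_block !(mulmx0, mul0mx, mulmx1, mul1mx, addr0, add0r) opprK.
Qed.

(** Induction on the size: a member other than 0 and 1 splits the space into two smaller pieces, and
    whatever commutes with it is block diagonal. *)
Lemma simultaneous_diag n (s : seq 'M[R]_n) :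
  (forall A, A \in s -> A *m A = A) ->
  (forall A B, A \in s -> B \in s -> A *m B = B *m A) ->
  exists E : glmx R n, forall A, A \in s -> exists I, A = proj E I.
Proof.
elim/ltn_ind: n s => n IH s idem comm.
have [[A0 [A0s A00 A01]]|H] := pselect (exists A, [/\ A \in s, A != 0 & A != 1%:M]); last first.
  exists (gl1 R n) => A As; have [->|A0] := eqVneq A 0.
    by exists set0; rewrite proj_gl1 set_mx0.
  have [->|A1] := eqVneq A 1%:M; first by exists setT; rewrite proj_gl1 set_mxT.
  by case: H; exists A.
have [L [U [p [pn _ A0E]]]] := gauss divR A0.
move: (n - p)%N (subnKC pn) => q nE.
case: n / nE in IH s idem comm A0 A0s A00 A01 L U pn A0E *.
have [E A0b] := idem_block (idem _ A0s) A0E.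
have p_gt0 : (0 < p)%N.
  rewrite lt0n; apply: contraNneq A00 => p0; rewrite A0E.
  have -> : pid_mx p = 0 :> 'M[R]_(p + q).
    apply/matrixP=> i j; rewrite !mxE; have -> : (i < p)%N = false.
      by apply/negP=> lt; have := leq_trans lt (eq_leq p0).
    by rewrite andbF.
  by rewrite mulmx0 mul0mx.
have q_gt0 : (0 < q)%N.
  rewrite lt0n; apply: contraNneq A01 => q0; rewrite A0b -(conj_mx1 E) scalar_mx_block.
  apply/eqP; congr (conj_mx _ (block_mx _ _ _ _)).
  by apply/matrixP=> i; have := leq_trans (ltn_ord i) (eq_leq q0).
pose T A := conj_mx (glI E) A.
have Tb A : A \in s -> T A = block_mx (ulsubmx (T A)) 0 0 (drsubmx (T A)).
  move=> As; have /conj_comm := comm _ _ As A0s => /(_ (glI E)).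
  rewrite [in conj_mx _ A0]A0b conj_mxI -/(T A) -[T A]submxK !mulmx_block.
  rewrite !(mulmx0, mul0mx, mulmx1, mul1mx, addr0, add0r).
  by move=> /eq_block_mx[_ H1 H2 _]; rewrite -H1 H2 block_mxKul block_mxKdr.
have TM A B : T (A *m B) = T A *m T B by rewrite /T conj_mxM.
have blk A B : A \in s -> B \in s ->
    T A *m T B = block_mx (ulsubmx (T A) *m ulsubmx (T B)) 0 0 (drsubmx (T A) *m drsubmx (T B)).
  move=> As Bs; rewrite (Tb A As) (Tb B Bs) mulmx_block.
  by rewrite !block_mxKul !block_mxKdr !(mulmx0, mul0mx, addr0, add0r).
have [|||E1 HE1] := IH p _ [seq ulsubmx (T A) | A <- s].
- by rewrite -addn1 leq_add2l.
- move=> _ /mapP[A As ->]; have := blk _ _ As As; rewrite -TM idem // {1}Tb //.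
  by move=> /eq_block_mx[].
- move=> _ _ /mapP[A As ->] /mapP[B Bs ->]; have := blk _ _ As Bs.
  by rewrite -TM comm // TM blk // => /eq_block_mx[].
have [|||E2 HE2] := IH q _ [seq drsubmx (T A) | A <- s].
- by rewrite -add1n leq_add2r.
- move=> _ /mapP[A As ->]; have := blk _ _ As As; rewrite -TM idem // {1}Tb //.
  by move=> /eq_block_mx[].
- move=> _ _ /mapP[A As ->] /mapP[B Bs ->]; have := blk _ _ As Bs.
  by rewrite -TM comm // TM blk // => /eq_block_mx[].
exists (glM (gl_block E1 E2) E) => A As.
have [I1 I1E] := HE1 _ (map_f (fun A => ulsubmx (T A)) As).
have [I2 I2E] := HE2 _ (map_f (fun A => drsubmx (T A)) As).
exists [set i | match split i with inl a => a \in I1 | inr b => b \in I2 end].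
rewrite proj_glM -[A](conj_mxIV E) -/(T A) (Tb A As) I1E I2E; congr conj_mx.
rewrite /proj /conj_mx /=.
have -> : set_mx R [set i | match split i with inl a => a \in I1 | inr b => b \in I2 end] =
  block_mx (set_mx R I1) 0 0 (set_mx R I2).
  apply/matrixP=> i j; rewrite set_mxE inE.
  case: (split_ordP i) => i' ->; case: (split_ordP j) => j' ->.
  - by rewrite block_mxEul set_mxE eq_lshift.
  - by rewrite block_mxEur mxE eq_lrshift.
  - by rewrite block_mxEdl mxE eq_rlshift.
  - by rewrite block_mxEdr set_mxE eq_rshift.
by rewrite !mulmx_block !(mulmx0, mul0mx, addr0, add0r).
Qed.

End DivisionRing.

(** * Commutativity-preserving bijections map frames to frames *)

Section Combinatorics.
Variable T : finType.
Implicit Types A B I J : {set T}.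

Lemma subset_of_card A m : (m <= #|A|)%N -> exists2 B : {set T}, B \subset A & #|B| = m.
Proof.
move=> mA; exists [set x | x \in take m (enum A)].
  by apply/subsetP=> x; rewrite inE => /mem_take; rewrite mem_enum.
rewrite cardsE (card_uniqP _) ?take_uniq ?enum_uniq //.
by rewrite size_takel -?cardE.
Qed.

Lemma card_set_avoiding A x m : x \notin A -> (0 < m)%N -> (m + #|A| <= #|T|)%N ->
  exists I : {set T}, [/\ #|I| = m, x \in I & [disjoint I & A]].
Proof.
move=> xA m0 mA; have [|B /subsetP BA Bm] := @subset_of_card (~: (x |: A)) m.-1.
  by rewrite -(leq_add2l #|x |: A|) cardsC cardsU1 xA addnAC add1n prednK.
exists (x |: B); split; last 2 first.
- by rewrite setU11.
- apply/pred0P=> y /=; rewrite !inE; case: eqP => [->|_] /=; first exact: negbTE.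
  by apply/negP=> /andP[/BA]; rewrite !inE negb_or => /andP[_ /negPf->].
rewrite cardsU1 Bm; have -> : x \notin B by apply/negP=> /BA; rewrite !inE eqxx.
by rewrite add1n prednK.
Qed.

(** [I] does not cut [A]. For a pair [A] this ensures that matrices with all off-diagonal entries
    inside [A] commute with [set_mx R I]. *)
Definition whole A I := (A \subset I) || [disjoint A & I].

Lemma whole2 i j I : whole [set i; j] I = ((i \in I) == (j \in I)).
Proof.
rewrite /whole subUset !sub1set disjoints_subset subUset !sub1set !inE.
by case: (i \in I); case: (j \in I).
Qed.

Lemma whole_disjoint A I : [disjoint I & A] -> whole A I.
Proof. by rewrite /whole disjoint_sym => ->; rewrite orbT. Qed.

Lemma set2_eq A i j : #|A| = 2%N -> i != j -> i \in A -> j \in A -> A = [set i; j].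
Proof.
move=> A2 ij iA jA; apply/esym/eqP; rewrite eqEcard A2 cards2 ij subUset !sub1set iA jA //.
Qed.

Lemma set2P A i : #|A| = 2%N -> i \in A -> exists2 j, i != j & A = [set i; j].
Proof.
move=> /eqP/cards2P[x [y [xy ->]]]; rewrite !inE => /orP[]/eqP->; first by exists y.
by exists x; rewrite 1?eq_sym // setUC.
Qed.

End Combinatorics.

Lemma card_set_separating n k (A : {set 'I_n}) a b : (0 < k)%N -> (2 * k < n)%N ->
  #|A| = 2%N -> a \notin A -> a != b ->
  exists I : {set 'I_n}, [/\ #|I| = k, a \in I, b \notin I & whole A I].
Proof.
move=> k0 kn A2 aA ab; have [|//||I [Ik aI dI]] := @card_set_avoiding _ (b |: A) a k.
- by rewrite !inE negb_or ab.
- rewrite card_ord cardsU1 A2; have [bA|bA] := boolP (b \in A); first by lia.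
  (* Here [a], [b] and the pair are four indices, so n >= 4; for k = 1 the bound 2k < n would only
     give n >= 3. *)
  have : (#|a |: (b |: A)| <= n)%N by rewrite -[X in (_ <= X)%N]card_ord; exact: max_card.
  by rewrite !cardsU1 !inE negb_or ab aA bA A2; lia.
exists I; split=> //.
  by move: dI; rewrite disjoint_sym => /pred0P/(_ b) /=; rewrite !inE eqxx => /= ->.
by apply: whole_disjoint; apply: disjointWr dI; exact: subsetUr.
Qed.

(** * Idempotents of rank k and bijections that preserve commutation *)

Section Rank.
Variable R : unitRingType.
Hypothesis divR : forall x : R, x != 0 -> x \is a GRing.unit.
Variable n : nat.
Implicit Types (E : glmx R n) (A B : 'M[R]_n) (I J : {set 'I_n}) (k m : nat).

Definition idem_rank k A := exists E (I : {set _}), #|I| = k /\ A = proj E I.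

Lemma idem_rank_proj E I : idem_rank #|I| (proj E I). Proof. by exists E, I. Qed.

Lemma idem_rank_set I : idem_rank #|I| (set_mx R I).
Proof. by exists (gl1 R n), I; rewrite proj_gl1. Qed.

Lemma idem_rankP k A : idem_rank k A -> A *m A = A.
Proof. by move=> [E [I [_ ->]]]; exact: proj_idem. Qed.

Lemma idem_rank_conj k E A : idem_rank k A -> idem_rank k (conj_mx E A).
Proof. by move=> [E' [I [Ik ->]]]; exists (glM E' E), I; rewrite proj_glM. Qed.

Lemma idem_rank_ex A : A *m A = A -> exists k, idem_rank k A.
Proof.
move=> AA; have [||E /(_ A (mem_head _ _))[I ->]] := simultaneous_diag divR (s := [:: A]).
- by move=> B; rewrite inE => /eqP->.
- by move=> B C; rewrite !inE => /eqP-> /eqP->.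
by exists #|I|; exact: idem_rank_proj.
Qed.

Lemma idem_rank_uniq k m A : idem_rank k A -> idem_rank m A -> k = m.
Proof. by move=> [E [I [<- ->]]] [E' [I' [<-]]]; exact: proj_card. Qed.

Lemma idem_rank0 A : idem_rank 0 A -> A = 0.
Proof. by move=> [E [I [/cards0_eq -> ->]]]; rewrite /proj set_mx0 conj_mx0. Qed.

Lemma set_mxU (I J : {set 'I_n}) : [disjoint I & J] -> set_mx R (I :|: J) = set_mx R I + set_mx R J.
Proof.
move=> /pred0P IJ; apply/matrixP=> i j; rewrite [RHS]mxE !set_mxE inE.
have := IJ i; rewrite /=; case: (i == j); rewrite ?addr0 //=.
by case: (i \in I); case: (i \in J); rewrite ?addr0 ?add0r.
Qed.

Lemma idem_rankD k m A B : idem_rank k A -> idem_rank m B -> A *m B = 0 -> B *m A = 0 ->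
  idem_rank (k + m) (A + B).
Proof.
move=> Ak Bm AB BA.
have [||E H] := simultaneous_diag divR (s := [:: A; B]).
- by move=> C; rewrite !inE => /orP[]/eqP->; [exact: idem_rankP Ak|exact: idem_rankP Bm].
- by move=> C D; rewrite !inE => /orP[]/eqP-> /orP[]/eqP->; rewrite ?AB ?BA.
have [I AI] := H A (mem_head _ _); have [|J BJ] := H B; first by rewrite !inE eqxx orbT.
have IJ : [disjoint I & J].
  rewrite -setI_eq0; apply/eqP/(@set_mx_inj R)/(@conj_mx_inj _ _ E).
  by rewrite -set_mxM conj_mxM -/(proj _ _) -/(proj _ _) -AI -BJ AB set_mx0 conj_mx0.
have -> : A + B = proj E (I :|: J) by rewrite /proj set_mxU // conj_mxD AI BJ.
have -> : k = #|I| by apply: idem_rank_uniq Ak _; rewrite AI; exact: idem_rank_proj.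
have -> : m = #|J| by apply: idem_rank_uniq Bm _; rewrite BJ; exact: idem_rank_proj.
by rewrite -cardsUI (disjoint_setI0 IJ) cards0 addn0; exact: idem_rank_proj.
Qed.

Lemma idem_div (x : R) : x * x = x -> x = 0 \/ x = 1.
Proof.
have [->|/divR ux xx] := eqVneq x 0; first by left.
by right; apply: (mulrI ux); rewrite mulr1.
Qed.

Lemma mulf_neq0_div (x y : R) : x != 0 -> y != 0 -> x * y != 0.
Proof.
move=> /divR ux y0; apply: contraNneq y0 => xy; apply/eqP/(mulrI ux).
by rewrite xy mulr0.
Qed.

Lemma idem_diag k A : idem_rank k A -> (forall i j, i != j -> A i j = 0) ->
  exists2 I : {set 'I_n}, #|I| = k & A = set_mx R I.
Proof.
move=> Ak Ad; pose I := [set i | A i i == 1].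
have AE : A = set_mx R I.
  apply/matrixP=> i j; rewrite set_mxE; have [<-|/Ad ->//] := eqVneq i j.
  rewrite inE /=; have /matrixP/(_ i i) := idem_rankP Ak.
  rewrite mxE (bigD1 i) //= big1 ?addr0 => [|l li]; last by rewrite [A l i]Ad // mulr0.
  by case/idem_div => ->; rewrite ?eqxx // eq_sym oner_eq0.
by exists I => //; apply: idem_rank_uniq Ak; rewrite AE; exact: idem_rank_set.
Qed.

Lemma noncomm_set A I : A *m set_mx R I <> set_mx R I *m A ->
  exists i j, [/\ i != j, (i \in I) != (j \in I) & A i j != 0].
Proof.
move=> H; apply: contrapT => K; apply: H; apply/comm_set_mx => i j ij.
apply: contrapT => /eqP Aij; apply: K; exists i, j; split => //.
by apply: contraNneq ij => ->.
Qed.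

Lemma comm_set_entry A I i j : A *m set_mx R I = set_mx R I *m A -> A i j != 0 ->
  (i \in I) = (j \in I).
Proof. by move=> /comm_set_mx H; apply: contraNeq => /H ->. Qed.

Lemma comm_all_set k A : (0 < k < n)%N ->
  (forall I : {set 'I_n}, #|I| = k -> A *m set_mx R I = set_mx R I *m A) ->
  forall i j, i != j -> A i j = 0.
Proof.
move=> /andP[k0 kn] H i j ij.
have [|//||I [Ik iI]] := @card_set_avoiding _ [set j] i k; rewrite ?inE //.
  by rewrite cards1 addn1 card_ord.
rewrite disjoint_sym disjoints1 => jI; apply: contraTeq iI => Aij.
by rewrite (comm_set_entry (H I Ik) Aij).
Qed.

Lemma mxB m p (A B : 'M[R]_(m, p)) i j : (A - B) i j = A i j - B i j.
Proof. by rewrite !mxE. Qed.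
Lemma mxD m p (A B : 'M[R]_(m, p)) i j : (A + B) i j = A i j + B i j.
Proof. by rewrite mxE. Qed.

Lemma gl_elem_entry (i j a b : 'I_n) (c : R) (ij : i != j) :
  gl_elem c ij a b = (a == b)%:R + c *+ ((a == i) && (b == j)).
Proof. by rewrite !mxE; case: (_ && _); rewrite ?mulr1 ?mulr0 ?mulr1n. Qed.
Lemma gl_elem_inv_entry (i j a b : 'I_n) (c : R) (ij : i != j) :
  glmx_inv (gl_elem c ij) a b = (a == b)%:R - c *+ ((a == i) && (b == j)).
Proof. by rewrite !mxE; case: (_ && _); rewrite ?mulr1 ?mulr0 ?mulr1n ?oppr0. Qed.

Lemma conj_elem_set (i j : 'I_n) (c : R) (ij : i != j) I : (i \in I) = (j \in I) ->
  conj_mx (gl_elem c ij) (set_mx R I) = set_mx R I.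
Proof.
move=> ijI; rewrite /conj_mx -mulmxA; apply: canLR (glmxK _) _; apply/esym/comm_set_mx => a b ab.
rewrite gl_elem_entry; have [E|_] := eqVneq a b; first by rewrite E eqxx in ab.
have [ai|] //= := eqVneq a i; last by rewrite addr0.
have [bj|] //= := eqVneq b j; last by rewrite addr0.
by rewrite ai bj ijI eqxx in ab.
Qed.

Lemma proj_elem (i j : 'I_n) (c : R) (ij : i != j) I : i \in I -> j \notin I ->
  proj (gl_elem c ij) I = set_mx R I + c *: delta_mx i j.
Proof.
move=> iI jI; rewrite /proj /conj_mx.
have -> : glmx_inv (gl_elem c ij) *m set_mx R I = set_mx R I.
  apply/matrixP=> a b; rewrite mul_mx_set gl_elem_inv_entry set_mxE.
  case: (a =P b) => [->|_]; case: (b =P j) => [->|_];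
    rewrite ?(negPf jI) ?andbF ?subr0 ?mulr0n //= ?subr0; by case: (b \in I).
apply/matrixP=> a b; rewrite mul_set_mx gl_elem_entry [RHS]mxE set_mxE !mxE.
case: (a =P i) => [->|_]; rewrite ?iI /= ?addr0 ?mulr0 ?andbT ?addr0.
  by rewrite mulr1n mulr_natr.
by case: (a == b); case: (a \in I); rewrite ?mulr1n ?mulr0n ?mul0rn.
Qed.

Lemma proj_elemC (i j : 'I_n) (c : R) (ij : i != j) I : i \notin I -> j \in I ->
  proj (gl_elem c ij) I = set_mx R I - c *: delta_mx i j.
Proof.
move=> iI jI; rewrite -[in LHS](setCK I) projC proj_elem ?inE ?negbK //.
by rewrite set_mxC opprD opprB addrA subrKC.
Qed.

(** Both maps are total on matrices, with arbitrary values outside the idempotents of rank [k];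
    carrying the inverse [g] makes the notion symmetric. *)
Definition comm_bij k (f g : 'M[R]_n -> 'M[R]_n) :=
  [/\ forall A, idem_rank k A -> idem_rank k (f A) /\ g (f A) = A,
      forall A, idem_rank k A -> idem_rank k (g A) /\ f (g A) = A &
      forall A B, idem_rank k A -> idem_rank k B ->
        (A *m B = B *m A <-> f A *m f B = f B *m f A)].

Lemma comm_bij_sym k f g : comm_bij k f g -> comm_bij k g f.
Proof.
move=> [F G C]; split=> // A B rA rB; have [rgA fgA] := G A rA; have [rgB fgB] := G B rB.
by rewrite (C _ _ rgA rgB) fgA fgB.
Qed.

Lemma comm_bij_conj k E E' f g : comm_bij k f g ->
  comm_bij k (fun A => conj_mx E' (f (conj_mx E A))) (fun A => conj_mx (glI E) (g (conj_mx (glI E') A))).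
Proof.
move=> [F G C]; split=> [A rA|A rA|A B rA rB].
- have [rf gf] := F _ (idem_rank_conj E rA); split; first exact: idem_rank_conj.
  by rewrite conj_mxI gf conj_mxI.
- have [rf gf] := G _ (idem_rank_conj (glI E') rA); split; first exact: idem_rank_conj.
  by rewrite conj_mxIV gf conj_mxIV.
by rewrite conj_comm -C ?conj_comm //; exact: idem_rank_conj.
Qed.

(** Maximality of the commuting set of a frame: in the coordinates of the frame, an entry at (i, j)
    is killed by a k-set that contains i and not j. *)
Lemma frame_max k E A : (0 < k < n)%N -> idem_rank k A ->
  (forall I : {set 'I_n}, #|I| = k -> A *m proj E I = proj E I *m A) ->
  exists2 I : {set _}, #|I| = k & A = proj E I.
Proof.
move=> kn rA H; have [|I Ik AE] := idem_diag (idem_rank_conj (glI E) rA).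
  apply: comm_all_set kn _ => I /H HI.
  by apply/(conj_comm E); rewrite conj_mxIV; exact: HI.
by exists I => //; rewrite /proj -AE conj_mxIV.
Qed.

Lemma frame_image k f g E : comm_bij k f g ->
  exists E', forall I : {set 'I_n}, #|I| = k -> exists2 J : {set _}, #|J| = k & f (proj E I) = proj E' J.
Proof.
move=> [F G C].
pose s := [seq f (proj E K) | K <- [seq K : {set 'I_n} <- enum {: {set 'I_n}} | #|K| == k]].
have sP A : A \in s -> exists2 I : {set _}, #|I| = k & A = f (proj E I).
  by move=> /mapP[I]; rewrite mem_filter => /andP[/eqP Ik _] ->; exists I.
have rP I : #|I| = k -> idem_rank k (proj E I) by move=> <-; exact: idem_rank_proj.
have [A /sP[I /rP rI ->]|A B /sP[I /rP rI ->] /sP[J /rP rJ ->]|E' HE'] := simultaneous_diag divR (s := s).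
- by have [/idem_rankP] := F _ rI.
- by apply: (C _ _ rI rJ).1; exact: proj_comm.
exists E' => I Ik; have [|J fE] := HE' (f (proj E I)).
  by apply: map_f; rewrite mem_filter Ik eqxx mem_enum.
exists J => //; have [rf _] := F _ (rP _ Ik).
by apply: idem_rank_uniq rf; rewrite fE; exact: idem_rank_proj.
Qed.

(** The image under [g] commutes with every [proj E I], because this can be tested after applying
    [f], inside the frame [E']; maximality then applies. *)
Lemma frame_preimage k f g E E' : (0 < k < n)%N -> comm_bij k f g ->
  (forall I : {set 'I_n}, #|I| = k -> exists2 J : {set _}, #|J| = k & f (proj E I) = proj E' J) ->
  (forall J : {set 'I_n}, #|J| = k -> exists2 I : {set _}, #|I| = k & g (proj E' J) = proj E I).
Proof.
move=> kn [F G C] H J Jk; have rJ : idem_rank k (proj E' J) by rewrite -Jk; exact: idem_rank_proj.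
have [rg fg] := G _ rJ; apply: frame_max => // I Ik.
have rI : idem_rank k (proj E I) by rewrite -Ik; exact: idem_rank_proj.
by apply: (C _ _ rg rI).2; rewrite fg; have [J' _ ->] := H I Ik; exact: proj_comm.
Qed.

End Rank.

(** * Pairs of indices seen through commutation *)

Section PermFrame.
Variable R : unitRingType.
Hypothesis divR : forall x : R, x != 0 -> x \is a GRing.unit.
Variables (n k : nat).
Hypothesis (k2 : (2 <= k)%N) (kn : (2 * k < n)%N).
Implicit Types (A B I J : {set 'I_n}) (Z : 'M[R]_n).

Let k_gt0 : (0 < k)%N. Proof. exact: ltnW. Qed.
Let k1n : (k + 1 <= n)%N. Proof. lia. Qed.
Let k3n : (k + 3 <= n)%N. Proof. lia. Qed.
Let k_bool_leq (b : bool) : (k + (b + 2) <= n)%N.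
Proof. by apply: leq_trans k3n; rewrite leq_add2l; case: b. Qed.

(* For a pair [A] this says that [Z] has a nonzero off-diagonal entry and that
   all such entries have both indices in [A]; only commutation is used, so
   that [comm_bij] preserves it. *)
Definition pair_idem A Z :=
  [/\ idem_rank k Z,
      forall I : {set _}, #|I| = k -> whole A I -> Z *m set_mx R I = set_mx R I *m Z &
      exists2 I : {set _}, #|I| = k & Z *m set_mx R I <> set_mx R I *m Z].

Let avoid3 A a b : #|A| = 2%N -> a \notin A -> a != b ->
  exists I, [/\ #|I| = k, a \in I, b \notin I & whole A I].
Proof. exact: card_set_separating. Qed.

(** If one of [i], [j] is outside [A], some k-set separates them without cutting [A], and
    commutation with it kills the entry. *)
Lemma pair_idem_supp A Z i j : #|A| = 2%N -> pair_idem A Z -> i != j -> Z i j != 0 ->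
  i \in A /\ j \in A.
Proof.
move=> A2 [_ ZA _] ij Zij; apply/andP; apply: contraTT isT; rewrite negb_and => /orP[iA|jA].
  have [I [Ik iI jI wI]] := avoid3 A2 iA ij.
  by have := comm_set_entry (ZA I Ik wI) Zij; rewrite iI (negPf jI).
rewrite eq_sym in ij; have [I [Ik jI iI wI]] := avoid3 A2 jA ij.
by have := comm_set_entry (ZA I Ik wI) Zij; rewrite jI (negPf iI).
Qed.

Lemma pair_idem_offdiag A Z : #|A| = 2%N -> pair_idem A Z ->
  exists i j, [/\ i != j, A = [set i; j] & Z i j != 0].
Proof.
move=> A2 ZA; have [_ _ [I _ /noncomm_set[i [j [ij _ Zij]]]]] := ZA.
by exists i, j; split=> //; have [iA jA] := pair_idem_supp A2 ZA ij Zij; exact: set2_eq.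
Qed.

Lemma pair_idemI i j Z : i != j -> idem_rank k Z ->
  (forall a b, a != b -> Z a b != 0 -> a \in [set i; j] /\ b \in [set i; j]) ->
  (exists a b, a != b /\ Z a b != 0) -> pair_idem [set i; j] Z.
Proof.
move=> ij Zk H [a [b [ab Zab]]]; split=> //.
  move=> I Ik; rewrite whole2 => /eqP wI; apply/comm_set_mx => c d cd.
  have cd' : c != d by apply: contraNneq cd => ->.
  apply: contraTeq cd => /(H _ _ cd')[]; rewrite !inE.
  by move=> /orP[]/eqP-> /orP[]/eqP->; rewrite ?wI eqxx.
have [|||I [Ik aI]] := @card_set_avoiding _ [set b] a k.
- by rewrite inE.
- by [].
- by rewrite cards1 card_ord.
rewrite disjoint_sym disjoints1 => bI; exists I => // /comm_set_entry/(_ Zab).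
by rewrite aI (negPf bI).
Qed.

Lemma pair_idem_elem (i j : 'I_n) I : i != j -> #|I| = k -> i \in I -> j \notin I ->
  pair_idem [set i; j] (set_mx R I + delta_mx i j).
Proof.
move=> ij Ik iI jI; rewrite -(scale1r (delta_mx i j)) -(proj_elem 1 ij) //; apply: pair_idemI => //.
- by rewrite -Ik; exact: idem_rank_proj.
- move=> a b ab; rewrite proj_elem // scale1r mxD set_mxE (negPf ab) add0r mxE !inE.
  by case: (a =P i) => [->|_]; case: (b =P j) => [->|_]; rewrite ?eqxx ?orbT.
exists i, j; split=> //; rewrite proj_elem // scale1r mxD set_mxE (negPf ij) add0r mxE !eqxx.
exact: oner_neq0.
Qed.

Lemma ex_pair_idem A : #|A| = 2%N -> exists Z, pair_idem A Z.
Proof.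
move=> A2; have /eqP/cards2P[i [j [ij ->]]] := A2.
have [|||I [Ik iI]] := @card_set_avoiding _ [set j] i k.
- by rewrite inE.
- by [].
- by rewrite cards1 card_ord.
rewrite disjoint_sym disjoints1 => jI.
by exists (set_mx R I + delta_mx i j); exact: pair_idem_elem.
Qed.

Lemma mulmx_supp Z Z' (i j l : 'I_n) : (forall a, a != j -> Z i a * Z' a l = 0) ->
  (Z *m Z') i l = Z i j * Z' j l.
Proof. by move=> H; rewrite mxE (bigD1 j) //= big1 ?addr0. Qed.

(* For pairs this holds iff they are disjoint.  If [n = 6] and [k = 2], counting
   does not distinguish disjoint pairs from pairs with a common element: 3
   subsets of size [k] cut neither pair, in both cases. *)
Definition commuting_pairs A B := forall Z, pair_idem A Z -> exists Z1 Z2,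
  [/\ pair_idem A Z1, pair_idem B Z2, Z *m Z1 = Z1 *m Z & Z1 *m Z2 = Z2 *m Z1].

(** Outside [A] the matrix [Z] is diagonal with entries 0 and 1, so [Z] is [P + set_mx R I'] with
    [P] supported on [A]. Moving [I'] away from [A] and [B] gives [Z1], whose rows and columns in
    [B] vanish; [Z2] has a diagonal set [K] that avoids [A]. *)
Lemma disjoint_commuting A B : #|A| = 2%N -> #|B| = 2%N -> [disjoint A & B] ->
  commuting_pairs A B.
Proof.
move=> A2 B2 dAB Z ZA; have [Zk _ _] := ZA.
have Zd a b : a != b -> a \notin A -> Z a b = 0.
  move=> ab aA; apply: contraTeq isT => Zab.
  by have [aA'] := pair_idem_supp A2 ZA ab Zab; rewrite aA' in aA.
have Zd' a b : a != b -> b \notin A -> Z a b = 0.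
  move=> ab bA; apply: contraTeq isT => Zab.
  by have [_ bA'] := pair_idem_supp A2 ZA ab Zab; rewrite bA' in bA.
pose I' := [set a | (a \notin A) && (Z a a == 1)].
have Z01 a : a \notin A -> Z a a = (a \in I')%:R.
  move=> aA; rewrite inE aA /=; have /matrixP/(_ a a) := idem_rankP Zk.
  rewrite (mulmx_supp (j := a)) => [|b ba]; last by rewrite (Zd a b) 1?eq_sym // mul0r.
  by case/(idem_div divR) => ->; rewrite ?eqxx // eq_sym oner_eq0.
have I'A a : a \in I' -> a \notin A by rewrite inE => /andP[].
have ZI : Z *m set_mx R I' = set_mx R I'.
  apply/matrixP=> a b; rewrite mul_mx_set set_mxE.
  have [->|ab] := eqVneq a b; have [bI|_] /= := boolP (b \in I'); rewrite ?andbF //=.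
    by rewrite Z01 ?I'A // bI.
  by rewrite Zd' ?I'A.
have IZ : set_mx R I' *m Z = set_mx R I'.
  apply/matrixP=> a b; rewrite mul_set_mx set_mxE.
  have [<-|ab] := eqVneq a b; have [aI|_] /= := boolP (a \in I'); rewrite ?andbF //=.
    by rewrite Z01 ?I'A // aI.
  by rewrite Zd ?I'A.
have II (J : {set 'I_n}) : set_mx R J *m set_mx R J = set_mx R J by rewrite set_mxM setIid.
have [P PE] : exists P, P = Z - set_mx R I' by eexists.
have PI : P *m set_mx R I' = 0 by rewrite PE mulmxBl ZI II subrr.
have IP : set_mx R I' *m P = 0 by rewrite PE mulmxBr IZ II subrr.
have PP : P *m P = P by rewrite {1}PE mulmxBl IP subr0 PE mulmxBr ZI (idem_rankP Zk).
have Psupp a b : P a b != 0 -> a \in A /\ b \in A.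
  move=> Pab; apply/andP; apply: contraNT Pab; rewrite negb_and PE mxB set_mxE.
  have [<-|ab] := eqVneq a b; first by rewrite orbb => aA; rewrite Z01 // subrr.
  by move=> /orP[aA|bA]; rewrite subr0; [rewrite (Zd _ _ ab aA)|rewrite (Zd' _ _ ab bA)].
have [m Pm] := idem_rank_ex divR PP.
have [i [j [ij AE Zij]]] := pair_idem_offdiag A2 ZA.
have offP a b : a != b -> P a b = Z a b.
  by move=> ab; rewrite PE mxB set_mxE (negPf ab) subr0.
have km : k = (m + #|I'|)%N.
  apply: (idem_rank_uniq divR Zk); have -> : Z = P + set_mx R I' by rewrite PE subrK.
  by apply: idem_rankD => //; exact: idem_rank_set.
have m0 : (0 < m)%N.
  rewrite lt0n; apply: contraNneq Zij => m0; rewrite -offP //.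
  by rewrite m0 in Pm; rewrite (idem_rank0 Pm) mxE.
(* As [P] has rank at least 1, [I'] has at most k - 1 elements, and k - 1 + 4 <= n. With k elements
   there would be no room if k = 2 and n = 5. *)
have [|J /subsetP JAB Jc] := @subset_of_card _ (~: (A :|: B)) #|I'|.
  have := cardsC (A :|: B); rewrite cardsU (disjoint_setI0 dAB) cards0 subn0 A2 B2 card_ord; lia.
have PJ0 a b : b \in J -> P a b = 0.
  move=> /JAB; rewrite !inE negb_or => /andP[bA _]; apply: contraNeq bA => /Psupp[] //.
have P0J a b : a \in J -> P a b = 0.
  move=> /JAB; rewrite !inE negb_or => /andP[aA _]; apply: contraNeq aA => /Psupp[] //.
have PJ : P *m set_mx R J = 0.
  by apply/matrixP=> a b; rewrite mul_mx_set [RHS]mxE; case: (boolP (b \in J)) => // bJ; rewrite PJ0.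
have JP : set_mx R J *m P = 0.
  by apply/matrixP=> a b; rewrite mul_set_mx [RHS]mxE; case: (boolP (a \in J)) => // aJ; rewrite P0J.
have [Z1 Z1E] : exists Z1, Z1 = P + set_mx R J by eexists.
have Z1k : idem_rank k Z1.
  by rewrite Z1E km -Jc; apply: idem_rankD => //; exact: idem_rank_set.
have off1 a b : a != b -> Z1 a b = Z a b.
  by move=> ab; rewrite Z1E mxD set_mxE (negPf ab) addr0 offP.
have ZA1 : pair_idem A Z1.
  rewrite AE; apply: pair_idemI => // [a b ab|]; last by exists i, j; rewrite off1.
  by rewrite off1 // -AE; exact: pair_idem_supp.
have /eqP/cards2P[x [y [xy BE]]] := B2.
have xA : x \notin A by rewrite (disjointFl dAB) // BE !inE eqxx.
have yA : y \notin A by rewrite (disjointFl dAB) // BE !inE eqxx orbT.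
have xJ : x \notin J by apply/negP=> /JAB; rewrite !inE BE !inE eqxx orbT.
have yJ : y \notin J by apply/negP=> /JAB; rewrite !inE BE !inE eqxx !orbT.
have [|||K [Kk xK dK]] := @card_set_avoiding _ (y |: A) x k.
- by rewrite !inE negb_or xy.
- by [].
- by rewrite card_ord cardsU1 A2.
have yK : y \notin K.
  by move: dK; rewrite disjoint_sym => /pred0P/(_ y) /=; rewrite !inE eqxx => /= ->.
have AK a : a \in A -> a \notin K.
  by move=> aA; move: dK; rewrite disjoint_sym => /pred0P/(_ a) /=; rewrite !inE aA orbT => /= ->.
exists Z1, (set_mx R K + delta_mx x y); split=> //.
- by rewrite BE; exact: pair_idem_elem.
- have -> : Z = P + set_mx R I' by rewrite PE subrK.
  by rewrite Z1E !mulmxDl !mulmxDr PJ JP PI IP !set_mxM setIC.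
have Z1K : Z1 *m set_mx R K = set_mx R K *m Z1.
  apply/comm_set_mx => a b ab; have ab' : a != b by apply: contraNneq ab => ->.
  apply: contraNeq ab => /(pair_idem_supp A2 ZA1 ab')[/AK/negPf-> /AK/negPf->].
  by rewrite eqxx.
have Z1D : Z1 *m delta_mx x y = 0.
  apply/matrixP=> a b; rewrite !mxE big1 // => c _; rewrite [delta_mx _ _ _ _]mxE.
  have [->|] := eqVneq c x; last by rewrite mulr0.
  have -> : Z1 a x = 0; last by rewrite mul0r.
  have [->|yb] := eqVneq a x; last by rewrite off1 // Zd'.
  rewrite Z1E mxD set_mxE (negPf xJ) andbF addr0.
  by apply: contraTeq isT => /Psupp[]; rewrite (negPf xA).
have DZ1 : delta_mx x y *m Z1 = 0.
  apply/matrixP=> a b; rewrite !mxE big1 // => c _; rewrite [delta_mx _ _ _ _]mxE.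
  have [->|] := eqVneq c y; last by rewrite andbF mul0r.
  have -> : Z1 y b = 0; last by rewrite mulr0.
  have [<-|yb] := eqVneq y b; last by rewrite off1 // Zd.
  rewrite Z1E mxD set_mxE (negPf yJ) andbF addr0.
  by apply: contraTeq isT => /Psupp[]; rewrite (negPf yA).
by rewrite mulmxDr mulmxDl Z1K Z1D DZ1.
Qed.

Lemma inter_not_commuting (nz2 : 2%:R != 0 :> R) i j l : i != j -> j != l -> i != l ->
  ~ commuting_pairs [set i; j] [set j; l].
Proof.
move=> ij jl il.
have [|||I [Ik iI]] := @card_set_avoiding _ [set j] i k.
- by rewrite inE.
- by [].
- by rewrite cards1 card_ord.
rewrite disjoint_sym disjoints1 => jI.
have ji : j != i by rewrite eq_sym.
have elem a b (ab : a != b) : exists e : glmx R n,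
    [/\ forall c d, e c d = (c == d)%:R + ((c == a) && (d == b))%:R,
        forall c d, glmx_inv e c d = (c == d)%:R - ((c == a) && (d == b))%:R &
        forall K : {set 'I_n}, (a \in K) = (b \in K) -> conj_mx e (set_mx R K) = set_mx R K].
  exists (gl_elem 1 ab); split=> [c d|c d|]; first exact: gl_elem_entry.
    exact: gl_elem_inv_entry.
  exact: conj_elem_set.
have [e1 [e1E e1V e1K]] := elem _ _ ij; have [e2 [e2E e2V e2K]] := elem _ _ ji.
(* The block of [Z] at [i, j] is [[2, 1], [-2, -1]], without vanishing entries
   since [2 != 0]: an idempotent for the pair [i, j] that commutes with [Z] is
   not triangular, hence commutes with no idempotent for the pair [j, l]. *)
pose h := glM e1 e2.
pose Z := proj h I.
have hi b : h i b = (i == b)%:R *+ 2 + (j == b)%:R.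
  rewrite /h /= mxE (bigD1 i) //= (bigD1 j) //= big1 ?addr0 => [|c /andP[ci cj]]; last first.
    by rewrite e1E (negPf cj) andbF addr0 eq_sym (negPf ci) mul0r.
  rewrite !e1E !e2E !eqxx (negPf ij) /= add0r !addr0 !mul1r.
  by rewrite [b == i]eq_sym addrCA -mulr2n addrC.
have hV a c : c \in I -> glmx_inv h a c = (a == c)%:R - ((a == j) && (c == i))%:R.
  move=> cI; have cj : c != j by apply: contraNneq jI => <-.
  rewrite /h /= mxE (bigD1 c) //= big1 => [|d dc]; last first.
    by rewrite e1V (negPf dc) sub0r (negPf cj) andbF oppr0 mulr0.
  by rewrite addr0 e2V e1V eqxx (negPf cj) andbF subr0 mulr1.
have Zi b : Z i b = (i == b)%:R *+ 2 + (j == b)%:R.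
  rewrite /Z /proj /conj_mx mxE (bigD1 i) //= big1 ?addr0 => [|c ci]; last first.
    rewrite mul_mx_set; have [cI|] := boolP (c \in I); last by rewrite mul0r.
    by rewrite hV // eq_sym (negPf ci) (negPf ij) subr0 mul0r.
  by rewrite mul_mx_set iI hV // eqxx (negPf ij) subr0 mul1r hi.
have Z_i a : a != i -> Z a i = - (a == j)%:R *+ 2.
  move=> ai; rewrite /Z /proj /conj_mx mxE (bigD1 i) //= big1 ?addr0 => [|c ci]; last first.
    rewrite mul_mx_set; have [cI|] := boolP (c \in I); last by rewrite mul0r.
    suff -> : h c i = 0 by rewrite mulr0.
    have cj : c != j by apply: contraNneq jI => <-.
    rewrite /h /= mxE big1 // => d _; rewrite e1E (negPf ci) addr0.
    have [<-|] := eqVneq c d; last by rewrite mul0r.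
    by rewrite e2E (negPf cj) (negPf ci) /= add0r mulr0.
  by rewrite mul_mx_set iI hV // (negPf ai) eqxx andbT sub0r hi eqxx (negPf ji) addr0 mulrnAr mulr1.
have two (x : R) : x *+ 2 = 0 -> x = 0.
  by rewrite -mulr_natr => H; apply: contraTeq isT => /mulf_neq0_div-/(_ divR _ nz2); rewrite H eqxx.
have ZA : pair_idem [set i; j] Z.
  split; first by rewrite -Ik; exact: idem_rank_proj.
    move=> K _; rewrite whole2 => /eqP ijK.
    have <- : conj_mx h (set_mx R K) = set_mx R K by rewrite conj_glM e1K ?e2K.
    by apply/conj_comm; rewrite !set_mxM setIC.
  exists I => // /comm_set_entry-/(_ i j); rewrite iI (negPf jI) Zi (negPf ij) eqxx mul0rn add0r.
  by move=> /(_ (oner_neq0 _)).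
move=> /(_ Z ZA)[Z1 [Z2 [ZA1 ZB2 C1 C2]]].
have Z1_0 a b : a != b -> (a \notin [set i; j]) || (b \notin [set i; j]) -> Z1 a b = 0.
  move=> ab; apply: contraTeq => /(pair_idem_supp _ ZA1 ab); rewrite cards2 ij => /(_ erefl)[-> ->] //.
have Z2_0 a b : a != b -> (a \notin [set j; l]) || (b \notin [set j; l]) -> Z2 a b = 0.
  move=> ab; apply: contraTeq => /(pair_idem_supp _ ZB2 ab); rewrite cards2 jl => /(_ erefl)[-> ->] //.
(* Compare the entries of [Z *m Z1] and [Z1 *m Z] at (i, i). By this relation the two off-diagonal
   entries of [Z1] vanish together. *)
have E1 : Z1 j i = - (Z1 i j *+ 2).
  have := congr1 (fun M : 'M_n => M i i) C1; rewrite /= !mxE.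
  rewrite (bigD1 i) //= (bigD1 j) //= big1 ?addr0 => [|c /andP[ci cj]]; last first.
    by rewrite Zi ![_ == c]eq_sym (negPf ci) (negPf cj) mul0rn addr0 mul0r.
  rewrite (bigD1 i) //= (bigD1 j) //= big1 ?addr0 => [|c /andP[ci cj]]; last first.
    by rewrite Z_i // (negPf cj) oppr0 mul0rn mulr0.
  rewrite !Zi Z_i // !eqxx (negPf ij) (negPf ji) mul0rn addr0 add0r mul1r.
  by rewrite mulrnAl mulrnAr mul1r mulr1 mulrnAr mulrN1 mulNrn => /addrI.
have off (x y : 'I_n) (M : 'M[R]_n) : x != y -> pair_idem [set x; y] M -> M x y != 0 \/ M y x != 0.
  move=> xy /pair_idem_offdiag; rewrite cards2 xy => /(_ erefl)[p [q [pq E Mpq]]].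
  have /setP/(_ p) := E; have /setP/(_ q) := E; rewrite !inE !eqxx orbT.
  move=> /orP[]/eqP ? /orP[]/eqP ?; subst; rewrite ?eqxx in pq; try by []; by [left|right].
have nij : Z1 i j != 0.
  by have [//|] := off _ _ _ ij ZA1; apply: contraNneq => E; rewrite E1 E mul0rn oppr0.
have nji : Z1 j i != 0.
  by apply: contraNneq nij => /eqP; rewrite E1 oppr_eq0 => /eqP/two ->.
have lj : l != j by rewrite eq_sym.
have li : l != i by rewrite eq_sym.
(* At (i, l) the product [Z1 *m Z2] has only the term through [j], and [Z2 *m Z1] vanishes; [F2] is
   the analogue at (l, i). *)
have F1 : Z1 i j * Z2 j l = 0.
  have := congr1 (fun M : 'M_n => M i l) C2; rewrite /= (mulmx_supp (j := j)) => [->|a aj].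
    rewrite mxE big1 // => c _; have [->|ci] := eqVneq c i.
      by rewrite [Z1 i l]Z1_0 ?mulr0 // !inE !negb_or li lj orbT.
    by rewrite [Z2 i c]Z2_0 ?mul0r 1?eq_sym // !inE !negb_or ij il.
  have [->|al] := eqVneq a l; first by rewrite [Z1 i l]Z1_0 ?mul0r // !inE !negb_or li lj orbT.
  by rewrite [Z2 a l]Z2_0 ?mulr0 // !inE !negb_or aj al.
have F2 : Z2 l j * Z1 j i = 0.
  have := congr1 (fun M : 'M_n => M l i) (esym C2); rewrite /= (mulmx_supp (j := j)) => [->|a aj].
    rewrite mxE big1 // => c _; have [->|cl] := eqVneq c l.
      by rewrite [Z2 l i]Z2_0 ?mulr0 // !inE !negb_or ij il orbT.
    by rewrite [Z1 l c]Z1_0 ?mul0r 1?eq_sym // !inE !negb_or li lj.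
  have [->|ai] := eqVneq a i; first by rewrite [Z2 l i]Z2_0 ?mul0r // !inE !negb_or ij il orbT.
  by rewrite [Z1 a i]Z1_0 ?mulr0 // !inE !negb_or aj ai.
have [H|H] := off _ _ _ jl ZB2.
  by have := mulf_neq0_div divR nij H; rewrite F1 eqxx.
by have := mulf_neq0_div divR H nji; rewrite F2 eqxx.
Qed.

Section Frame.
Variables (f g : 'M[R]_n -> 'M[R]_n) (t t' : {set 'I_n} -> {set 'I_n}).
Hypothesis fg : comm_bij k f g.
Hypothesis ft : forall I, #|I| = k -> #|t I| = k /\ f (set_mx R I) = set_mx R (t I).
Hypothesis gt : forall I, #|I| = k -> #|t' I| = k /\ g (set_mx R I) = set_mx R (t' I).

Lemma tK I : #|I| = k -> t' (t I) = I.
Proof.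
move=> Ik; have [tk fE] := ft Ik; have [_ gE] := gt tk; apply: (@set_mx_inj R).
by rewrite -gE -fE; have [/(_ (set_mx R I))[]//] := fg; rewrite -Ik; exact: idem_rank_set.
Qed.

Lemma rank_set I : #|I| = k -> idem_rank k (set_mx R I).
Proof. by move=> <-; exact: idem_rank_set. Qed.

(** One off-diagonal entry of [f Z] suffices: [f Z] commutes with the images of all sets that do not
    cut [A], so none of these images separates its two indices. *)
Lemma pair_image1 A : #|A| = 2%N -> exists2 A' : {set _}, #|A'| = 2%N &
  forall I, #|I| = k -> whole A I -> whole A' (t I).
Proof.
move=> A2; have [Z [Zk ZA [I Ik ZI]]] := ex_pair_idem A2.
have [F G C] := fg.
have /noncomm_set[i [j [ij _ fZij]]] : f Z *m set_mx R (t I) <> set_mx R (t I) *m f Z.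
  by rewrite -(ft Ik).2 => H; apply: ZI; exact: (C _ _ Zk (rank_set Ik)).2.
exists [set i; j] => [|J Jk wJ]; first by rewrite cards2 ij.
rewrite whole2; apply/eqP; apply: comm_set_entry fZij.
rewrite -(ft Jk).2; apply: (C _ _ Zk (rank_set Jk)).1; exact: ZA.
Qed.

Lemma whole_subset A B : #|A| = 2%N -> #|B| = 2%N ->
  (forall I, #|I| = k -> whole A I -> whole B I) -> A = B.
Proof.
move=> A2 B2 H; apply/esym/eqP; rewrite eqEcard A2 B2 leqnn andbT.
apply/subsetP=> b bB; apply: contraT => bA; have [c bc BE] := set2P B2 bB.
have [I [Ik bI cI wA]] := avoid3 A2 bA bc.
by have := H I Ik wA; rewrite BE whole2 bI (negPf cI).
Qed.

End Frame.

Section Frame2.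
Variables (f g : 'M[R]_n -> 'M[R]_n) (t t' : {set 'I_n} -> {set 'I_n}).
Hypothesis fg : comm_bij k f g.
Hypothesis ft : forall I, #|I| = k -> #|t I| = k /\ f (set_mx R I) = set_mx R (t I).
Hypothesis gt : forall I, #|I| = k -> #|t' I| = k /\ g (set_mx R I) = set_mx R (t' I).
Let gf := comm_bij_sym fg.

(** Going forth by [f] and back by [g] leads from [A] to a pair that is uncut whenever [A] is. By
    [whole_subset] it is [A] itself, which turns the implications into an equality. *)
Lemma pair_image A : #|A| = 2%N -> exists2 A' : {set _}, #|A'| = 2%N &
  forall I, #|I| = k -> whole A I = whole A' (t I).
Proof.
move=> A2; have [A' A'2 AA'] := pair_image1 fg ft A2.
have [A'' A''2 A'A''] := pair_image1 gf gt A'2.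
have E : A = A''.
  apply: whole_subset => // I Ik wI; rewrite -(tK fg ft gt Ik); apply: A'A'' (AA' _ Ik wI).
  by case: (ft Ik).
exists A' => // I Ik; apply/idP/idP; first exact: AA'.
by move=> wI; rewrite E -(tK fg ft gt Ik); apply: A'A''; case: (ft Ik).
Qed.

End Frame2.

End PermFrame.

(** * Whitney's argument: the permutation of the indices *)

Section Whitney.
Variable T : finType.
(** On four elements the result fails: exchanging one pair with its complement and fixing the other
    pairs preserves the relation of meeting. *)
Hypothesis T5 : (5 <= #|T|)%N.
Variable b : {set T} -> {set T}.
Hypothesis b2 : forall A : {set T}, #|A| = 2%N -> #|b A| = 2%N.
Hypothesis b_inj : forall A B : {set T}, #|A| = 2%N -> #|B| = 2%N -> b A = b B -> A = B.
Hypothesis b_surj : forall B : {set T}, #|B| = 2%N -> exists2 A : {set T}, #|A| = 2%N & b A = B.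
Hypothesis b_meet : forall i j l : T, i != j -> j != l -> i != l ->
  ~~ [disjoint b [set i; j] & b [set j; l]].

Lemma notin_small (A : {set T}) : (#|A| < #|T|)%N -> exists x, x \notin A.
Proof.
move=> AT; apply: contrapT => H; suff : [set: T] \subset A.
  by move=> /subset_leq_card; rewrite cardsT leqNgt AT.
by apply/subsetP=> x _; apply: contrapT => /negP xA; apply: H; exists x.
Qed.

Lemma b_cards2 i j : i != j -> #|b [set i; j]| = 2%N.
Proof. by move=> ij; rewrite b2 // cards2 ij. Qed.

Lemma b_neq i j l : i != j -> i != l -> j != l -> b [set i; j] <> b [set i; l].
Proof.
move=> ij il jl /b_inj; rewrite !cards2 ij il => /(_ erefl erefl)/setP/(_ j).
by rewrite !inE eqxx orbT eq_sym (negPf ij) (negPf jl).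
Qed.

Lemma b_meet2 i j l : i != j -> i != l -> j != l ->
  exists2 c, c \in b [set i; j] & c \in b [set i; l].
Proof.
move=> ij il jl; have := @b_meet j i l; rewrite [j == i]eq_sym => /(_ ij il jl).
rewrite setUC => /pred0Pn[c /andP[c1 c2]]; by exists c.
Qed.

(** The images of the pairs through [i] meet pairwise, so without a common element three of them
    form a triangle on [a], [x], [y]. The image of a fourth pair meets all three sides, hence is one
    of them, against injectivity; this takes four indices besides [i]. *)
Lemma star_center i : exists a, forall j, i != j -> a \in b [set i; j].
Proof.
have [j1] : exists x, x \notin [set i] by apply: notin_small; rewrite cards1; apply: leq_trans T5.
rewrite inE eq_sym => ij1.
have [j2] : exists x, x \notin [set i; j1].
  by apply: notin_small; rewrite cards2 ij1; apply: leq_trans T5.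
rewrite !inE negb_or ![j2 == _]eq_sym => /andP[ij2 j12].
have [a a1 a2] := b_meet2 ij1 ij2 j12.
apply: contrapT => H.
have [j3 [ij3 a3]] : exists j3, i != j3 /\ a \notin b [set i; j3].
  apply: contrapT => K; apply: H; exists a => j ij; apply: contrapT => /negP aj.
  by apply: K; exists j.
have j13 : j1 != j3 by apply: contraNneq a3 => <-.
have j23 : j2 != j3 by apply: contraNneq a3 => <-.
have [x ax b1E] := set2P (b_cards2 ij1) a1.
have [y ay b2E] := set2P (b_cards2 ij2) a2.
have xy : x != y.
  by apply/eqP=> xy; apply: (b_neq ij1 ij2 j12); rewrite b1E b2E xy.
have key j : i != j -> j1 != j -> j2 != j -> a \notin b [set i; j] -> b [set i; j] = [set x; y].
  move=> ij j1j j2j aj; apply: set2_eq => //; first exact: b_cards2.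
    have [c] := b_meet2 ij1 ij j1j; rewrite b1E !inE => /orP[]/eqP-> //.
    by rewrite (negPf aj).
  have [c] := b_meet2 ij2 ij j2j; rewrite b2E !inE => /orP[]/eqP-> //.
  by rewrite (negPf aj).
have b3E := key _ ij3 j13 j23 a3.
have [j4] : exists z, z \notin [set i; j1; j2; j3].
  apply: notin_small; apply: leq_ltn_trans T5.
  do 2![apply: leq_trans (leq_card_setU _ _) _; rewrite cards1 addn1 ltnS].
  by rewrite cards2; case: (_ != _).
rewrite !inE !negb_or ![j4 == _]eq_sym => /andP[/andP[/andP[ij4 j14] j24] j34].
have [a4|a4] := boolP (a \in b [set i; j4]); last first.
  by apply: (b_neq ij3 ij4 j34); rewrite b3E key.
have [c] := b_meet2 ij3 ij4 j34; rewrite b3E !inE => /orP[]/eqP -> c4.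
  by apply: (b_neq ij1 ij4 j14); rewrite b1E; apply/esym/set2_eq => //; exact: b_cards2.
by apply: (b_neq ij2 ij4 j24); rewrite b2E; apply/esym/set2_eq => //; exact: b_cards2.
Qed.

Lemma pair_perm : exists s : {perm T}, forall i j, i != j -> b [set i; j] = [set s i; s j].
Proof.
have [p pP] := choice star_center.
(* If [p] identified [i] and [j], injectivity of [b] would make [p i] the centre at every index; all
   images would contain it, against surjectivity. *)
have p_inj : injective p.
  move=> i j pij; apply/eqP; apply: contraT => ij.
  have pj l : j != l -> i != l -> p l = p i.
    move=> jl il; apply/eqP; apply: contraT => pl.
    have mem x : x != l -> p l \in b [set x; l] by rewrite eq_sym setUC; exact: pP.
    have E1 : b [set i; l] = [set p l; p i].
      by apply: set2_eq; rewrite ?b_cards2 ?pP ?mem.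
    have E2 : b [set j; l] = [set p l; p i].
      by apply: set2_eq; rewrite ?b_cards2 ?mem // pij pP.
    have /setP/(_ j) : [set i; l] = [set j; l] by apply: b_inj; rewrite ?cards2 ?il ?jl // E1.
    by rewrite !inE eqxx eq_sym (negPf ij) (negPf jl).
  have all_i l m : l != m -> p i \in b [set l; m].
    move=> lm; have [E|il] := eqVneq i l; first by rewrite E; apply: pP.
    have [jl|jl] := eqVneq j l; first by rewrite pij jl; apply: pP.
    by rewrite -(pj l) //; apply: pP.
  have [x] : exists x, x \notin [set p i].
    by apply: notin_small; rewrite cards1; apply: leq_trans T5.
  rewrite inE => xi.
  have [y] : exists y, y \notin [set p i; x].
    by apply: notin_small; rewrite cards2; case: eqP => _; apply: leq_trans T5.
  rewrite !inE negb_or => /andP[yi yx].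
  have [|A /eqP/cards2P[l [m [lm ->]]] /setP/(_ (p i))] := @b_surj [set x; y].
    by rewrite cards2 eq_sym yx.
  by rewrite all_i // !inE ![p i == _]eq_sym (negPf xi) (negPf yi).
exists (perm p_inj) => i j ij; rewrite !permE; apply: set2_eq; first exact: b_cards2.
- by rewrite (inj_eq p_inj).
- exact: pP.
- by rewrite setUC; apply: pP; rewrite eq_sym.
Qed.

End Whitney.

(** * The permutation of the indices induced on a frame *)

Section PermFrame.
Variable R : unitRingType.
Hypothesis divR : forall x : R, x != 0 -> x \is a GRing.unit.
Hypothesis nz2 : 2%:R != 0 :> R.
Variables (n k : nat).
Hypothesis (k_gt0 : (0 < k)%N) (kn : (2 * k < n)%N).
Variables (f g : 'M[R]_n -> 'M[R]_n).
Hypothesis fg : comm_bij k f g.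

(** The uncut pairs determine a set up to complement, and a complement has n - k elements, which
    differs from k. *)
Lemma perm_of_whole (I K : {set 'I_n}) : #|I| = k -> #|K| = k ->
  (forall i j, i != j -> whole [set i; j] I = whole [set i; j] K) -> I = K.
Proof.
move=> Ik Kk H; have [i0 i0I] : exists i, i \in I by apply/card_gt0P; rewrite Ik.
have H' j : (j \in I) = (j \in K) (+) (i0 \notin K).
  have [->|ij] := eqVneq j i0; first by rewrite i0I; case: (_ \in _).
  by have := H _ _ ij; rewrite !whole2 i0I; case: (j \in I); case: (j \in K); case: (i0 \in K).
have [i0K|i0K] := boolP (i0 \in K); first by apply/setP=> j; rewrite H' i0K addbF.
have IK : I = ~: K by apply/setP=> j; rewrite H' i0K inE addbT.
have := cardsC K; rewrite -IK Ik Kk card_ord; lia.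
Qed.

Lemma perm_frame_set :
  (forall I : {set 'I_n}, #|I| = k -> exists2 J : {set _}, #|J| = k & f (set_mx R I) = set_mx R J) ->
  exists s : {perm 'I_n}, forall I : {set 'I_n}, #|I| = k -> f (set_mx R I) = set_mx R (s @: I).
Proof.
move=> Hf.
have kn0 : (0 < k < n)%N by lia.
have Hg (I : {set 'I_n}) : #|I| = k -> exists2 J : {set _}, #|J| = k & g (set_mx R I) = set_mx R J.
  move=> Ik; have [|J Jk E] := frame_preimage divR kn0 fg (E := gl1 R n) (E' := gl1 R n) _ Ik.
    by move=> K Kk; have [J Jk E] := Hf K Kk; exists J => //; rewrite !proj_gl1.
  by exists J; rewrite // -proj_gl1 E proj_gl1.
have tot (h : 'M[R]_n -> 'M[R]_n) :
   (forall I : {set 'I_n}, #|I| = k -> exists2 J : {set _}, #|J| = k & h (set_mx R I) = set_mx R J) ->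
   exists t : {set 'I_n} -> {set 'I_n}, forall I : {set 'I_n}, #|I| = k -> #|t I| = k /\ h (set_mx R I) = set_mx R (t I).
  move=> Hh; suff /choice[t tP] : forall I : {set 'I_n}, exists J : {set 'I_n},
      #|I| = k -> #|J| = k /\ h (set_mx R I) = set_mx R J by exists t.
  move=> I; have [/Hh[J Jk E]|nI] := pselect (#|I| = k); by [exists J|exists set0].
have [t ft] := tot f Hf; have [t' gt] := tot g Hg.
have t'K (I : {set 'I_n}) : #|I| = k -> t' (t I) = I by exact: tK fg ft gt I.
have tK' (I : {set 'I_n}) : #|I| = k -> t (t' I) = I by exact: (tK (comm_bij_sym fg) gt ft).
suff [s sP] : exists s : {perm 'I_n}, forall I : {set 'I_n}, #|I| = k -> t I = s @: I.
  by exists s => I Ik; rewrite (ft I Ik).2 sP.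
(* For k = 1 the sets are the indices themselves; the description of pairs by commutation takes k >=
   2. *)
have [k1|k1] := eqVneq k 1%N.
  have {}tP i : exists j, t [set i] = [set j].
    by have [|/eqP + _] := ft [set i]; rewrite k1 ?cards1 // => /cards1P[j ->]; exists j.
  have [p pP] := choice tP.
  have p_inj : injective p.
    move=> i j pij; apply: (@set1_inj _); rewrite -(t'K [set i]) ?k1 ?cards1 // pP pij -pP.
    by rewrite t'K // k1 cards1.
  exists (perm p_inj) => I; rewrite k1 => /eqP/cards1P[i ->].
  by rewrite imset_set1 permE pP.
have k2 : (2 <= k)%N by lia.
have totb : exists b : {set 'I_n} -> {set 'I_n}, forall A : {set 'I_n}, #|A| = 2%N ->
    #|b A| = 2%N /\ forall I : {set 'I_n}, #|I| = k -> whole A I = whole (b A) (t I).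
  suff /choice[b bP] : forall A : {set 'I_n}, exists B : {set 'I_n}, #|A| = 2%N -> #|B| = 2%N /\
    forall I : {set 'I_n}, #|I| = k -> whole A I = whole B (t I) by exists b.
  move=> A.
  have [A2|nA] := pselect (#|A| = 2%N); last by exists set0.
  by have [B B2 BE] := pair_image k2 kn fg ft gt A2; exists B.
have [b bP] := totb.
have b2 (A : {set 'I_n}) : #|A| = 2%N -> #|b A| = 2%N by move=> /bP[].
have bw (A I : {set 'I_n}) : #|A| = 2%N -> #|I| = k -> whole A I = whole (b A) (t I).
  by move=> /bP[_]; exact.
have b_inj (A B : {set 'I_n}) : #|A| = 2%N -> #|B| = 2%N -> b A = b B -> A = B.
  move=> A2 B2 bAB; apply: (whole_subset k2 kn A2 B2) => I Ik.
  by rewrite (bw A) // (bw B) // bAB.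
have b_surj (B : {set 'I_n}) : #|B| = 2%N -> exists2 A : {set 'I_n}, #|A| = 2%N & b A = B.
  move=> B2; have [A A2 AE] := pair_image k2 kn (comm_bij_sym fg) gt ft B2.
  exists A => //; apply: (whole_subset k2 kn (b2 _ A2) B2) => I Ik.
  by rewrite (AE I Ik) -{1}(tK' I Ik) -bw //; case: (gt I Ik).
have [F G C] := fg.
have Zf (A : {set 'I_n}) Z : #|A| = 2%N -> pair_idem k A Z -> pair_idem k (b A) (f Z).
  move=> A2 [Zk ZA [I Ik ZI]]; split.
  - by have [] := F _ Zk.
  - move=> I' I'k; have [t'k _] := gt I' I'k; rewrite -(tK' I' I'k) -bw // => /(ZA _ t'k) H.
    rewrite -(ft _ t'k).2; apply: (C _ _ Zk (rank_set R t'k)).1; exact: H.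
  exists (t I); first by case: (ft I Ik).
  by rewrite -(ft _ Ik).2 => H; apply: ZI; exact: (C _ _ Zk (rank_set R Ik)).2.
have Zg (A : {set 'I_n}) Z : #|A| = 2%N -> pair_idem k (b A) Z -> pair_idem k A (g Z).
  move=> A2 [Zk ZA [I Ik ZI]]; have [gk gE] := G _ Zk; split=> //.
  - move=> I' I'k; have [tk fE] := ft I' I'k; rewrite bw // => /(ZA _ tk) H.
    by apply: (C _ _ gk (rank_set R I'k)).2; rewrite gE fE.
  have [tk hE] := gt I Ik; exists (t' I) => // H; apply: ZI.
  have := (C _ _ gk (rank_set R tk)).1 H; by rewrite gE (ft _ tk).2 tK'.
have [||s sP] := @pair_perm 'I_n _ b b2 b_inj b_surj.
- by rewrite card_ord; lia.
(* Disjoint images would be commuting pairs. Carried back by [g], this would make the two pairs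
   through [j] commuting as well. *)
- move=> i j l ij jl il; apply/negP=> dAB.
  have A2 : #|[set i; j]| = 2%N by rewrite cards2 ij.
  have B2 : #|[set j; l]| = 2%N by rewrite cards2 jl.
  apply: (inter_not_commuting divR k2 kn nz2 ij jl il) => Z ZA.
  have [Z1 [Z2 [ZA1 ZB2 C1 C2]]] := disjoint_commuting divR k2 kn (b2 _ A2) (b2 _ B2) dAB (Zf _ _ A2 ZA).
  have [Zk _ _] := ZA; have [Z1k _ _] := ZA1; have [Z2k _ _] := ZB2.
  have [g1 fg1] := G _ Z1k; have [g2 fg2] := G _ Z2k.
  exists (g Z1), (g Z2); split; [exact: (Zg _ _ A2)|exact: (Zg _ _ B2)| |].
    by apply: (C _ _ Zk g1).2; rewrite fg1.
  by apply: (C _ _ g1 g2).2; rewrite fg1 fg2.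
exists s => I Ik; have [tk _] := ft I Ik.
have E : I = s @^-1: t I.
  apply: perm_of_whole => // [|i j ij].
    by rewrite -tk card_preimset //; exact: perm_inj.
  have ij2 : #|[set i; j]| = 2%N by rewrite cards2 ij.
  by rewrite bw // sP // !whole2 !inE.
rewrite [in RHS]E; apply/setP=> x.
by rewrite -{2}[x](permKV s) mem_imset ?inE ?permKV //; exact: perm_inj.
Qed.

End PermFrame.

(** * The induced map on idempotents of rank 1 *)

Section ElementaryGeneration.
Variable R : unitRingType.
Hypothesis divR : forall x : R, x != 0 -> x \is a GRing.unit.

Lemma gl_diag_subproof n (d d' : 'rV[R]_n) : (forall i, d 0 i * d' 0 i = 1) ->
  diag_mx d *m diag_mx d' = 1%:M.
Proof.
move=> H; apply/matrixP=> i j; rewrite mul_diag_mx !mxE.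
by case: eqP => [->|]; rewrite ?mulr0 // mulr1n H.
Qed.

Definition gl_diag n (d d' : 'rV[R]_n) (H : forall i, d 0 i * d' 0 i = 1)
  (H' : forall i, d' 0 i * d 0 i = 1) : glmx R n :=
  Glmx (gl_diag_subproof H) (gl_diag_subproof H').

(** Closure is stated in the direction of elimination: [P] holds for a matrix if it holds after a
    row operation, so that reduction to 1 is what has to be done. *)
Definition elem_closed n (P : 'M[R]_n -> Prop) :=
  (forall (i j : 'I_n) (c : R) (ij : i != j) A, P (gl_elem c ij *m A) -> P A) /\
  (forall (d d' : 'rV[R]_n) (H : forall i, d 0 i * d' 0 i = 1) (H' : forall i, d' 0 i * d 0 i = 1) A,
     P (gl_diag H H' *m A) -> P A).

Lemma elem_block m n (i j : 'I_n) (c : R) (ij : i != j) (ij' : rshift m i != rshift m j) :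
  gl_elem c ij' = block_mx 1%:M 0 0 (gl_elem c ij) :> 'M[R]_(m + n).
Proof.
apply/matrixP=> a b; case: (split_ordP a) => a' ->; case: (split_ordP b) => b' ->.
- by rewrite block_mxEul gl_elem_entry mxE eq_lshift eq_lrshift addr0.
- by rewrite block_mxEur gl_elem_entry mxE !eq_lrshift addr0.
- by rewrite block_mxEdl gl_elem_entry mxE !eq_rlshift eq_lrshift andbF addr0.
- by rewrite block_mxEdr !gl_elem_entry !eq_rshift.
Qed.

Lemma elem_closed_lower m n (P : 'M[R]_(m + n) -> Prop) (Y : 'M_(n, m)) A :
  elem_closed P -> P (gl_lower Y *m A) -> P A.
Proof.
move=> [Pe _].
have ij (i : 'I_n) (j : 'I_m) : rshift m i != lshift n j by rewrite eq_rlshift.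
have E1 i j c : gl_elem c (ij i j) = gl_lower (c *: delta_mx i j) :> 'M[R]_(m + n).
  apply/matrixP=> a b; rewrite gl_lowerE gl_elem_entry.
  case: (split_ordP a) => a' ->; case: (split_ordP b) => b' ->.
  - by rewrite block_mxEul mxE eq_lshift eq_lrshift addr0.
  - by rewrite block_mxEur mxE !eq_lrshift addr0.
  - by rewrite block_mxEdl !mxE eq_rlshift eq_rshift eq_lshift add0r mulr_natr.
  - by rewrite block_mxEdr mxE !eq_rshift eq_rlshift andbF addr0.
have EM (X X' : 'M[R]_(n, m)) : gl_lower X *m gl_lower X' = gl_lower (X + X').
  by rewrite !gl_lowerE mulmx_block !(mulmx0, mul0mx, mulmx1, mul1mx, addr0, add0r).
have step i j c B : P (gl_lower (c *: delta_mx i j) *m B) -> P B.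
  by rewrite -E1; exact: Pe.
pose Q (X : 'M[R]_(n, m)) := forall B, P (gl_lower X *m B) -> P B.
suff : Q Y by apply.
have Q0 : Q 0 by move=> B; rewrite gl_lowerE -scalar_mx_block mul1mx.
have QD X X' : Q X -> Q X' -> Q (X + X').
  by move=> QX QX' B; rewrite -EM -mulmxA => /QX/QX'.
rewrite (matrix_sum_delta Y); elim/big_ind: _ => // i _; elim/big_ind: _ => // j _.
exact: step.
Qed.

Lemma elem_closed_upper m n (P : 'M[R]_(m + n) -> Prop) (X : 'M_(m, n)) A :
  elem_closed P -> P (gl_upper X *m A) -> P A.
Proof.
move=> [Pe _].
have ij (i : 'I_m) (j : 'I_n) : lshift n i != rshift m j by rewrite eq_lrshift.
have E1 i j c : gl_elem c (ij i j) = gl_upper (c *: delta_mx i j) :> 'M[R]_(m + n).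
  apply/matrixP=> a b; rewrite gl_upperE gl_elem_entry.
  case: (split_ordP a) => a' ->; case: (split_ordP b) => b' ->.
  - by rewrite block_mxEul mxE !eq_lshift eq_lrshift andbF addr0.
  - by rewrite block_mxEur !mxE eq_lrshift eq_rshift eq_lshift add0r mulr_natr.
  - by rewrite block_mxEdl mxE !eq_rlshift addr0.
  - by rewrite block_mxEdr mxE !eq_rshift eq_rlshift addr0.
have EM (Y Y' : 'M[R]_(m, n)) : gl_upper Y *m gl_upper Y' = gl_upper (Y' + Y).
  by rewrite !gl_upperE mulmx_block !(mulmx0, mul0mx, mulmx1, mul1mx, addr0, add0r).
have step i j c B : P (gl_upper (c *: delta_mx i j) *m B) -> P B.
  by rewrite -E1; exact: Pe.
pose Q (Y : 'M[R]_(m, n)) := forall B, P (gl_upper Y *m B) -> P B.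
suff : Q X by apply.
have Q0 : Q 0 by move=> B; rewrite gl_upperE -scalar_mx_block mul1mx.
have QD Y Y' : Q Y -> Q Y' -> Q (Y + Y').
  by move=> QY QY' B; rewrite -EM -mulmxA => /QY'/QY.
rewrite (matrix_sum_delta X); elim/big_ind: _ => // i _; elim/big_ind: _ => // j _.
exact: step.
Qed.

Lemma diag_block m n (d d' : 'rV[R]_n) : (forall i, d 0 i * d' 0 i = 1) ->
  forall i, row_mx (const_mx 1) d 0 i * row_mx (const_mx 1 : 'rV_m) d' 0 i = 1.
Proof.
move=> H i; case: (split_ordP i) => i' ->; rewrite ?row_mxEl ?row_mxEr //.
by rewrite !mxE mulr1.
Qed.

Lemma diag_blockE m n (d : 'rV[R]_n) :
  diag_mx (row_mx (const_mx 1) d) = block_mx 1%:M 0 0 (diag_mx d) :> 'M[R]_(m + n).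
Proof.
apply/matrixP=> a b; rewrite mxE.
case: (split_ordP a) => a' ->; case: (split_ordP b) => b' ->.
- by rewrite block_mxEul row_mxEl eq_lshift !mxE.
- by rewrite block_mxEur eq_lrshift !mxE.
- by rewrite block_mxEdl eq_rlshift !mxE.
- by rewrite block_mxEdr row_mxEr eq_rshift !mxE.
Qed.

(** Row operations alone suffice: the corner is made 1 and its column cleared, the induction
    hypothesis reduces the lower right block to 1, and the rows of that block clear the first
    row. *)
Lemma glmx_elimS n :
  (forall P : 'M[R]_n -> Prop, elem_closed P -> P 1%:M -> forall A : glmx R n, P A) ->
  forall P : 'M[R]_(1 + n) -> Prop, elem_closed P -> P 1%:M -> forall A : glmx R (1 + n), P A.
Proof.
move=> IH P clP P1 A.
have block_case (x : 'rV_n) (X : glmx R n) : P (block_mx 1%:M x 0 X).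
  pose P' (X : 'M[R]_n) := forall x, P (block_mx 1%:M x 0 X).
  suff : P' X by apply.
  apply: IH => [|y].
    split=> [i j c ij B PB y|d d' H H' B PB y].
      have ij' : rshift 1 i != rshift 1 j by rewrite eq_rshift.
      apply: (clP.1 _ _ c ij'); rewrite elem_block mulmx_block.
      by rewrite !(mul0mx, mulmx0, mul1mx, addr0, add0r); exact: PB.
    apply: (clP.2 _ _ (@diag_block 1 _ _ _ H) (@diag_block 1 _ _ _ H')).
    rewrite [glmx_val _]diag_blockE mulmx_block.
    by rewrite !(mul0mx, mulmx0, mul1mx, addr0, add0r); exact: PB.
  apply: (elem_closed_upper (X := - y) clP); rewrite gl_upperE mulmx_block.
  by rewrite !(mul0mx, mulmx0, mul1mx, mulmx1, addr0, add0r) subrr -scalar_mx_block.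
pose o := lshift n (0 : 'I_1).
have ulE (B : 'M[R]_(1 + n)) : B o o = 1 -> ulsubmx B = 1%:M.
  by move=> Boo; rewrite [LHS]mx11_scalar !mxE Boo.
have corner_case (B : glmx R (1 + n)) : B o o = 1 -> P B.
  move=> Boo; apply: (elem_closed_lower (Y := - dlsubmx B) clP).
  pose C := glM (gl_lower (- dlsubmx B)) B.
  have CE : C = block_mx 1%:M (ursubmx C) 0 (drsubmx C) :> 'M_(1 + n).
    rewrite -[LHS]submxK; congr block_mx.
      rewrite glME gl_lowerE -[B in _ *m B]submxK mulmx_block block_mxKul mul1mx mul0mx addr0.
      exact: ulE.
    rewrite glME gl_lowerE -[B in _ *m B]submxK mulmx_block block_mxKdl mul1mx.
    by rewrite ulE // mulmx1 addNr.
  have C1 := glmxV C; have C2 := glVmx C; move: C1 C2.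
  rewrite CE -[glmx_inv C]submxK !mulmx_block scalar_mx_block.
  rewrite !(mul0mx, mulmx0, mul1mx, mulmx1, addr0, add0r).
  move=> /eq_block_mx[_ _ _ D1] /eq_block_mx[_ _ D0 D2].
  rewrite D0 mul0mx add0r in D2.
  by rewrite -[X in P X]/(glmx_val C) CE; exact: (block_case _ (Glmx D1 D2)).
have [i Aio] : exists i, A i o != 0.
  apply: contrapT => H; have /matrixP/(_ o o) := glVmx A.
  rewrite !mxE eqxx big1 => [/esym/eqP|j _]; first by rewrite oner_eq0.
  have -> : A j o = 0; last by rewrite mulr0.
  by apply: contrapT => /eqP Aj; apply: H; exists j.
have [io|io] := eqVneq i o.
  rewrite io in Aio.
  pose d : 'rV[R]_(1 + n) := \row_j (if j == o then (A o o)^-1 else 1).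
  pose d' : 'rV[R]_(1 + n) := \row_j (if j == o then A o o else 1).
  have H j : d 0 j * d' 0 j = 1 by rewrite !mxE; case: eqP; rewrite ?mulr1 // mulVr ?divR.
  have H' j : d' 0 j * d 0 j = 1 by rewrite !mxE; case: eqP; rewrite ?mulr1 // mulrV ?divR.
  apply: (clP.2 _ _ H H'); apply: (corner_case (glM (gl_diag H H') A)).
  by rewrite glME mul_diag_mx !mxE eqxx mulVr ?divR.
(* This coefficient makes the corner equal to 1 whatever [A o o] is. *)
rewrite eq_sym in io; pose c := (1 - A o o) * (A i o)^-1.
apply: (clP.1 _ _ c io); apply: (corner_case (glM (gl_elem c io) A)).
rewrite glME mulmxDl mul1mx mxE -scalemxAl [X in _ + X]mxE.
have -> : (delta_mx o i *m A) o o = A i o.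
  rewrite mxE (bigD1 i) //= big1 ?addr0 => [|j ji]; first by rewrite mxE !eqxx mul1r.
  by rewrite mxE (negPf ji) andbF mul0r.
by rewrite /c -mulrA mulVr ?divR // mulr1 subrKC.
Qed.

Lemma glmx_elim n (P : 'M[R]_n -> Prop) : elem_closed P -> P 1%:M -> forall A : glmx R n, P A.
Proof.
elim: n P => [|n IH] P clP P1 A; last exact: glmx_elimS.
by have -> : A = 1%:M :> 'M_0; rewrite // [LHS]flatmx0 [RHS]flatmx0.
Qed.

End ElementaryGeneration.

(** * Frames compared by their transition matrices *)

Section SameFrame.
Variable R : nzRingType.
Variable n : nat.
Implicit Types (E : glmx R n) (I J : {set 'I_n}).

Lemma proj_eqP E E1 I : proj E I = proj E1 I <->
  (E1 *m glmx_inv E) *m set_mx R I = set_mx R I *m (E1 *m glmx_inv E).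
Proof.
rewrite /proj /conj_mx; split=> H.
  have := congr1 (fun X => E1 *m X *m glmx_inv E) H.
  by rewrite !mulmxA glmxV mul1mx -(mulmxA _ E) glmxV mulmx1.
have := congr1 (fun X => glmx_inv E1 *m X *m E) H.
by rewrite !mulmxA glVmx mul1mx -[in RHS]mulmxA glVmx mulmx1.
Qed.

Lemma proj_diag E E1 : (forall a b, a != b -> (E1 *m glmx_inv E) a b = 0) ->
  forall I, proj E I = proj E1 I.
Proof.
move=> H I; apply/proj_eqP/comm_set_mx => a b ab; apply: H.
by apply: contraNneq ab => ->.
Qed.

Lemma proj_set1E E l : proj E [set l] = glmx_inv E *m delta_mx l l *m E.
Proof.
rewrite /proj /conj_mx; congr (_ *m _ *m _).
apply/matrixP=> i j; rewrite set_mxE !mxE inE.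
by case: (i =P l) => [->|]; rewrite ?andbF ?andbT // eq_sym.
Qed.

End SameFrame.

Section FrameMap.
Variable R : unitRingType.
Hypothesis divR : forall x : R, x != 0 -> x \is a GRing.unit.
Variables (n k : nat).
Hypothesis (k_gt0 : (0 < k)%N) (kn : (2 * k < n)%N).
Implicit Types (E : glmx R n) (I J : {set 'I_n}).

Definition maps_frame (f : 'M[R]_n -> 'M[R]_n) E E' :=
  forall I : {set 'I_n}, #|I| = k -> f (proj E I) = proj E' I.

Lemma frame_mapE f E E1 E' : (forall I, proj E I = proj E1 I) ->
  maps_frame f E E' -> maps_frame f E1 E'.
Proof. by move=> H F I Ik; rewrite -H F. Qed.

Lemma frame_uniq E E1 : (forall I : {set 'I_n}, #|I| = k -> proj E I = proj E1 I) ->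
  forall I, proj E I = proj E1 I.
Proof.
move=> H; apply: proj_diag; apply: (@comm_all_set _ _ k); first by lia.
by move=> I /H/proj_eqP.
Qed.

Lemma maps_frame_perm f E E' (s : 'S_n) : maps_frame f E E' ->
  maps_frame f (glM (gl_perm R s) E) (glM (gl_perm R s) E').
Proof.
move=> F I Ik; rewrite !proj_glM !proj_perm; apply: F.
by rewrite card_imset //; exact: perm_inj.
Qed.

Variables (f g : 'M[R]_n -> 'M[R]_n).
Hypothesis fg : comm_bij k f g.

Lemma maps_frame_ex (nz2 : 2%:R != 0 :> R) E : exists E', maps_frame f E E'.
Proof.
have [E0 H0] := frame_image divR E fg.
have [I Ik|s sP] := perm_frame_set divR nz2 k_gt0 kn (comm_bij_conj E (glI E0) fg).
  by have [J Jk E1] := H0 I Ik; exists J; rewrite // -/(proj E I) E1 conj_mxI.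
exists (glM (gl_perm R s) E0) => I Ik.
by rewrite proj_glM proj_perm -sP // conj_mxIV.
Qed.

Lemma maps_frame_sym E E' : maps_frame f E E' -> maps_frame g E' E.
Proof.
move=> F I Ik; rewrite -F //; have [/(_ (proj E I)) H _ _] := fg.
by have [|_ ->] := H; first by rewrite -Ik; exact: idem_rank_proj.
Qed.

(** A k-set that does not cut the pair of [i] and [j] has the same idempotent in both frames, hence
    in both image frames; so the image transition matrix commutes with its [set_mx], and such sets
    separate all other pairs of indices. *)
Lemma maps_frame_elem E E1 E' E1' (i j : 'I_n) (c : R) (ij : i != j) :
  E1 = gl_elem c ij *m E :> 'M_n ->
  maps_frame f E E' -> maps_frame f E1 E1' ->
  forall a b, a != b -> ~~ ((a \in [set i; j]) && (b \in [set i; j])) ->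
  (E1' *m glmx_inv E') a b = 0.
Proof.
move=> E1E F F1.
have ij2 : #|[set i; j]| = 2%N by rewrite cards2 ij.
have H I : #|I| = k -> whole [set i; j] I ->
    (E1' *m glmx_inv E') *m set_mx R I = set_mx R I *m (E1' *m glmx_inv E').
  move=> Ik wI; apply/proj_eqP; rewrite -F // -F1 //; congr f; apply/proj_eqP.
  rewrite E1E -(mulmxA _ (glmx_val E)) glmxV mulmx1; apply/comm_set_mx => a b ab.
  rewrite whole2 in wI; rewrite gl_elem_entry; have [E0|_] := eqVneq a b; first by rewrite E0 eqxx in ab.
  have [ai|] //= := eqVneq a i; last by rewrite addr0.
  have [bj|] //= := eqVneq b j; last by rewrite addr0.
  by rewrite ai bj (eqP wI) eqxx in ab.
move=> a b ab; rewrite negb_and => /orP[aij|bij].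
  have [I [Ik aI bI wI]] := card_set_separating k_gt0 kn ij2 aij ab.
  by have /comm_set_mx/(_ a b) := H I Ik wI; rewrite aI (negPf bI) => ->.
rewrite eq_sym in ab; have [I [Ik bI aI wI]] := card_set_separating k_gt0 kn ij2 bij ab.
by have /comm_set_mx/(_ a b) := H I Ik wI; rewrite bI (negPf aI) => ->.
Qed.

Lemma maps_frame_elem1 E E1 E' E1' (i j : 'I_n) (c : R) (ij : i != j) :
  E1 = gl_elem c ij *m E :> 'M_n ->
  maps_frame f E E' -> maps_frame f E1 E1' ->
  forall l, l \notin [set i; j] -> proj E' [set l] = proj E1' [set l].
Proof.
move=> E1E F F1 l lij; apply/proj_eqP/comm_set_mx => a b; rewrite !inE => ab.
apply: (maps_frame_elem E1E F F1); first by apply: contraNneq ab => ->.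
by apply/negP=> /andP[aij bij]; move: ab; have [E0|_] := eqVneq a l;
  [rewrite E0 (negPf lij) in aij|have [E0|_//] := eqVneq b l; rewrite E0 (negPf lij) in bij].
Qed.

End FrameMap.

(** * Independence of the frame at a single index *)

Section RankOneMap.
Variable R : unitRingType.
Hypothesis divR : forall x : R, x != 0 -> x \is a GRing.unit.
Hypothesis nz2 : 2%:R != 0 :> R.
Variables (n k : nat).
Hypothesis (k_gt0 : (0 < k)%N) (kn : (2 * k < 1 + n)%N).
Variables (f g : 'M[R]_(1 + n) -> 'M[R]_(1 + n)).
Hypothesis fg : comm_bij k f g.
Let o := lshift n (0 : 'I_1).

(** The common member makes the transition matrix block diagonal. The lower right block is reduced
    by elementary matrices, whose indices differ from [o] and which therefore keep the image member
    at [o], and by diagonal matrices, which keep the whole frame. *)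
Lemma maps_frame_first E E1 E' E1' : maps_frame k f E E' -> maps_frame k f E1 E1' ->
  proj E [set o] = proj E1 [set o] -> proj E' [set o] = proj E1' [set o].
Proof.
move=> F F1 /proj_eqP.
have [G GD] : exists G, G = E1 *m glmx_inv E by eexists.
rewrite -GD => GC.
have GE : G = block_mx (ulsubmx G) 0 0 (drsubmx G).
  have H := (comm_set_mx _ _).1 GC; rewrite -{1}[G]submxK; congr block_mx.
    by apply/matrixP=> a b; rewrite !mxE; apply: H; rewrite !inE !ord1 eqxx eq_rlshift.
  by apply/matrixP=> a b; rewrite !mxE; apply: H; rewrite !inE !ord1 eqxx eq_rlshift.
pose Gg := glM E1 (glI E).
have G1 := glmxV Gg; have G2 := glVmx Gg; move: G1 G2.
rewrite -[glmx_inv Gg]submxK [glmx_val Gg](etrans (esym GD) GE) !mulmx_block scalar_mx_block.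
rewrite !(mul0mx, mulmx0, mul1mx, mulmx1, addr0, add0r).
move=> /eq_block_mx[U1 _ _ D1] /eq_block_mx[U2 _ _ D2].
have E1E : E1 = block_mx (ulsubmx G) 0 0 (drsubmx G) *m E :> 'M_(1 + n).
  by rewrite -GE GD -mulmxA glVmx mulmx1.
(* All frames are quantified, since an elementary factor inserts an intermediate frame, whose image
   comes from [ex]. *)
pose P (X : 'M[R]_n) := forall E E1 E' E1', maps_frame k f E E' -> maps_frame k f E1 E1' ->
  E1 = block_mx (ulsubmx G) 0 0 X *m E :> 'M_(1 + n) -> proj E' [set o] = proj E1' [set o].
have ex := maps_frame_ex divR k_gt0 kn fg nz2.
suff : P (Glmx D1 D2) by move=> H; exact: (H _ _ _ _ F F1).
apply: (glmx_elim divR (P := P)); last first.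
  move=> {F F1 E1E GC GE GD Gg D1 D2 U1 U2}; move: (ulsubmx G) @P => U P.
  move=> {}E {}E1 {}E' {}E1' F F1 E1E; apply: (frame_uniq k_gt0 kn) => I Ik.
  rewrite -F // -F1 //; congr f; apply: proj_diag => a b.
  rewrite E1E -mulmxA glmxV mulmx1.
  case: (split_ordP a) => a' ->; case: (split_ordP b) => b' ->.
  - by rewrite !ord1 eqxx.
  - by rewrite block_mxEur mxE.
  - by rewrite block_mxEdl mxE.
  - by rewrite block_mxEdr eq_rshift mxE => /negPf ->.
move=> {F F1 E1E GC GE GD Gg D1 D2 U1 U2}.
split=> [i j c ij X PX|d d' H H' X PX] {}E {}E1 {}E' {}E1' F F1 E1E.
  have ij' : rshift 1 i != rshift 1 j by rewrite eq_rshift.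
  have [E2' F2] := ex (glM (gl_elem c ij') E1).
  have := PX E (glM (gl_elem c ij') E1) E' E2' F F2.
  rewrite glME E1E mulmxA elem_block mulmx_block.
  rewrite !(mul0mx, mulmx0, mul1mx, mulmx1, addr0, add0r) => /(_ erefl) ->.
  apply/esym/(maps_frame_elem1 k_gt0 kn (ij := ij') (c := c) _ F1 F2) => //.
  by rewrite !inE !eq_lrshift.
pose D := gl_diag (@diag_block _ 1 _ _ _ H) (@diag_block _ 1 _ _ _ H').
apply: (PX E (glM D E1) E' E1' F).
  apply: frame_mapE F1; apply: proj_diag => a b ab.
  by rewrite glME -mulmxA glmxV mulmx1 mxE (negPf ab) mulr0n.
rewrite glME E1E mulmxA [glmx_val D]diag_blockE mulmx_block.
by rewrite !(mul0mx, mulmx0, mul1mx, mulmx1, addr0, add0r).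
Qed.

Lemma rank1_std (A : 'M[R]_(1 + n)) : idem_rank 1 A -> exists E : glmx R (1 + n), A = proj E [set o].
Proof.
move=> [E [I [/eqP/cards1P[l ->] ->]]]; exists (glM (gl_perm R (tperm o l)) E).
by rewrite proj_glM proj_perm imset_set1 tpermL.
Qed.

(** [maps_frame_first] makes the choice at index [o] consistent; a transposition brings any other
    index to [o], and it permutes a frame and its image alike. *)
Lemma rank1_map : exists phi : 'M[R]_(1 + n) -> 'M[R]_(1 + n),
  forall E E', maps_frame k f E E' -> forall l, phi (proj E [set l]) = proj E' [set l].
Proof.
have ex := maps_frame_ex divR k_gt0 kn fg nz2.
have /choice[phi phiP] : forall A : 'M[R]_(1 + n), exists B : 'M[R]_(1 + n), forall E E',
    maps_frame k f E E' -> A = proj E [set o] -> B = proj E' [set o].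
  move=> A; have [/rank1_std[E AE]|nA] := pselect (idem_rank 1 A); last first.
    exists 0 => E E' _ AE; case: nA; rewrite AE; by exists E, [set o]; rewrite cards1.
  have [E' F] := ex E; exists (proj E' [set o]) => E1 E1' F1 A1.
  by apply: (maps_frame_first F F1); rewrite -AE -A1.
exists phi => E E' F l.
have F1 := maps_frame_perm (tperm o l) F.
have H E1 : proj (glM (gl_perm R (tperm o l)) E1) [set o] = proj E1 [set l].
  by rewrite proj_glM proj_perm imset_set1 tpermL.
by rewrite -!H; apply: phiP F1 _.
Qed.

End RankOneMap.

(** * Points and hyperplanes *)

Section Rank1.
Variable R : unitRingType.
Hypothesis divR : forall x : R, x != 0 -> x \is a GRing.unit.
Variable n : nat.
Implicit Types (E : glmx R n) (r s t : 'M[R]_n) (x : 'rV[R]_n) (y : 'cV[R]_n).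

Definition pairing x y : R := (x *m y) 0 0.

Lemma pairingE x y : x *m y = (pairing x y)%:M.
Proof. exact: mx11_scalar. Qed.

(** It sends a row z to [pairing z y *: x]. When [pairing x y = 1] it is the projection onto the
    point spanned by [x] along the hyperplane with equation [y]. *)
Definition rank1 x y : 'M[R]_n := y *m x.

Lemma rank1M x y x' y' : rank1 x y *m rank1 x' y' = y *m (pairing x y' *: x').
Proof. by rewrite /rank1 mulmxA -(mulmxA y) pairingE -mulmxA mul_scalar_mx. Qed.

Lemma pairingZ a x y : pairing (a *: x) y = a * pairing x y.
Proof. by rewrite /pairing -scalemxAl mxE. Qed.

Lemma pairingZr a x y : pairing x (y *m a%:M) = pairing x y * a.
Proof. by rewrite {1}/pairing mulmxA pairingE -scalar_mxM [LHS]mxE eqxx. Qed.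

Lemma pairingDl x x' y : pairing (x + x') y = pairing x y + pairing x' y.
Proof. by rewrite /pairing mulmxDl mxE. Qed.

Lemma pairing0 y : pairing 0 y = 0.
Proof. by rewrite /pairing mul0mx mxE. Qed.

Lemma mul_rank1 x y z : z *m rank1 x y = pairing z y *: x.
Proof. by rewrite /rank1 mulmxA pairingE mul_scalar_mx. Qed.

Lemma rank1_mul x y z : rank1 x y *m z = y *m (pairing x z)%:M.
Proof. by rewrite /rank1 -mulmxA pairingE. Qed.

Lemma divR_inv (a b : R) : a * b = 1 -> b * a = 1.
Proof.
move=> ab; have ua : a \is a GRing.unit.
  by apply: divR; apply: contra_eq_neq ab => ->; rewrite mul0r eq_sym oner_neq0.
by apply: (mulrI ua); rewrite mulrA ab mul1r mulr1.
Qed.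

Lemma idem_rank1P r : idem_rank 1 r <-> exists x y, pairing x y = 1 /\ r = rank1 x y.
Proof.
split=> [[E [I [/eqP/cards1P[l ->] ->]]]|[x [y [xy ->]]]].
  exists (row l E), (col l (glmx_inv E)); split.
    have <- : (E *m glmx_inv E) l l = 1 by rewrite glmxV mxE eqxx.
    by rewrite /pairing !mxE; apply: eq_bigr => j _; rewrite !mxE.
  rewrite proj_set1E rowE colE /rank1 !mulmxA -(mulmxA _ (delta_mx l 0)).
  by rewrite mul_delta_mx.
have [|m [E [I [Im AE]]]] := @idem_rank_ex _ divR _ (rank1 x y).
  by rewrite rank1M xy scale1r.
suff [a Ia] : exists a, I = [set a] by exists E, I; rewrite Ia cards1 -Ia.
have H a b : (E *m y) a 0 * (x *m glmx_inv E) 0 b = ((a == b) && (a \in I))%:R.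
  rewrite -set_mxE -[set_mx _ _](conj_mxI E) -/(proj E I) -AE /conj_mx /rank1.
  by rewrite /= !mulmxA -mulmxA [RHS]mxE big_ord1.
have [a aI] : exists a, a \in I.
  apply/set0Pn; apply: contra_eq_neq xy => I0.
  have : x *m rank1 x y = 0 by rewrite AE I0 /proj set_mx0 conj_mx0 mulmx0.
  rewrite mul_rank1 => /(congr1 (fun z => pairing z y)); rewrite pairingZ pairing0.
  apply: contra_eq_neq => ->; by rewrite mul1r oner_neq0.
exists a; apply/setP=> b; rewrite inE; apply/idP/eqP => [bI|->//].
apply/eqP; apply: contraTT isT => ba.
have Haa := H a a; have Hbb := H b b; have Hab := H a b.
rewrite eqxx aI in Haa; rewrite eqxx bI in Hbb; rewrite eq_sym (negPf ba) in Hab.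
have : (E *m y) a 0 != 0 by apply: contra_eq_neq Haa => ->; rewrite mul0r eq_sym oner_neq0.
have : (x *m glmx_inv E) 0 b != 0 by apply: contra_eq_neq Hbb => ->; rewrite mulr0 eq_sym oner_neq0.
by move=> v u; have := mulf_neq0_div divR u v; rewrite Hab eqxx.
Qed.

Lemma rank1_idem_rank x y : pairing x y = 1 -> idem_rank 1 (rank1 x y).
Proof. by move=> xy; apply/idem_rank1P; exists x, y. Qed.

(** On row vectors, r s = r puts the image of r inside that of s, and r s = s (below) puts the
    kernel of r inside that of s; for idempotents of rank 1 the inclusions are equalities. *)
Definition samept r s := r *m s = r.
Definition samehyp r s := r *m s = s.

Lemma samept_rank1 x y x' y' : pairing x y = 1 -> pairing x' y' = 1 ->
  samept (rank1 x y) (rank1 x' y') <-> exists a, x = a *: x'.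
Proof.
move=> xy xy'; rewrite /samept rank1M; split=> [H|[a ->]].
  exists (pairing x y'); have := congr1 (mulmx x) H.
  by rewrite mulmxA pairingE xy mul1mx mul_rank1 xy scale1r => ->.
by rewrite pairingZ xy' mulr1.
Qed.

Lemma samehyp_rank1 x y x' y' : pairing x y = 1 -> pairing x' y' = 1 ->
  samehyp (rank1 x y) (rank1 x' y') <-> exists a, y' = y *m a%:M.
Proof.
move=> xy xy'; rewrite /samehyp; split=> [H|[a ->]].
  exists (pairing x y'); have := congr1 (mulmx ^~ y') H.
  by rewrite /= -mulmxA [rank1 x' y' *m y']rank1_mul xy' mulmx1 rank1_mul => ->.
by rewrite rank1M pairingZr xy mul1r /rank1 -mulmxA mul_scalar_mx.
Qed.

Lemma samept_sym r s : idem_rank 1 r -> idem_rank 1 s -> samept r s -> samept s r.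
Proof.
move=> /idem_rank1P[x [y [xy ->]]] /idem_rank1P[x' [y' [xy' ->]]].
rewrite !samept_rank1 // => -[a xE]; exists (pairing x' y).
by rewrite xE scalerA (divR_inv (a := a)) ?scale1r // -pairingZ -xE.
Qed.

Lemma samehyp_sym r s : idem_rank 1 r -> idem_rank 1 s -> samehyp r s -> samehyp s r.
Proof.
move=> /idem_rank1P[x [y [xy ->]]] /idem_rank1P[x' [y' [xy' ->]]].
rewrite !samehyp_rank1 // => -[a yE]; exists (pairing x' y).
by rewrite yE -mulmxA -scalar_mxM divR_inv ?mulmx1 // -pairingZr -yE.
Qed.

Lemma samept_trans r s t : samept r s -> samept s t -> samept r t.
Proof. by rewrite /samept => rs st; rewrite -{1}rs -mulmxA st rs. Qed.

Lemma samehyp_trans r s t : samehyp r s -> samehyp s t -> samehyp r t.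
Proof. by rewrite /samehyp => rs st; rewrite -{1}st mulmxA rs st. Qed.

Lemma samept_samehyp r s : samept r s -> samehyp r s -> r = s.
Proof. by rewrite /samept /samehyp => {2}<- ->. Qed.

Definition near r s := samept r s \/ samehyp r s.

Lemma near_sym r s : idem_rank 1 r -> idem_rank 1 s -> near r s -> near s r.
Proof. by move=> rr rs [H|H]; [left; apply: samept_sym|right; apply: samehyp_sym]. Qed.

Lemma near_conj E r s : near (conj_mx E r) (conj_mx E s) <-> near r s.
Proof.
by rewrite /near /samept /samehyp -conj_mxM; split=> -[H|H];
  by [left; apply: conj_mx_inj H|right; apply: conj_mx_inj H|left; rewrite H|right; rewrite H].
Qed.

(** The rook graph is connected. If the point of one idempotent is off the hyperplane of the other,
    this point and this hyperplane give an intermediate vertex; otherwise x + x' is off both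
    hyperplanes. *)
Lemma near_connect (P : 'M[R]_n -> Prop) r s :
  (forall r s, idem_rank 1 r -> idem_rank 1 s -> near r s -> P r -> P s) ->
  idem_rank 1 r -> idem_rank 1 s -> P r -> P s.
Proof.
move=> H /idem_rank1P[x [y [xy ->]]] /idem_rank1P[x' [y' [xy' ->]]] Pr.
have H1 z (t t' : 'cV[R]_n) : pairing z t = 1 -> pairing z t' = 1 -> P (rank1 z t) -> P (rank1 z t').
  move=> zt zt'; apply: H; try exact: rank1_idem_rank.
  by left; apply/samept_rank1 => //; exists 1; rewrite scale1r.
have H2 z z' (t : 'cV[R]_n) : pairing z t = 1 -> pairing z' t = 1 -> P (rank1 z t) -> P (rank1 z' t).
  move=> zt zt'; apply: H; try exact: rank1_idem_rank.
  by right; apply/samehyp_rank1 => //; exists 1; rewrite mulmx1.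
have H2' a z (t : 'cV[R]_n) : pairing z (t *m a%:M) = 1 -> P (rank1 z (t *m a%:M)) -> forall z', pairing z' t = 1 -> P (rank1 z' t).
  move=> zt Pz z' z't; apply: H Pz; try exact: rank1_idem_rank.
  right; apply/samehyp_rank1 => //; exists (pairing z t).
  by rewrite -mulmxA -scalar_mxM divR_inv ?mulmx1 // -pairingZr.
have [c0|c0] := eqVneq (pairing x y') 0; last first.
  have E1 : pairing x (y' *m (pairing x y')^-1%:M) = 1 by rewrite pairingZr divrr ?divR.
  by apply: (H2' _ _ _ E1) xy'; exact: H1 Pr.
have [d0|d0] := eqVneq (pairing x' y) 0; last first.
  have E1 : pairing x' (y *m (pairing x' y)^-1%:M) = 1 by rewrite pairingZr divrr ?divR.
  apply: (H1 _ _ _ E1 xy'); apply: H Pr; try exact: rank1_idem_rank.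
  by right; apply/samehyp_rank1 => //; eexists.
have zy : pairing (x + x') y = 1 by rewrite pairingDl xy d0 addr0.
have zy' : pairing (x + x') y' = 1 by rewrite pairingDl xy' c0 add0r.
by apply: (H2 _ _ _ zy' xy'); apply: (H1 _ _ _ zy zy'); exact: H2 Pr.
Qed.

End Rank1.

(** * Adjacent idempotents of rank 1 as members of frames differing by an elementary matrix *)

Section NormalForm.
Variable R : unitRingType.
Hypothesis divR : forall x : R, x != 0 -> x \is a GRing.unit.
Variable n : nat.
Implicit Types (E : glmx R n) (r s t : 'M[R]_n).

Fact gl_transvection_subproof (u : 'cV[R]_n) (e : 'rV_n) (a b : R) :
  a + b = a * pairing e u * b -> (1%:M - rank1 (a *: e) u) *m (1%:M - rank1 (b *: e) u) = 1%:M.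
Proof.
move=> ab; rewrite mulmxBl mul1mx mulmxBr mulmx1 rank1M pairingZ scalerA -ab /rank1.
by rewrite scalerDl mulmxDr opprB [X in _ + (X - _)]addrC addrK subrK.
Qed.

Definition gl_transvection (u : 'cV[R]_n) (e : 'rV_n) (a b : R)
  (ab : a + b = a * pairing e u * b) (ba : b + a = b * pairing e u * a) : glmx R n :=
  Glmx (gl_transvection_subproof ab) (gl_transvection_subproof ba).

Lemma gl_transvectionE u e a b ab ba :
  @gl_transvection u e a b ab ba = 1%:M - rank1 (a *: e) u :> 'M_n.
Proof. by []. Qed.

Lemma pairing_deltal i (u : 'cV[R]_n) : pairing (delta_mx 0 i) u = u i 0.
Proof. by rewrite /pairing -rowE mxE. Qed.
Lemma pairing_deltar i (e : 'rV[R]_n) : pairing e (delta_mx i 0) = e 0 i.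
Proof. by rewrite /pairing -colE mxE. Qed.

Lemma set_mx1 i : set_mx R [set i] = rank1 (delta_mx 0 i) (delta_mx i 0) :> 'M_n.
Proof. by rewrite -proj_gl1 proj_set1E /rank1 mul_delta_mx /= mul1mx mulmx1. Qed.

Lemma set_mx1_rank i : idem_rank 1 (set_mx R [set i] : 'M_n).
Proof. by rewrite -(cards1 i); exact: idem_rank_set. Qed.

(** A base change that fixes the row and the column [o] brings [s] to the coordinate idempotent
    modified by one off-diagonal unit; [a] is any index where [s] has a further nonzero entry. *)
Lemma near_set_mx1 o s : idem_rank 1 s -> near (set_mx R [set o]) s -> set_mx R [set o] <> s ->
  exists (H : glmx R n) i j (ij : i != j), [/\ o \in [set i; j],
     set_mx R [set o] = proj H [set o] & s = proj (glM (gl_elem 1 ij) H) [set o]].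
Proof.
move=> rs rN sN.
pose D : 'M[R]_n := set_mx R [set o].
have fin (H : glmx R n) i j (ij : i != j) S : (gl_elem (1 : R) ij : 'M_n) = gl_elem 1 ij ->
    o \in [set i; j] ->
    H *m D = D -> D *m H = D -> proj (gl_elem 1 ij) [set o] = S -> H *m s = S *m H ->
    exists (H : glmx R n) i j (ij : i != j), [/\ o \in [set i; j],
     D = proj H [set o] & s = proj (glM (gl_elem 1 ij) H) [set o]].
  move=> _ oij HD DH PS HS; exists H, i, j, ij; split=> //.
    by rewrite /proj /conj_mx -mulmxA DH; apply: canRL (glmxK _) _.
  by rewrite proj_glM PS /conj_mx -mulmxA -HS glmxK.
case: rN => N.
  have N' := samept_sym divR (set_mx1_rank o) rs N.
  pose c := col o s.
  have sE : s = rank1 (delta_mx 0 o) c.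
    by rewrite -[LHS]N' set_mx1 /rank1 mulmxA -colE.
  have so : s o o = 1.
    by have /matrixP/(_ o o) := N; rewrite mul_set_mx !set_mxE !inE eqxx mulr1n.
  have [a ao ca] : exists2 a, a != o & c a 0 != 0.
    apply: contrapT => H; apply: sN; rewrite set_mx1 sE; congr rank1.
    apply/matrixP=> i j; rewrite ord1 mxE eqxx andbT; have [->|io] := eqVneq i o; first by rewrite mxE so.
    by apply/esym; apply: contrapT => /eqP ci; apply: H; exists i.
  (* With this [u] the matrix [gl_transvection ab ba] takes the column [c] to the coordinate column
     [o] minus the column [a]. *)
  pose u := c - delta_mx o 0 + delta_mx a 0.
  have ua : pairing (delta_mx 0 a) u = c a 0 + 1.
    by rewrite pairing_deltal !mxE !eqxx (negPf ao) /= subr0.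
  have uo : pairing (delta_mx 0 o) u = 0.
    by rewrite pairing_deltal !mxE so !eqxx [o == a]eq_sym (negPf ao) /= addr0 subrr.
  have ab : (c a 0)^-1 + 1 = (c a 0)^-1 * pairing (delta_mx 0 a) u * 1.
    by rewrite ua mulr1 mulrDr mulr1 mulVr ?divR // addrC.
  have ba : 1 + (c a 0)^-1 = 1 * pairing (delta_mx 0 a) u * (c a 0)^-1.
    by rewrite ua mul1r mulrDl mul1r mulrV ?divR.
  have HE z : (1%:M - rank1 ((c a 0)^-1 *: delta_mx 0 a) u) *m z = z - u *m ((c a 0)^-1 *: row a z).
    by rewrite mulmxBl mul1mx /rank1 -mulmxA -scalemxAl -rowE.
  have oH : delta_mx 0 o *m (gl_transvection ab ba : 'M_n) = delta_mx 0 o :> 'rV_n.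
    by rewrite gl_transvectionE mulmxBr mulmx1 mul_rank1 uo scale0r subr0.
  apply: (fin (gl_transvection ab ba) a o ao (D - delta_mx a o)) => //.
  - by rewrite !inE eqxx orbT.
  - rewrite gl_transvectionE HE /D set_mx1; have -> : row a (rank1 (delta_mx 0 o) (delta_mx o 0)) = 0 :> 'rV[R]_n.
      by rewrite rowE mul_rank1 pairing_deltal mxE (negPf ao) scale0r.
    by rewrite scaler0 mulmx0 subr0.
  - by rewrite /D set_mx1 /rank1 -mulmxA oH.
  - rewrite proj_elemC ?scale1r // !inE ?eqxx //.
  have -> : D - delta_mx a o = (delta_mx o 0 - delta_mx a 0 : 'cV_n) *m delta_mx 0 o.
    by rewrite mulmxBl !mul_delta_mx /D set_mx1 /rank1 mul_delta_mx.
  rewrite -mulmxA oH gl_transvectionE HE {2}sE; have -> : row a (rank1 (delta_mx 0 o) c) = c a 0 *: delta_mx 0 o.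
    by rewrite rowE mul_rank1 pairing_deltal.
  rewrite scalerA mulVr ?divR // scale1r sE /rank1 -mulmxBl; congr (_ *m _).
  by rewrite /u opprD opprB addrA subrKC.
have N' := samehyp_sym divR (set_mx1_rank o) rs N.
pose c := row o s.
have sE : s = rank1 c (delta_mx o 0).
  by rewrite -[LHS]N set_mx1 /rank1 -mulmxA -rowE.
have so : s o o = 1.
  by have /matrixP/(_ o o) := N'; rewrite mul_mx_set !set_mxE !inE eqxx mulr1n.
have [a ao ca] : exists2 a, a != o & c 0 a != 0.
  apply: contrapT => H; apply: sN; rewrite set_mx1 sE; congr rank1.
  apply/matrixP=> j i; rewrite ord1 mxE eqxx; have [->|io] := eqVneq i o; first by rewrite mxE so.
  by apply/esym; apply: contrapT => /eqP ci; apply: H; exists i.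
(* With this [e] the matrix [gl_transvection ab ba] takes the sum of the coordinate rows [o] and [a]
   to the row [c]. *)
pose e := delta_mx 0 a - c + delta_mx 0 o.
have ea : pairing e (delta_mx a 0) = 1 - c 0 a.
  by rewrite pairing_deltar !mxE !eqxx (negPf ao) /= addr0.
have eo : pairing e (delta_mx o 0) = 0.
  by rewrite pairing_deltar !mxE so !eqxx [o == a]eq_sym (negPf ao) /= sub0r addNr.
have ab : 1 + - (c 0 a)^-1 = 1 * pairing e (delta_mx a 0) * - (c 0 a)^-1.
  by rewrite ea mul1r mulrBl mul1r mulrN mulrV ?divR // opprK addrC.
have ba : - (c 0 a)^-1 + 1 = - (c 0 a)^-1 * pairing e (delta_mx a 0) * 1.
  by rewrite ea mulr1 mulrBr mulr1 mulNr mulVr ?divR // opprK.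
have Hz (z : 'rV[R]_n) : (gl_transvection ab ba : 'M_n) *m (delta_mx o 0 *m z) = delta_mx o 0 *m z.
  by rewrite mulmxA gl_transvectionE mulmxBl mul1mx scale1r rank1_mul eo raddf0 mulmx0 subr0.
have oH : delta_mx 0 o *m (gl_transvection ab ba : 'M_n) = delta_mx 0 o :> 'rV_n.
  by rewrite gl_transvectionE mulmxBr mulmx1 mul_rank1 pairing_deltal mxE eq_sym (negPf ao) scale0r subr0.
have oa : o != a by rewrite eq_sym.
apply: (fin (gl_transvection ab ba) o a oa (D + delta_mx o a)) => //.
- by rewrite !inE eqxx.
- by rewrite /D set_mx1 Hz.
- by rewrite /D set_mx1 /rank1 -mulmxA oH.
- by rewrite proj_elem ?scale1r // !inE ?eqxx.
have -> : D + delta_mx o a = delta_mx o 0 *m (delta_mx 0 o + delta_mx 0 a : 'rV_n).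
  by rewrite mulmxDr !mul_delta_mx /D set_mx1 /rank1 mul_delta_mx.
rewrite -mulmxA [in RHS]mulmxDl oH sE Hz; congr (_ *m _).
rewrite gl_transvectionE mulmxBr mulmx1 mul_rank1 pairing_deltal mxE !eqxx !scale1r.
by apply/esym/eqP; rewrite addrA subr_eq /e addrA subrKC addrC.
Qed.

Lemma near_normal r s : idem_rank 1 r -> idem_rank 1 s -> near r s -> r <> s ->
  exists E i j (ij : i != j) l, [/\ l \in [set i; j],
     r = proj E [set l] & s = proj (glM (gl_elem 1 ij) E) [set l]].
Proof.
move=> [E [I [/eqP/cards1P[o ->] rE]]] rs rN sN.
have [||H [i [j [ij [oij HD HS]]]]] := @near_set_mx1 o _ (idem_rank_conj (glI E) rs).
- by apply/(near_conj E); rewrite conj_mxIV -/(proj E [set o]) -rE.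
- by move=> H; apply: sN; rewrite rE /proj H conj_mxIV.
exists (glM H E), i, j, ij, o; split=> //; first by rewrite proj_glM -HD.
by rewrite -[LHS](conj_mxIV E) HS -proj_glM /proj !conj_glM.
Qed.

End NormalForm.

(** * Adjacency is preserved by bijections that map frames to frames *)

Section NearMap.
Variable R : unitRingType.
Hypothesis divR : forall x : R, x != 0 -> x \is a GRing.unit.
Variable n : nat.
Hypothesis n3 : (3 <= n)%N.
Implicit Types (E : glmx R n) (r s t : 'M[R]_n).

Definition frame_map (f : 'M[R]_n -> 'M[R]_n) := forall E, exists E', maps_frame 1 f E E'.
Definition frame_bij (f g : 'M[R]_n -> 'M[R]_n) :=
  [/\ frame_map f, frame_map g &
      forall r, idem_rank 1 r -> g (f r) = r /\ f (g r) = r].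

Lemma frame_bij_sym f g : frame_bij f g -> frame_bij g f.
Proof. by move=> [F G C]; split=> // r /C[]. Qed.

Lemma maps_frame1 f E E' l : maps_frame 1 f E E' -> f (proj E [set l]) = proj E' [set l].
Proof. by apply; rewrite cards1. Qed.

Lemma frame_map_rank f r : frame_map f -> idem_rank 1 r -> idem_rank 1 (f r).
Proof.
move=> F [E [I [I1 ->]]]; have [E' F'] := F E; rewrite F' //.
by rewrite -I1; exact: idem_rank_proj.
Qed.

Lemma proj_rank1 E l : idem_rank 1 (proj E [set l]).
Proof. by rewrite -(cards1 l); exact: idem_rank_proj. Qed.

(** Idempotents that are orthogonal on both sides lie in a common frame, and its image is a
    frame. *)
Lemma frame_map_orth f r s : frame_map f -> idem_rank 1 r -> idem_rank 1 s ->
  r *m s = 0 -> s *m r = 0 -> f r *m f s = 0.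
Proof.
move=> F rr rs rs0 sr0.
have [||E H] := simultaneous_diag divR (s := [:: r; s]).
- by move=> C; rewrite !inE => /orP[]/eqP->; [exact: idem_rankP rr|exact: idem_rankP rs].
- by move=> C D; rewrite !inE => /orP[]/eqP-> /orP[]/eqP->; rewrite ?rs0 ?sr0.
have [I rI] := H r (mem_head _ _); have [|J sJ] := H s; first by rewrite !inE eqxx orbT.
have I1 : #|I| = 1%N by apply: (idem_rank_uniq divR _ rr); rewrite rI; exact: idem_rank_proj.
have J1 : #|J| = 1%N by apply: (idem_rank_uniq divR _ rs); rewrite sJ; exact: idem_rank_proj.
have IJ : I :&: J = set0.
  apply/(@set_mx_inj R)/(@conj_mx_inj _ _ E).
  by rewrite -set_mxM conj_mxM -/(proj _ _) -/(proj _ _) -rI -sJ rs0 set_mx0 conj_mx0.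
have [E' F'] := F E; rewrite rI sJ !F' //.
by rewrite /proj -conj_mxM set_mxM IJ set_mx0 conj_mx0.
Qed.

Lemma proj_mul_entry E E1 a b : (proj E [set a] *m proj E1 [set b] = 0) <->
  (E *m glmx_inv E1) a b = 0.
Proof.
have -> : proj E [set a] *m proj E1 [set b] =
    glmx_inv E *m (delta_mx a a *m (E *m glmx_inv E1) *m delta_mx b b) *m E1.
  by rewrite !proj_set1E !mulmxA.
have -> : delta_mx a a *m (E *m glmx_inv E1) *m delta_mx b b = (E *m glmx_inv E1) a b *: delta_mx a b.
  set M := E *m _; apply/matrixP=> i j; rewrite mxE (bigD1 b) //= big1 ?addr0 => [|c cb]; last first.
    by rewrite [delta_mx b b c j]mxE (negPf cb) mulr0.
  rewrite mxE (bigD1 a) //= big1 ?addr0 => [|c ca]; last first.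
    by rewrite [delta_mx a a i c]mxE (negPf ca) andbF mul0r.
  by rewrite !mxE !eqxx andbT /=; case: (i == a); rewrite ?mul1r ?mul0r ?mulr0 //=.
split=> [H|->]; last by rewrite scale0r mulmx0 mul0mx.
have := congr1 (fun X : 'M_n => (E *m X *m glmx_inv E1) a b) H.
rewrite /= !mulmxA glmxV mul1mx -(mulmxA _ E1) glmxV mulmx1 mulmx0 mul0mx.
by rewrite !mxE !eqxx mulr1.
Qed.

Section PairSupport.
Variables (M N : 'M[R]_n).
Hypothesis MN : M *m N = 1%:M.

(** In the 2 by 2 block at [i], [j]: the inverse of a triangular matrix is triangular of the same
    kind. *)
Lemma pair_support_inv (i j : 'I_n) : i != j ->
  (forall a b, a != b -> ~~ ((a \in [set i; j]) && (b \in [set i; j])) -> M a b = 0) ->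
  (forall a b, a != b -> ~~ ((a \in [set i; j]) && (b \in [set i; j])) -> N a b = 0) ->
  N i j = 0 -> M i j = 0.
Proof.
move=> ij HM HN Nij.
have ji : j != i by rewrite eq_sym.
have /matrixP/(_ j j) := MN; rewrite [RHS]mxE eqxx mxE (bigD1 j) //= big1 ?addr0 => [Mjj|c cj].
  have /matrixP/(_ i j) := MN; rewrite [RHS]mxE (negPf ij) mxE (bigD1 j) //= big1 ?addr0 => [Mij|c cj].
    have /divR u : N j j != 0 by apply: contra_eq_neq Mjj => ->; rewrite mulr0 eq_sym oner_neq0.
    by apply: (mulIr u); rewrite Mij mul0r.
  have [->|ci] := eqVneq c i; first by rewrite Nij mulr0.
  by rewrite [N c j]HN ?mulr0 // !inE (negPf cj) (negPf ci).
have [->|ci] := eqVneq c i; first by rewrite Nij mulr0.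
by rewrite [N c j]HN ?mulr0 // !inE (negPf cj) (negPf ci).
Qed.

End PairSupport.

Lemma near_row E E1 l : (forall a, a != l -> (E1 *m glmx_inv E) l a = 0) ->
  samept (proj E1 [set l]) (proj E [set l]).
Proof.
set G := E1 *m _ => H; rewrite /samept !proj_set1E.
have -> : glmx_inv E1 *m delta_mx l l *m E1 *m (glmx_inv E *m delta_mx l l *m E) =
    glmx_inv E1 *m (delta_mx l l *m G *m delta_mx l l) *m E by rewrite /G !mulmxA.
have -> : delta_mx l l *m G *m delta_mx l l = delta_mx l l *m G.
  apply/matrixP=> i j; rewrite mxE (bigD1 l) //= big1 ?addr0 => [|c cl]; last first.
    by rewrite [delta_mx l l c j]mxE (negPf cl) mulr0.
  rewrite [delta_mx l l l j]mxE eqxx; have [->|jl] := eqVneq j l; first by rewrite mulr1.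
  rewrite mulr0 mxE big1 // => c _; rewrite mxE.
  by have [->|cl] := eqVneq c l; rewrite ?andbF ?mul0r // H ?mulr0.
by rewrite /G !mulmxA -[LHS]mulmxA glVmx mulmx1.
Qed.

Lemma near_col E E1 l : (forall a, a != l -> (E1 *m glmx_inv E) a l = 0) ->
  samehyp (proj E1 [set l]) (proj E [set l]).
Proof.
set G := E1 *m _ => H; rewrite /samehyp !proj_set1E.
have -> : glmx_inv E1 *m delta_mx l l *m E1 *m (glmx_inv E *m delta_mx l l *m E) =
    glmx_inv E1 *m (delta_mx l l *m G *m delta_mx l l) *m E by rewrite /G !mulmxA.
have -> : delta_mx l l *m G *m delta_mx l l = G *m delta_mx l l.
  rewrite -mulmxA; apply/matrixP=> i j; rewrite mxE (bigD1 l) //= big1 ?addr0 => [|c cl]; last first.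
    by rewrite [delta_mx l l i c]mxE (negPf cl) andbF mul0r.
  rewrite [delta_mx l l i l]mxE eqxx andbT; have [->|il] := eqVneq i l; first by rewrite mul1r.
  rewrite mul0r mxE big1 // => c _; rewrite [delta_mx l l c j]mxE.
  by have [->|cl] := eqVneq c l; rewrite ?mulr0 // H ?mul0r.
by rewrite /G !mulmxA glVmx mul1mx.
Qed.

Section ElementaryMove.
Variables (f g : 'M[R]_n -> 'M[R]_n).
Hypothesis fg : frame_bij f g.

Let n2 : (2 * 1 < n)%N. Proof. by []. Qed.

Lemma elem_support E E1 E' E1' (i j : 'I_n) (c : R) (ij : i != j) :
  E1 = gl_elem c ij *m E :> 'M_n -> maps_frame 1 f E E' -> maps_frame 1 f E1 E1' ->
  (forall a b, a != b -> ~~ ((a \in [set i; j]) && (b \in [set i; j])) -> (E1' *m glmx_inv E') a b = 0) /\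
  (forall a b, a != b -> ~~ ((a \in [set i; j]) && (b \in [set i; j])) -> (E' *m glmx_inv E1') a b = 0).
Proof.
move=> H F F1; split; first exact: (maps_frame_elem (k := 1) _ n2 H F F1).
apply: (maps_frame_elem (k := 1) (ij := ij) (c := - c) _ n2 _ F1 F) => //.
rewrite H mulmxA; have -> : gl_elem (- c) ij *m gl_elem c ij = 1%:M; last by rewrite mul1mx.
by rewrite -(glVmx (gl_elem c ij)); congr (_ *m _); rewrite /= scaleNr.
Qed.

(** A block at [i], [j] with both off-diagonal entries nonzero has to be excluded. For a third index
    [l] let [E2] be the frame moved by the elementary matrix at (i, l). The member [j] of [E1] and
    the member [l] of [E2] are orthogonal on both sides, so their images are, and each product
    reduces to one term through [i]. *)
Lemma elem_triangular E E1 E' E1' (i j : 'I_n) (ij : i != j) :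
  E1 = glM (gl_elem 1 ij) E -> maps_frame 1 f E E' -> maps_frame 1 f E1 E1' ->
  ((E1' *m glmx_inv E') i j = 0 /\ (E' *m glmx_inv E1') i j = 0) \/
  ((E1' *m glmx_inv E') j i = 0 /\ (E' *m glmx_inv E1') j i = 0).
Proof.
move=> E1E F F1; have [Ff Fg C] := fg.
have [l] : exists l, l \notin [set i; j].
  by apply: notin_small; rewrite cards2 ij card_ord.
rewrite !inE negb_or => /andP[li lj].
have il : i != l by rewrite eq_sym.
have jl : j != l by rewrite eq_sym.
have [E2' F2] := Ff (glM (gl_elem 1 il) E).
have [S1 S1'] := elem_support (ij := ij) (c := 1) (congr1 (@glmx_val R n) E1E) F F1.
have [S2 S2'] := elem_support (E := E) (E1 := glM (gl_elem 1 il) E) (ij := il) (c := 1) erefl F F2.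
set E2 := glM _ E in F2.
pose G := E1' *m glmx_inv E'; pose G' := E' *m glmx_inv E1'.
pose H := E2' *m glmx_inv E'; pose H' := E' *m glmx_inv E2'.
have GG' : G *m G' = 1%:M := glmxV (glM E1' (glI E')).
have G'G : G' *m G = 1%:M := glmxV (glM E' (glI E1')).
have HH' : H *m H' = 1%:M := glmxV (glM E2' (glI E')).
have suff1 : G' i j = 0 \/ G j i = 0.
  have o1 : proj E1 [set j] *m proj E2 [set l] = 0.
    apply/proj_mul_entry; rewrite E1E /= mulmxA -(mulmxA _ E) glmxV mulmx1.
    rewrite mxE big1 // => c _; rewrite -[X in X * _]/(gl_elem 1 ij j c) -[X in _ * X]/(glmx_inv (gl_elem 1 il) c l).
    rewrite gl_elem_entry gl_elem_inv_entry eqxx andbT [j == i]eq_sym (negPf ij) mulr0n addr0.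
    have [<-|] := eqVneq j c; last by rewrite mul0r.
    by rewrite (negPf jl) [j == i]eq_sym (negPf ij) mulr0n subr0 mulr0.
  have o2 : proj E2 [set l] *m proj E1 [set j] = 0.
    apply/proj_mul_entry; rewrite E1E /= mulmxA -(mulmxA _ E) glmxV mulmx1.
    rewrite mxE big1 // => c _; rewrite -[X in X * _]/(gl_elem 1 il l c) -[X in _ * X]/(glmx_inv (gl_elem 1 ij) c j).
    rewrite gl_elem_entry gl_elem_inv_entry eqxx andbT (negPf li) mulr0n addr0.
    have [<-|] := eqVneq l c; last by rewrite mul0r.
    by rewrite (negPf lj) (negPf li) mulr0n subr0 mulr0.
  have := frame_map_orth Ff (proj_rank1 _ _) (proj_rank1 _ _) o1 o2.
  rewrite (maps_frame1 _ F1) (maps_frame1 _ F2) => /proj_mul_entry.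
  have -> : E1' *m glmx_inv E2' = G *m H'.
    by rewrite /G /H' mulmxA -(mulmxA _ _ (glmx_val E')) glVmx mulmx1.
  rewrite mxE (bigD1 i) //= big1 ?addr0 => [o1'|c ci]; last first.
    have [->|cj] := eqVneq c j; first by rewrite [H' j l]S2' ?mulr0 // !inE [j == i]eq_sym (negPf ij) (negPf jl).
    by rewrite [G j c]S1 ?mul0r 1?eq_sym // !inE (negPf ci) (negPf cj) andbF.
  have := frame_map_orth Ff (proj_rank1 _ _) (proj_rank1 _ _) o2 o1.
  rewrite (maps_frame1 _ F1) (maps_frame1 _ F2) => /proj_mul_entry.
  have -> : E2' *m glmx_inv E1' = H *m G'.
    by rewrite /G' /H mulmxA -(mulmxA _ _ (glmx_val E')) glVmx mulmx1.
  rewrite mxE (bigD1 i) //= big1 ?addr0 => [o2'|c ci]; last first.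
    have [->|cl] := eqVneq c l; first by rewrite [G' l j]S1' ?mulr0 // !inE (negPf li) (negPf lj).
    by rewrite [H l c]S2 ?mul0r 1?eq_sym // !inE (negPf ci) (negPf cl) andbF.
  have [H'il|H'il] := eqVneq (H' i l) 0; last first.
    right; apply: contrapT => /eqP Gji; have := mulf_neq0_div divR Gji H'il; by rewrite o1' eqxx.
  have [Hli|Hli] := eqVneq (H l i) 0; last first.
    left; apply: contrapT => /eqP Gij; have := mulf_neq0_div divR Hli Gij; by rewrite o2' eqxx.
  have Hil : H i l = 0 by apply: (pair_support_inv HH' il S2 S2' H'il).
  (* In the remaining case the transition from [E'] to [E2'] has a diagonal row and column [l], so
     the distinct members [l] of [E] and [E2] have the same image. *)
  have PE : proj E' [set l] = proj E2' [set l].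
    apply/proj_eqP/comm_set_mx => a b; rewrite !inE -/H => ab.
    have ab' : a != b by apply: contraNneq ab => ->.
    have [/andP[]|/S2->//] := boolP ((a \in [set i; l]) && (b \in [set i; l])).
    rewrite !inE => /orP[]/eqP E0 /orP[]/eqP E0'; rewrite E0 E0' ?eqxx in ab ab' *; by [].
  have : proj E [set l] = proj E2 [set l].
    have [<- _] := C _ (proj_rank1 E l); have [<- _] := C _ (proj_rank1 E2 l).
    by rewrite (maps_frame1 _ F) (maps_frame1 _ F2) PE.
  rewrite proj_glM => /(congr1 (conj_mx (glI E))); rewrite {1}/proj !conj_mxI.
  rewrite proj_elemC ?inE ?eqxx // scale1r => /eqP; rewrite eq_sym -subr_eq0 addrAC subrr sub0r oppr_eq0.
  by move=> /eqP/matrixP/(_ i l)/eqP; rewrite !mxE !eqxx oner_eq0.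
have S1i : forall a b, a != b -> ~~ ((a \in [set j; i]) && (b \in [set j; i])) -> G a b = 0.
  by move=> a b; rewrite setUC; exact: S1.
have S1i' : forall a b, a != b -> ~~ ((a \in [set j; i]) && (b \in [set j; i])) -> G' a b = 0.
  by move=> a b; rewrite setUC; exact: S1'.
have ji : j != i by rewrite eq_sym.
case: suff1 => [G'ij|Gji]; [left|right]; split=> //.
  exact: (pair_support_inv GG' ij S1 S1' G'ij).
exact: (pair_support_inv G'G ji S1i' S1i Gji).
Qed.

(** In normal form, triangularity of the image block leaves a row or a column of the transition
    matrix at [l] with only its diagonal entry, that is, a common point or a common hyperplane. *)
Lemma near_map r s : idem_rank 1 r -> idem_rank 1 s -> near r s -> near (f r) (f s).
Proof.
move=> rr rs rN; have [Ff _ _] := fg.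
have [<-|/eqP sN] := eqVneq r s; first by left; exact: idem_rankP (frame_map_rank Ff rr).
have [E [i [j [ij [l [lij -> ->]]]]]] := near_normal divR rr rs rN sN.
have [E' F] := Ff E; have [E1' F1] := Ff (glM (gl_elem 1 ij) E).
rewrite (maps_frame1 _ F) (maps_frame1 _ F1).
apply: (near_sym divR); try exact: proj_rank1.
have [S1 S1'] := elem_support (E := E) (E1 := glM (gl_elem 1 ij) E) (ij := ij) (c := 1) erefl F F1.
have ji : j != i by rewrite eq_sym.
move: lij; rewrite !inE => /orP[]/eqP ->; have [[G G']|[G G']] := @elem_triangular E _ _ _ _ _ ij erefl F F1.
- left; apply: near_row => a ai; have [->//|aj] := eqVneq a j.
  by rewrite S1 1?eq_sym // !inE (negPf ai) (negPf aj) andbF.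
- right; apply: near_col => a ai; have [->//|aj] := eqVneq a j.
  by rewrite S1 // !inE (negPf ai) (negPf aj).
- right; apply: near_col => a aj; have [->//|ai] := eqVneq a i.
  by rewrite S1 // !inE (negPf ai) (negPf aj).
- left; apply: near_row => a aj; have [->//|ai] := eqVneq a i.
  by rewrite S1 1?eq_sym // !inE (negPf ai) (negPf aj) andbF.
Qed.

End ElementaryMove.

End NearMap.

Record equiv_on T (X : T -> Prop) (A : T -> T -> Prop) := EquivOn {
  eqv_refl : forall r, X r -> A r r;
  eqv_sym : forall r s, X r -> X s -> A r s -> A s r;
  eqv_trans : forall r s t, X r -> X s -> X t -> A r s -> A s t -> A r t }.

(* The neighbours of [r] in the rook graph [A \/ B] form two cliques without
   edges between them; adjacency alone distinguishes the cliques, up to a swap. *)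
Lemma rook_local T (X : T -> Prop) (A B A' B' : T -> T -> Prop) (f : T -> T) (r s1 : T) :
  equiv_on X A -> equiv_on X B -> equiv_on X A' -> equiv_on X B' ->
  (forall r s, A r s -> B r s -> r = s) -> (forall r s, A' r s -> B' r s -> r = s) ->
  (forall r, X r -> X (f r)) -> (forall r s, X r -> X s -> f r = f s -> r = s) ->
  (forall r s, X r -> X s -> A r s \/ B r s <-> A' (f r) (f s) \/ B' (f r) (f s)) ->
  X r -> X s1 -> r <> s1 -> A r s1 -> A' (f r) (f s1) ->
  (forall s, X s -> A r s -> A' (f r) (f s)) /\ (forall s, X s -> B r s -> B' (f r) (f s)).
Proof.
move=> eA eB eA' eB' AB AB' fX fI fN rX sX rs Ars Ars'; split=> s Xs rel.
  have [//|Brs'] := (fN r s rX Xs).1 (or_introl rel).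
  have As1 := eqv_trans eA Xs rX sX (eqv_sym eA rX Xs rel) Ars.
  have [Ass'|Bss'] := (fN _ _ Xs sX).1 (or_introl As1).
    exact: (eqv_trans eA' (fX _ rX) (fX _ sX) (fX _ Xs) Ars' (eqv_sym eA' (fX _ Xs) (fX _ sX) Ass')).
  have := eqv_trans eB' (fX _ rX) (fX _ Xs) (fX _ sX) Brs' Bss'.
  by move=> /(AB' _ _ Ars')/(fI _ _ rX sX).
have [As'|//] := (fN r s rX Xs).1 (or_intror rel).
have As1' := eqv_trans eA' (fX _ Xs) (fX _ rX) (fX _ sX) (eqv_sym eA' (fX _ rX) (fX _ Xs) As') Ars'.
have [As1|Bs1] := (fN _ _ Xs sX).2 (or_introl As1').
  have Ars2 := eqv_trans eA rX sX Xs Ars (eqv_sym eA Xs sX As1).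
  by rewrite -(AB _ _ Ars2 rel); apply: (eqv_refl eB'); exact: fX.
by have := AB _ _ Ars (eqv_trans eB rX Xs sX rel Bs1).
Qed.

(** * Global choice between collineation and correlation *)

Section Rook.
Variable R : unitRingType.
Hypothesis divR : forall x : R, x != 0 -> x \is a GRing.unit.
Variable n : nat.
Hypothesis n3 : (3 <= n)%N.
Variables (f g : 'M[R]_n -> 'M[R]_n).
Hypothesis fg : frame_bij f g.
Implicit Types (E : glmx R n) (r s t : 'M[R]_n).

Lemma samept_equiv : equiv_on (@idem_rank R n 1) (@samept R n).
Proof.
split=> [r /idem_rankP//|r s rr rs|r s t _ _ _]; first exact: samept_sym.
exact: samept_trans.
Qed.

Lemma samehyp_equiv : equiv_on (@idem_rank R n 1) (@samehyp R n).
Proof.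
split=> [r /idem_rankP//|r s rr rs|r s t _ _ _]; first exact: samehyp_sym.
exact: samehyp_trans.
Qed.

Lemma ex_samept r : idem_rank 1 r -> exists s, [/\ idem_rank 1 s, r <> s & samept r s].
Proof.
move=> [E [I [/eqP/cards1P[j ->] ->]]].
have [i] : exists i, i \notin [set j] by apply: notin_small; rewrite cards1 card_ord ltnW.
rewrite inE => ij; exists (proj (glM (gl_elem 1 ij) E) [set j]); split; first exact: proj_rank1.
  move=> /proj_eqP/comm_set_mx/(_ i j); rewrite !inE eqxx (negPf ij) => /(_ isT).
  rewrite glME -mulmxA glmxV mulmx1 gl_elem_entry (negPf ij) !eqxx add0r => /eqP.
  by rewrite oner_eq0.
apply: (samept_sym divR); try exact: proj_rank1.
apply: near_row => a aj; rewrite glME -mulmxA glmxV mulmx1 gl_elem_entry.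
by rewrite eq_sym (negPf aj) andbF addr0.
Qed.

Lemma frame_bij_inj r s : idem_rank 1 r -> idem_rank 1 s -> f r = f s -> r = s.
Proof. by have [_ _ C] := fg => /C[gr _] /C[gs _] E; rewrite -gr E gs. Qed.

Lemma near_map_iff r s : idem_rank 1 r -> idem_rank 1 s -> near r s <-> near (f r) (f s).
Proof.
move=> rr rs; split; first exact: near_map fg _ _ rr rs.
have [Ff _ C] := fg; have [gr _] := C _ rr; have [gs _] := C _ rs.
have := near_map divR n3 (frame_bij_sym fg) (frame_map_rank Ff rr) (frame_map_rank Ff rs).
by rewrite gr gs.
Qed.

(** The local behaviour of a collineation; [crossed] is that of a correlation, which exchanges
    points and hyperplanes. *)
Definition straight r := (forall s, idem_rank 1 s -> samept r s -> samept (f r) (f s)) /\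
  (forall s, idem_rank 1 s -> samehyp r s -> samehyp (f r) (f s)).
Definition crossed r := (forall s, idem_rank 1 s -> samept r s -> samehyp (f r) (f s)) /\
  (forall s, idem_rank 1 s -> samehyp r s -> samept (f r) (f s)).

Lemma straight_or_crossed r : idem_rank 1 r -> straight r \/ crossed r.
Proof.
move=> rr; have [s [rs rNs rsp]] := ex_samept rr; have [Ff _ _] := fg.
have rk := frame_map_rank Ff.
have [H|H] := (near_map_iff rr rs).1 (or_introl rsp); [left|right].
  exact: (rook_local samept_equiv samehyp_equiv samept_equiv samehyp_equiv
    (@samept_samehyp R n) (@samept_samehyp R n) rk frame_bij_inj near_map_iff rr rs rNs rsp H).
apply: (rook_local samept_equiv samehyp_equiv samehyp_equiv samept_equiv
    (@samept_samehyp R n) _ rk frame_bij_inj _ rr rs rNs rsp H).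
- by move=> r' s' /[swap]; exact: samept_samehyp.
- by move=> r' s' rr' rs'; rewrite [X in _ <-> X]orC; exact: near_map_iff.
Qed.

(** Were [s] crossed, the images of [r] and [s] would share both point and hyperplane, so r = s by
    injectivity. *)
Lemma straight_near r s : idem_rank 1 r -> idem_rank 1 s -> near r s -> straight r -> straight s.
Proof.
move=> rr rs rN [S1 S2]; have [//|[C1 C2]] := straight_or_crossed rs.
have [Ff _ _] := fg; have rk := frame_map_rank Ff.
suff <- : r = s by [].
apply: frame_bij_inj => //; case: rN => N.
  apply: samept_samehyp; first exact: S1.
  by apply: (samehyp_sym divR (rk _ rs) (rk _ rr)); apply: C1 => //; exact: (samept_sym divR rr rs).
apply: samept_samehyp; last exact: S2.
by apply: (samept_sym divR (rk _ rs) (rk _ rr)); apply: C2 => //; exact: (samehyp_sym divR rr rs).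
Qed.

Lemma all_straight_or_crossed :
  (forall r, idem_rank 1 r -> straight r) \/ (forall r, idem_rank 1 r -> crossed r).
Proof.
have [[r [rr rS]]|H] := pselect (exists r, idem_rank 1 r /\ straight r); [left|right] => s rs.
  exact: (near_connect divR straight_near rr rs rS).
by have [S|//] := straight_or_crossed rs; case: H; exists s.
Qed.

End Rook.

(** * The fundamental theorem of projective geometry *)

Section Core.
Variables R R' : unitRingType.
Hypothesis divR : forall x : R, x != 0 -> x \is a GRing.unit.
Hypothesis divR' : forall x : R', x != 0 -> x \is a GRing.unit.
Variable n : nat.
Hypothesis n3 : (3 <= n)%N.
Variables (p : 'rV[R]_n -> 'rV[R']_n) (h : 'cV[R]_n -> 'cV[R']_n).
Hypothesis inc : forall (x : 'rV[R]_n) (y : 'cV[R]_n), x != 0 -> y != 0 -> pairing x y = 0 <-> pairing (p x) (h y) = 0.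
Hypothesis p_delta : forall l, exists2 c, c != 0 & p (delta_mx 0 l) = c *: delta_mx 0 l.
Hypothesis p_one : exists2 c, c != 0 & p (const_mx 1) = const_mx c.
Implicit Types (i j l : 'I_n) (x : 'rV[R]_n) (y : 'cV[R]_n).

Lemma row_neq0 (S : nzRingType) (x : 'rV[S]_n) i : x 0 i != 0 -> x != 0.
Proof. by apply: contraNneq => ->; rewrite mxE. Qed.
Lemma col_neq0 (S : nzRingType) (y : 'cV[S]_n) i : y i 0 != 0 -> y != 0.
Proof. by apply: contraNneq => ->; rewrite mxE. Qed.

Lemma delta_row_neq0 i : delta_mx 0 i != 0 :> 'rV[R]_n.
Proof. by apply: (@row_neq0 _ _ i); rewrite mxE !eqxx oner_neq0. Qed.
Lemma delta_col_neq0 i : delta_mx i 0 != 0 :> 'cV[R]_n.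
Proof. by apply: (@col_neq0 _ _ i); rewrite mxE !eqxx oner_neq0. Qed.

Lemma mulf_eq0_div (S : unitRingType) (dS : forall x : S, x != 0 -> x \is a GRing.unit) (a b : S) :
  a != 0 -> a * b = 0 -> b = 0.
Proof. by move=> a0 ab; apply: contrapT => /eqP/(mulf_neq0_div dS a0); rewrite ab eqxx. Qed.

Lemma h_coord y l : y != 0 -> (h y) l 0 = 0 <-> y l 0 = 0.
Proof.
move=> y0; have [c c0 pE] := p_delta l.
have := inc (delta_row_neq0 l) y0; rewrite pE pairingZ !pairing_deltal => I.
by split=> [H|/I]; [apply/I; rewrite H mulr0|exact: mulf_eq0_div].
Qed.

Lemma p_coord x l : x != 0 -> (p x) 0 l = 0 <-> x 0 l = 0.
Proof.
move=> x0; have := inc x0 (delta_col_neq0 l); rewrite pairing_deltar /pairing [X in _ <-> X = 0]mxE.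
rewrite (bigD1 l) //= big1 ?addr0 => [|j jl]; last first.
  have -> : h (delta_mx l 0) j 0 = 0 by apply/h_coord; rewrite ?delta_col_neq0 // mxE (negPf jl).
  by rewrite mulr0.
move=> I; split=> [H|/I H]; first by apply/I; rewrite H mul0r.
apply: contrapT => /eqP pl; have /eqP hl := mulf_eq0_div divR' pl H.
by move/eqP/h_coord: hl; rewrite mxE !eqxx => /(_ (delta_col_neq0 l))/eqP; rewrite oner_eq0.
Qed.

Definition line_col i j (a : R) : 'cV[R]_n := delta_mx j 0 - delta_mx i 0 *m a%:M.

Lemma delta_scale i (a : R) l : ((delta_mx i 0 : 'cV[R]_n) *m a%:M) l 0 = a *+ (l == i).
Proof. by rewrite mxE big_ord1 !mxE eqxx andbT mulr1n; case: eqP; rewrite ?mul1r ?mul0r. Qed.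

Lemma line_colE i j a l : line_col i j a l 0 = (l == j)%:R - a *+ (l == i).
Proof. by rewrite /line_col mxB delta_scale mxE eqxx andbT. Qed.

Lemma line_col_neq0 i j a : i != j -> line_col i j a != 0.
Proof.
move=> ij; apply: (@col_neq0 _ _ j); rewrite line_colE eqxx [j == i]eq_sym (negPf ij) subr0.
exact: oner_neq0.
Qed.

Lemma pairing_line x i j a : pairing x (line_col i j a) = x 0 j - x 0 i * a.
Proof.
rewrite /pairing /line_col mulmxBr mulmxA -!colE mxB [col j x 0 0]mxE.
by rewrite mxE big_ord1 !mxE eqxx mulr1n.
Qed.

(* The hyperplane [x_j = x_i a] contains all coordinate points except the
   [i]-th and the [j]-th; hence so does its image, which has an equation
   [x_j = x_i b]. *)
Definition scal i j a : R' := - (h (line_col i j a) i 0 * (h (line_col i j a) j 0)^-1).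

Lemma pairing2 (x : 'rV[R']_n) (y : 'cV[R']_n) i j : i != j ->
  (forall l, l != i -> l != j -> y l 0 = 0) -> pairing x y = x 0 i * y i 0 + x 0 j * y j 0.
Proof.
move=> ij H; rewrite /pairing mxE (bigD1 i) //= (bigD1 j) 1?eq_sym //= big1 ?addr0 // => l /andP[li lj].
by rewrite H ?mulr0.
Qed.

Lemma p_line x i j a : i != j -> x != 0 -> x 0 j = x 0 i * a -> (p x) 0 j = (p x) 0 i * scal i j a.
Proof.
move=> ij x0 xE; have y0 := line_col_neq0 a ij; set y := line_col i j a in y0.
have : pairing x y = 0 by rewrite pairing_line xE subrr.
move=> /(inc x0 y0); rewrite (pairing2 _ ij); last first.
  move=> l li lj; apply/(h_coord _ y0); by rewrite line_colE (negPf li) (negPf lj) subr0.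
have /divR' u : h y j 0 != 0.
  apply/eqP=> /(h_coord _ y0); rewrite line_colE eqxx [j == i]eq_sym (negPf ij) subr0 => /eqP.
  by rewrite oner_eq0.
move=> /eqP; rewrite addrC addr_eq0 => /eqP H.
by apply: (mulIr u); rewrite H /scal -/y mulrN mulNr !mulrA mulrVK.
Qed.

Lemma scal_one i j : i != j -> scal i j 1 = 1.
Proof.
move=> ij; have [c c0 pE] := p_one.
have x0 : const_mx 1 != 0 :> 'rV[R]_n by apply: (@row_neq0 _ _ i); rewrite mxE oner_neq0.
have := @p_line (const_mx 1) i j 1 ij x0; rewrite pE !mxE mulr1 => /(_ erefl) H.
by apply: (mulrI (divR' c0)); rewrite mulr1 -H.
Qed.

Lemma p_coord_neq0 x i : x 0 i != 0 -> (p x) 0 i != 0.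
Proof.
move=> xi; apply/eqP=> /(p_coord _ (row_neq0 xi))/eqP; by rewrite (negPf xi).
Qed.

Lemma scal_mul i j l a b : i != j -> j != l -> i != l -> scal i l (a * b) = scal i j a * scal j l b.
Proof.
move=> ij jl il.
(* The point with coordinates 1, a, ab: its three ratios are the arguments a, b and ab. *)
pose x : 'rV[R]_n := \row_m (if m == i then 1 else if m == j then a else if m == l then a * b else 0).
have xi : x 0 i = 1 by rewrite mxE eqxx.
have xj : x 0 j = a by rewrite mxE eqxx eq_sym (negPf ij).
have xl : x 0 l = a * b by rewrite mxE eqxx ![l == _]eq_sym (negPf il) (negPf jl).
have xi0 : x 0 i != 0 by rewrite xi oner_neq0.
have x0 := row_neq0 xi0; have u := divR' (p_coord_neq0 xi0).
apply: (mulrI u); rewrite mulrA -(p_line ij x0) ?xj ?xi ?mul1r //.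
by rewrite -(p_line jl x0) ?xl ?xj // -(p_line il x0) ?xl ?xi ?mul1r.
Qed.

Lemma third i j : exists l, i != l /\ j != l.
Proof.
have [l] : exists l, l \notin [set i; j].
  by apply: notin_small; rewrite cards2 card_ord; apply: leq_ltn_trans n3; case: (_ != _).
by rewrite !inE negb_or ![l == _]eq_sym => /andP[]; exists l.
Qed.

(** Multiplying by 1 in [scal_mul] changes one index at a time; if [j] and [i'] coincide, the change
    passes through a third index. *)
Lemma scalE i j i' j' a : i != j -> i' != j' -> scal i j a = scal i' j' a.
Proof.
have R1 k l l' : k != l -> k != l' -> scal k l a = scal k l' a.
  move=> kl kl'; have [->//|ll'] := eqVneq l l'.
  by rewrite -[in RHS](mulr1 a) (@scal_mul k l l') // scal_one ?mulr1.
have R2 k k' l : k != l -> k' != l -> scal k l a = scal k' l a.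
  move=> kl k'l; have [->//|kk'] := eqVneq k k'.
  by rewrite -[in LHS](mul1r a) (@scal_mul k k' l) // scal_one ?mul1r.
move=> ij ij'; have [ji'|ji'] := eqVneq j i'; last first.
  by rewrite (R2 i i' j) 1?[i' == j]eq_sym // (R1 i' j j') 1?[i' == j]eq_sym.
have [l [il jl]] := third i j.
by rewrite (R1 i j l) // (R2 i i' l) -?ji' // (R1 j l j') // ji'.
Qed.

Let o0 : 'I_n := Ordinal (ltnW (ltnW n3)).
Let o1 : 'I_n := Ordinal (ltnW n3).
Definition sigma := scal o0 o1.

Lemma scal_sigma i j a : i != j -> scal i j a = sigma a.
Proof. by move=> ij; exact: scalE. Qed.

Lemma p_prop x i j a : x != 0 -> x 0 j = x 0 i * a -> (p x) 0 j = (p x) 0 i * sigma a.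
Proof.
move=> x0 E; have [ij|ij] := eqVneq i j; last by rewrite (p_line ij x0 E) scal_sigma.
rewrite -ij in E *; have [xi|xi] := eqVneq (x 0 i) 0.
  by have /(p_coord _ x0) -> := xi; rewrite mul0r.
have -> : a = 1 by apply: (mulrI (divR xi)); rewrite mulr1.
by rewrite /sigma scal_one // mulr1.
Qed.

Lemma sigma1 : sigma 1 = 1. Proof. exact: scal_one. Qed.

Lemma sigmaM a b : sigma (a * b) = sigma a * sigma b.
Proof.
have o01 : o0 != o1 by []. have [l [l0 l1]] := third o0 o1.
by rewrite -(scal_sigma (a * b) l0) (@scal_mul o0 o1 l) // !scal_sigma.
Qed.

Lemma sigma0 : sigma 0 = 0.
Proof.
have x0 := delta_row_neq0 o0.
have := @p_prop (delta_mx 0 o0) o0 o1 0 x0; rewrite !mxE !eqxx /= mulr0 => /(_ erefl).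
have /(p_coord o1 x0) -> : (delta_mx 0 o0 : 'rV[R]_n) 0 o1 = 0 by rewrite mxE.
move=> /esym; apply: mulf_eq0_div => //; apply: p_coord_neq0.
by rewrite mxE !eqxx oner_neq0.
Qed.

Lemma pairing3 (x : 'rV[R']_n) (y : 'cV[R']_n) i j l : i != j -> j != l -> i != l ->
  (forall m, m != i -> m != j -> m != l -> y m 0 = 0) ->
  pairing x y = x 0 i * y i 0 + (x 0 j * y j 0 + x 0 l * y l 0).
Proof.
move=> ij jl il H; rewrite /pairing mxE (bigD1 i) //= (bigD1 j) 1?eq_sym //=.
rewrite (bigD1 l) ?[l == _]eq_sym ?il ?jl //= big1 ?addr0 // => m /andP[/andP[mi mj] ml].
by rewrite H ?mulr0.
Qed.

Lemma sigmaD a b : sigma (a + b) = sigma a + sigma b.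
Proof.
have [l [l0 l1]] := third o0 o1; have o01 : o0 != o1 by [].
(* The hyperplane x_o1 = x_o0 + x_l a. Its points o0 + o1 and l + a o1 determine the coefficients of
   the image hyperplane up to a factor; the point l + b o0 + (a + b) o1 then yields additivity. *)
pose y : 'cV[R]_n := delta_mx o1 0 - delta_mx o0 0 - delta_mx l 0 *m a%:M.
have yE m : y m 0 = (m == o1)%:R - (m == o0)%:R - a *+ (m == l).
  by rewrite /y !mxB delta_scale !mxE !eqxx !andbT.
have y1 : y o1 0 = 1 by rewrite yE eqxx (negPf l1) !subr0.
have y0 : y != 0 by apply: (@col_neq0 _ _ o1); rewrite y1 oner_neq0.
have yp x : pairing x y = x 0 o1 - x 0 o0 - x 0 l * a.
  rewrite /pairing /y !mulmxBr mulmxA -!colE !mxB [col o1 x 0 0]mxE [col o0 x 0 0]mxE.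
  by rewrite mxE big_ord1 !mxE eqxx mulr1n.
have hp (x : 'rV[R']_n) : pairing x (h y) = x 0 o0 * h y o0 0 + (x 0 o1 * h y o1 0 + x 0 l * h y l 0).
  apply: pairing3 => // m m0 m1 ml; apply/(h_coord _ y0).
  by rewrite yE (negPf m0) (negPf m1) (negPf ml) !subr0.
have u : h y o1 0 \is a GRing.unit.
  by apply: divR'; apply/eqP=> /(h_coord _ y0)/eqP; rewrite y1 oner_eq0.
have H0 : h y o0 0 = - h y o1 0.
  pose x : 'rV[R]_n := delta_mx 0 o0 + delta_mx 0 o1.
  have xE m : x 0 m = (m == o0)%:R + (m == o1)%:R by rewrite !mxE.
  have x00 : x 0 o0 != 0 by rewrite xE eqxx addr0 oner_neq0.
  have x0 := row_neq0 x00.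
  have : pairing x y = 0 by rewrite yp !xE !eqxx ![l == _]eq_sym (negPf l0) (negPf l1) !addr0 add0r mul0r subr0 subrr.
  move=> /(inc x0 y0); rewrite hp (p_prop (i := o0) (j := o1) (a := 1) x0) ?mulr1 ?xE ?eqxx ?addr0 ?add0r //.
  rewrite sigma1 mulr1; have -> : p x 0 l = 0.
    by apply/(p_coord _ x0); rewrite xE ![l == _]eq_sym (negPf l0) (negPf l1) addr0.
  rewrite mul0r addr0 -mulrDr => /(mulf_eq0_div divR' (p_coord_neq0 x00))/eqP.
  by rewrite addr_eq0 => /eqP.
have Hl : h y l 0 = - (sigma a * h y o1 0).
  pose x : 'rV[R]_n := delta_mx 0 l + a *: delta_mx 0 o1.
  have xE m : x 0 m = (m == l)%:R + a *+ (m == o1).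
    by rewrite !mxE eqxx /=; case: (m == o1); rewrite ?mulr1 ?mulr0.
  have xl0 : x 0 l != 0 by rewrite xE eqxx [l == _]eq_sym (negPf l1) addr0 oner_neq0.
  have x0 := row_neq0 xl0.
  have xl : x 0 l = 1 by rewrite xE eqxx [l == _]eq_sym (negPf l1) addr0.
  have x1 : x 0 o1 = a by rewrite xE eqxx (negPf l1) add0r.
  have x00 : x 0 o0 = 0 by rewrite xE (negPf l0) addr0.
  have : pairing x y = 0 by rewrite yp xl x1 x00 subr0 mul1r subrr.
  move=> /(inc x0 y0); rewrite hp (p_prop (i := l) (j := o1) (a := a) x0) ?xl ?x1 ?mul1r //.
  have -> : p x 0 o0 = 0 by apply/(p_coord _ x0).
  rewrite mul0r add0r -mulrA -mulrDr => /(mulf_eq0_div divR' (p_coord_neq0 xl0))/eqP.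
  by rewrite addrC addr_eq0 => /eqP.
pose x : 'rV[R]_n := delta_mx 0 l + b *: delta_mx 0 o0 + (a + b) *: delta_mx 0 o1.
have xE m : x 0 m = (m == l)%:R + b *+ (m == o0) + (a + b) *+ (m == o1).
  by rewrite !mxE eqxx /=; case: (m == o1); case: (m == o0); rewrite ?mulr1 ?mulr0.
have xl : x 0 l = 1 by rewrite xE eqxx ![l == _]eq_sym (negPf l0) (negPf l1) !addr0.
have x1 : x 0 o1 = a + b by rewrite xE eqxx (negPf l1) addr0 add0r.
have x00 : x 0 o0 = b by rewrite xE (negPf l0) add0r addr0.
have xl0 : x 0 l != 0 by rewrite xl oner_neq0.
have x0 := row_neq0 xl0.
have : pairing x y = 0 by rewrite yp xl x1 x00 mul1r addrK subrr.
move=> /(inc x0 y0); rewrite hp (p_prop (i := l) (j := o1) (a := a + b) x0) ?xl ?x1 ?mul1r //.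
rewrite (p_prop (i := l) (j := o0) (a := b) x0) ?xl ?x00 ?mul1r // H0 Hl.
rewrite -!mulrA -!mulrDr => /(mulf_eq0_div divR' (p_coord_neq0 xl0)).
rewrite mulrN -!mulNr -!mulrDl => E; have : - sigma b + (sigma (a + b) - sigma a) = 0.
  by apply: (mulIr u); rewrite E mul0r.
by move=> /eqP; rewrite addrC subr_eq0 subr_eq [X in _ == X]addrC => /eqP.
Qed.

Lemma sigmaN a : sigma (- a) = - sigma a.
Proof. by apply/eqP; rewrite -addr_eq0 -sigmaD addNr sigma0. Qed.

Lemma sigma_inv a : a != 0 -> sigma a^-1 = (sigma a)^-1.
Proof.
move=> /divR ua; have H : sigma a * sigma a^-1 = 1 by rewrite -sigmaM mulrV // sigma1.
have sa : sigma a != 0 by apply: contra_eq_neq H => ->; rewrite mul0r eq_sym oner_neq0.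
by apply: (mulrI (divR' sa)); rewrite H mulrV ?divR'.
Qed.

Lemma sigma_neq0 a : a != 0 -> sigma a != 0.
Proof.
move=> /divR ua; have H : sigma a * sigma a^-1 = 1 by rewrite -sigmaM mulrV // sigma1.
by apply: contra_eq_neq H => ->; rewrite mul0r eq_sym oner_neq0.
Qed.

Lemma p_sigma x : x != 0 -> exists2 c, c != 0 & p x = c *: map_mx sigma x.
Proof.
move=> x0; have [i0 [i xi]] := nz_entry x0; rewrite ord1 in xi.
exists ((p x) 0 i * (sigma (x 0 i))^-1).
  rewrite mulf_neq0_div ?p_coord_neq0 // -sigma_inv // sigma_neq0 //.
  by have := divR xi; rewrite -unitrV => u; apply: contraTneq u => ->; rewrite unitr0.
apply/matrixP=> j0 j; rewrite (ord1 j0) !mxE -mulrA -sigma_inv // -sigmaM.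
by apply: p_prop => //; rewrite mulrA mulrV ?divR // mul1r.
Qed.

Lemma h_sigma y : y != 0 -> exists2 c, c != 0 & h y = map_mx sigma y *m c%:M.
Proof.
move=> y0; have [i [i0 yi]] := nz_entry y0; rewrite ord1 in yi.
have hi : h y i 0 != 0 by apply/eqP=> /(h_coord _ y0)/eqP; rewrite (negPf yi).
exists ((sigma (y i 0))^-1 * h y i 0).
  rewrite mulf_neq0_div // -sigma_inv // sigma_neq0 //.
  by have := divR yi; rewrite -unitrV => u; apply: contraTneq u => ->; rewrite unitr0.
apply/matrixP=> j j0; rewrite (ord1 j0) [RHS]mxE big_ord1 !mxE eqxx mulr1n mulrA -sigma_inv // -sigmaM.
have [->|ji] := eqVneq j i; first by rewrite mulrV ?divR // sigma1 mul1r.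
(* A point of the hyperplane [y] with only the coordinates [j] and [i]; its image gives the ratio of
   these two coefficients of [h y]. *)
pose x : 'rV[R]_n := delta_mx 0 j + (- (y j 0 / y i 0)) *: delta_mx 0 i.
have xE m : x 0 m = (m == j)%:R + (- (y j 0 / y i 0)) *+ (m == i).
  by rewrite !mxE eqxx /=; case: (m == i); rewrite ?mulr1 ?mulr0.
have xj : x 0 j = 1 by rewrite xE eqxx (negPf ji) addr0.
have xi : x 0 i = - (y j 0 / y i 0) by rewrite xE eqxx [i == _]eq_sym (negPf ji) add0r.
have xj0 : x 0 j != 0 by rewrite xj oner_neq0.
have x0 := row_neq0 xj0.
have px m : m != j -> m != i -> p x 0 m = 0.
  by move=> mj mi; apply/(p_coord _ x0); rewrite xE (negPf mj) (negPf mi) addr0.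
have : pairing x y = 0.
  rewrite /pairing mxE (bigD1 j) //= (bigD1 i) 1?eq_sym //= big1 => [|m /andP[mj mi]]; last first.
    by rewrite xE (negPf mj) (negPf mi) addr0 mul0r.
  by rewrite xj xi mul1r addr0 mulNr mulrVK ?divR // subrr.
move=> /(inc x0 y0); rewrite /pairing mxE (bigD1 j) //= (bigD1 i) 1?eq_sym //=.
rewrite big1 => [|m /andP[mj mi]]; last by rewrite px ?mul0r.
rewrite addr0 (p_prop (i := j) (j := i) (a := - (y j 0 / y i 0)) x0) ?xj ?xi ?mul1r //.
rewrite -mulrA -mulrDr => /(mulf_eq0_div divR' (p_coord_neq0 xj0))/eqP.
by rewrite sigmaN mulNr subr_eq0 => /eqP.
Qed.

Lemma sigma_surj : (forall x' : 'rV[R']_n, x' != 0 -> exists2 x : 'rV[R]_n, x != 0 & exists2 c : R', c != 0 & p x = c *: x') ->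
  forall b, exists a, sigma a = b.
Proof.
move=> surj b; pose x' : 'rV[R']_n := delta_mx 0 o0 + b *: delta_mx 0 o1.
have x'E m : x' 0 m = (m == o0)%:R + b *+ (m == o1).
  by rewrite !mxE eqxx /=; case: (m == o1); rewrite ?mulr1 ?mulr0.
have x'0 : x' 0 o0 = 1 by rewrite x'E eqxx addr0.
have x'1 : x' 0 o1 = b by rewrite x'E eqxx add0r.
have [|x x0 [c c0 E]] := surj x'; first by apply: (@row_neq0 _ _ o0); rewrite x'0 oner_neq0.
have xo : x 0 o0 != 0.
  by apply/eqP=> /(p_coord _ x0)/eqP; rewrite E mxE x'0 mulr1 (negPf c0).
exists ((x 0 o0)^-1 * x 0 o1).
have := @p_prop x o0 o1 ((x 0 o0)^-1 * x 0 o1) x0; rewrite mulrA mulrV ?divR // mul1r => /(_ erefl).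
rewrite E ![(c *: x') _ _]mxE x'0 x'1 mulr1 => H.
by apply: (mulrI (divR' c0)); rewrite H.
Qed.

End Core.

(** * From maps of rank 1 idempotents to semilinear maps *)

Section Collineation.
Variables R R' : unitRingType.
Hypothesis divR : forall x : R, x != 0 -> x \is a GRing.unit.
Hypothesis divR' : forall x : R', x != 0 -> x \is a GRing.unit.
Variable n : nat.
Hypothesis n3 : (3 <= n)%N.

Lemma pairing_map (s : R -> R') (x : 'rV[R]_n) (y : 'cV[R]_n) :
  s 0 = 0 -> {morph s : a b / a + b} -> {morph s : a b / a * b} ->
  pairing (map_mx s x) (map_mx s y) = s (pairing x y).
Proof.
move=> s0 sD sM; rewrite /pairing !mxE (big_morph s sD s0).
by apply: eq_bigr => i _; rewrite !mxE sM.
Qed.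

Lemma ex_pairing_row (x : 'rV[R]_n) : x != 0 -> exists y, pairing x y = 1.
Proof.
move=> /nz_entry[i0 [i]]; rewrite (ord1 i0) => xi.
by exists (delta_mx i 0 *m (x 0 i)^-1%:M); rewrite pairingZr pairing_deltar mulrV ?divR.
Qed.

Lemma ex_pairing_col (y : 'cV[R]_n) : y != 0 -> exists x, pairing x y = 1.
Proof.
move=> /nz_entry[i [i0]]; rewrite (ord1 i0) => yi.
by exists ((y i 0)^-1 *: delta_mx 0 i); rewrite pairingZ pairing_deltal mulVr ?divR.
Qed.

Lemma pairing_neq0_row (S : nzRingType) (x : 'rV[S]_n) (y : 'cV[S]_n) : (x *m y) 0 0 = 1 -> x != 0.
Proof. by apply: contra_eq_neq => ->; rewrite mul0mx mxE eq_sym oner_neq0. Qed.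
Lemma pairing_neq0_col (S : nzRingType) (x : 'rV[S]_n) (y : 'cV[S]_n) : (x *m y) 0 0 = 1 -> y != 0.
Proof. by apply: contra_eq_neq => ->; rewrite mulmx0 mxE eq_sym oner_neq0. Qed.

Lemma rank1_mul0 (S : unitRingType) (x x' : 'rV[S]_n) (y y' z' : 'cV[S]_n) (z : 'rV[S]_n) :
  pairing z y = 1 -> pairing x' z' = 1 ->
  rank1 x y *m rank1 x' y' = 0 <-> pairing x y' = 0.
Proof.
move=> zy xz'; rewrite rank1M; split=> [H|->]; last by rewrite scale0r mulmx0.
have := congr1 (fun M => z *m M *m z') H.
rewrite /= mulmxA [z *m y]pairingE zy mul1mx -scalemxAl pairingE xz' mulmx0 mul0mx.
by move=> /matrixP/(_ 0 0); rewrite !mxE eqxx mulr1.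
Qed.

Variable phi : 'M[R]_n -> 'M[R']_n.
Hypothesis phi_rank : forall r, idem_rank 1 r -> idem_rank 1 (phi r).
Hypothesis phi_pt : forall r s, idem_rank 1 r -> idem_rank 1 s -> samept r s -> samept (phi r) (phi s).
Hypothesis phi_hyp : forall r s, idem_rank 1 r -> idem_rank 1 s -> samehyp r s -> samehyp (phi r) (phi s).
Hypothesis phi_inc : forall r s, idem_rank 1 r -> idem_rank 1 s -> r *m s = 0 <-> phi r *m phi s = 0.
Variable C : glmx R' n.
Hypothesis phi_frame : forall l, phi (set_mx R [set l]) = proj C [set l].
Hypothesis phi_surj : forall r', idem_rank 1 r' -> exists2 r, idem_rank 1 r & phi r = r'.

(** The idempotents [rank1 x y] with [x] fixed share their point, and so do their images; [q x] is
    one representative of the image point, valid for all [y]. *)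
Lemma row_map : exists q : 'rV[R]_n -> 'rV[R']_n, forall x y, pairing x y = 1 ->
  exists2 y', pairing (q x) y' = 1 & phi (rank1 x y) = rank1 (q x) y'.
Proof.
suff /choice[q qP] : forall x : 'rV[R]_n, exists x' : 'rV[R']_n, forall y, pairing x y = 1 ->
    exists2 y', pairing x' y' = 1 & phi (rank1 x y) = rank1 x' y' by exists q.
move=> x; have [->|/ex_pairing_row[y0 xy0]] := eqVneq x 0.
  by exists 0 => y; rewrite pairing0 => /eqP; rewrite eq_sym oner_eq0.
have r0 := rank1_idem_rank divR xy0.
have [x' [y0' [xy0' E0]]] := (idem_rank1P divR' _).1 (phi_rank r0).
exists x' => y xy; have r1 := rank1_idem_rank divR xy.
have [x1 [y1 [xy1 E1]]] := (idem_rank1P divR' _).1 (phi_rank r1).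
have : samept (rank1 x y) (rank1 x y0) by apply/(samept_rank1 xy xy0); exists 1; rewrite scale1r.
move=> /(phi_pt r1 r0); rewrite E0 E1 => /(samept_rank1 xy1 xy0')[a x1E].
exists (y1 *m a%:M); last by rewrite x1E /rank1 -mulmxA mul_scalar_mx.
by rewrite pairingZr (divR_inv divR' (a := a)) // -pairingZ -x1E.
Qed.

Lemma col_map : exists q : 'cV[R]_n -> 'cV[R']_n, forall x y, pairing x y = 1 ->
  exists2 x', pairing x' (q y) = 1 & phi (rank1 x y) = rank1 x' (q y).
Proof.
suff /choice[q qP] : forall y : 'cV[R]_n, exists y' : 'cV[R']_n, forall x, pairing x y = 1 ->
    exists2 x', pairing x' y' = 1 & phi (rank1 x y) = rank1 x' y'.
  by exists q => x y; exact: qP.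
move=> y; have [->|/ex_pairing_col[x0 xy0]] := eqVneq y 0.
  by exists 0 => x; rewrite /pairing mulmx0 mxE => /eqP; rewrite eq_sym oner_eq0.
have r0 := rank1_idem_rank divR xy0.
have [x0' [y' [xy0' E0]]] := (idem_rank1P divR' _).1 (phi_rank r0).
exists y' => x xy; have r1 := rank1_idem_rank divR xy.
have [x1 [y1 [xy1 E1]]] := (idem_rank1P divR' _).1 (phi_rank r1).
have : samehyp (rank1 x0 y) (rank1 x y).
  by apply/(samehyp_rank1 xy0 xy); exists 1; rewrite mulmx1.
move=> /(phi_hyp r0 r1); rewrite E0 E1 => /(samehyp_rank1 xy0' xy1)[a y1E].
exists (a *: x1); last by rewrite y1E /rank1 -mulmxA mul_scalar_mx.
by rewrite pairingZ (divR_inv divR' (b := a)) // -pairingZr -y1E.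
Qed.

(** Two rings are allowed because correlations take values over the opposite ring. The maps [q] on
    points and [t] on hyperplanes have to be normalized before the results on [sigma] apply. *)
Theorem collineation_semilinear : exists (s : R -> R') (D : glmx R' n),
  [/\ [/\ s 0 = 0, s 1 = 1, {morph s : a b / a + b} & {morph s : a b / a * b}],
      bijective s & forall r, idem_rank 1 r -> phi r = conj_mx D (map_mx s r)].
Proof.
have [q qP] := row_map; have [t tP] := col_map.
have qt_inc x y : x != 0 -> y != 0 -> pairing x y = 0 <-> pairing (q x) (t y) = 0.
  move=> /ex_pairing_row[y0 xy0] /ex_pairing_col[x0 xy].
  have [y' H1 E1] := qP _ _ xy0; have [x' H2 E2] := tP _ _ xy.
  have := phi_inc (rank1_idem_rank divR xy0) (rank1_idem_rank divR xy); rewrite E1 E2.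
  by rewrite (rank1_mul0 _ _ xy0 xy) (rank1_mul0 _ _ H1 H2).
have phiE x y : pairing x y = 1 -> pairing (q x) (t y) != 0 /\
    phi (rank1 x y) = rank1 ((pairing (q x) (t y))^-1 *: q x) (t y).
  move=> xy; have [y' H1 E1] := qP _ _ xy; have [x' H2 E2] := tP _ _ xy.
  have E : pairing (q x) (t y) *: x' = q x.
    by have := congr1 (mulmx (q x)) (etrans (esym E1) E2); rewrite !mul_rank1 H1 scale1r.
  have c0 : pairing (q x) (t y) != 0.
    by apply: contraNneq (pairing_neq0_row H1) => c0; rewrite -E c0 scale0r.
  move: E c0; set c := pairing _ _ => E c0; split=> //; by rewrite E2 -E scalerA mulVr ?divR' // scale1r.
(* [C] is the image of the coordinate frame; dividing by it makes the coordinate points fixed. *)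
pose q1 x := q x *m glmx_inv C; pose t1 y := C *m t y.
have qt1 x y : pairing (q1 x) (t1 y) = pairing (q x) (t y).
  by rewrite /pairing /q1 /t1 mulmxA glmxKVr.
have inc1 x y : x != 0 -> y != 0 -> pairing x y = 0 <-> pairing (q1 x) (t1 y) = 0.
  by move=> x0 y0; rewrite qt1; exact: qt_inc.
have q1_delta l : exists2 c, c != 0 & q1 (delta_mx 0 l) = c *: delta_mx 0 l.
  have xy : pairing (delta_mx 0 l : 'rV[R]_n) (delta_mx l 0) = 1.
    by rewrite pairing_deltal mxE !eqxx.
  have [y' H E] := qP _ _ xy; rewrite -set_mx1 phi_frame in E.
  have rc : pairing (row l C) (col l (glmx_inv C)) = 1.
    have <- : (C *m glmx_inv C) l l = 1 by rewrite glmxV mxE eqxx.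
    by rewrite /pairing !mxE; apply: eq_bigr => j _; rewrite !mxE.
  have CE : proj C [set l] = rank1 (row l C) (col l (glmx_inv C)).
    rewrite proj_set1E rowE colE /rank1 !mulmxA -(mulmxA _ (delta_mx l 0)).
    by rewrite mul_delta_mx.
  have : samept (rank1 (q (delta_mx 0 l)) y') (rank1 (row l C) (col l (glmx_inv C))).
    by rewrite -CE E /samept rank1M H scale1r.
  move=> /(samept_rank1 H rc)[a aE]; exists a; last first.
    by rewrite /q1 aE rowE -scalemxAl glmxKr.
  by apply: contraNneq (pairing_neq0_row H) => a0; rewrite aE a0 scale0r.
(* The unit point is on no coordinate hyperplane, so all coordinates [d] of its image are nonzero,
   and the diagonal matrix [T] rescales them to 1. *)
pose one : 'rV[R]_n := const_mx 1.
pose d : 'rV[R']_n := q1 one.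
have one0 : one != 0 by apply: (@row_neq0 _ _ _ (Ordinal (ltnW (ltnW n3)))); rewrite mxE oner_neq0.
have d0 i : d 0 i != 0.
  apply/eqP=> /(p_coord divR' inc1 q1_delta _ one0)/eqP.
  by rewrite mxE oner_eq0.
pose d' : 'rV[R']_n := \row_i (d 0 i)^-1.
have dd' i : d 0 i * d' 0 i = 1 by rewrite [d' _ _]mxE mulrV ?divR'.
have d'd i : d' 0 i * d 0 i = 1 by rewrite [d' _ _]mxE mulVr ?divR'.
pose T := gl_diag dd' d'd.
pose p x := q1 x *m glmx_inv T; pose h y := T *m t1 y.
have ph x y : pairing (p x) (h y) = pairing (q x) (t y).
  by rewrite -qt1 /pairing /p /h mulmxA glmxKVr.
have inc x y : x != 0 -> y != 0 -> pairing x y = 0 <-> pairing (p x) (h y) = 0.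
  by move=> x0 y0; rewrite ph; exact: qt_inc.
have p_delta l : exists2 c, c != 0 & p (delta_mx 0 l) = c *: delta_mx 0 l.
  have [c c0 E] := q1_delta l; exists (c * d' 0 l).
    by apply: mulf_neq0_div => //; apply: contra_eq_neq (d'd l) => ->; rewrite mul0r eq_sym oner_neq0.
  rewrite /p E -scalemxAl -scalerA; congr (_ *: _).
  apply/matrixP=> i j; rewrite ord1 mul_mx_diag !mxE eqxx /=.
  by case: eqP => [->|]; rewrite ?mul1r ?mulr1 ?mul0r ?mulr0.
have p_one : exists2 c, c != 0 & p (const_mx 1) = const_mx c.
  exists 1; first exact: oner_neq0.
  by apply/matrixP=> i j; rewrite ord1 /p mul_mx_diag mxE -/one -/d dd' mxE.
pose s := sigma n3 h.
have s1 : s 1 = 1 := sigma1 divR' n3 inc p_delta p_one.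
have s0 : s 0 = 0 := sigma0 divR divR' n3 inc p_delta p_one.
have sD : {morph s : a b / a + b} by apply: (sigmaD divR divR' n3 inc p_delta p_one).
have sM : {morph s : a b / a * b} by apply: (sigmaM divR' n3 inc p_delta p_one).
have pE := p_sigma divR divR' n3 inc p_delta p_one.
have hE := h_sigma divR divR' n3 inc p_delta p_one.
exists s, (glM T C); split=> //.
- have s_inj : injective s.
    move=> a b sab; apply/eqP; rewrite -subr_eq0; apply: contraT => /divR u.
    have sab0 : s (a - b) = 0.
      have := sD (a - b) b; rewrite subrK sab => /eqP.
      by rewrite -subr_eq subrr eq_sym => /eqP.
    have := s1; rewrite -(mulrV u) sM sab0 mul0r => /eqP.
    by rewrite eq_sym oner_eq0.
  have s_surj : forall b, exists a, s a = b.
    apply: (sigma_surj divR divR' n3 inc p_delta p_one) => x' x'0.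
    have x1 : x' *m T *m C != 0.
      by apply: contraNneq x'0 => H; rewrite -[x'](glmxKr T) -[x' *m T](glmxKr C) H !mul0mx.
    have [i [j x1j]] := nz_entry x1.
    have [y xy] : exists y, pairing (x' *m T *m C) y = 1.
      exists (delta_mx j 0 *m ((x' *m T *m C) 0 j)^-1%:M).
      by rewrite pairingZr pairing_deltar mulrV ?divR' // -(ord1 i).
    have [r rr rE] := phi_surj (rank1_idem_rank divR' xy).
    have [x [y0 [xy0 r0]]] := (idem_rank1P divR _).1 rr.
    exists x; first exact: pairing_neq0_row xy0.
    have [y' H E] := qP _ _ xy0.
    have : samept (rank1 (q x) y') (rank1 (x' *m T *m C) y).
      by rewrite -E -r0 rE /samept rank1M xy scale1r.
    move=> /(samept_rank1 H xy)[c cE]; exists c.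
      by apply: contraNneq (pairing_neq0_row H) => c0; rewrite cE c0 scale0r.
    by rewrite /p /q1 cE -!scalemxAl glmxKr glmxKr.
  have [s' s'P] := choice s_surj.
  by exists s' => [a|//]; apply: s_inj.
move=> r /(idem_rank1P divR)[x [y [xy ->]]].
have [c0 ->] := phiE _ _ xy.
have -> : rank1 ((pairing (q x) (t y))^-1 *: q x) (t y) =
    conj_mx (glM T C) (rank1 ((pairing (q x) (t y))^-1 *: p x) (h y)).
  have conjE (G : glmx R' n) a b : rank1 a b = conj_mx G (rank1 (a *m glmx_inv G) (G *m b)).
    by rewrite /conj_mx /rank1 !mulmxA glVmx mul1mx -mulmxA glVmx mulmx1.
  rewrite [LHS](conjE (glM T C)) /p /h /q1 /t1 glME mulmxA -scalemxAl; congr (conj_mx _ (rank1 (_ *: _) _)).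
  by rewrite /= mulmxA.
congr conj_mx; rewrite -ph.
(* The factors [a] and [b] come from the choice of representatives; they cancel against the inverse
   of the pairing, which is (a b)^-1. *)
have [a a0 pxE] := pE _ (pairing_neq0_row xy); have [b b0 hyE] := hE _ (pairing_neq0_col xy).
have -> : pairing (p x) (h y) = a * b.
  by rewrite pxE hyE pairingZ pairingZr (pairing_map _ _ s0 sD sM) xy s1 mul1r.
rewrite pxE hyE scalerA /rank1 -mulmxA mul_scalar_mx scalerA.
rewrite (_ : b * _ = 1) ?scale1r.
  by apply/matrixP=> i j; rewrite !mxE !big_ord1 !mxE sM.
have ua := divR' a0; have ub := divR' b0.
by rewrite invrM // !mulrA mulrV // mul1r mulVr.
Qed.

End Collineation.

Section MapMx.
Variables (R R' : nzRingType) (s : R -> R').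
Hypothesis s0 : s 0 = 0.
Hypothesis s1 : s 1 = 1.
Hypothesis sD : {morph s : a b / a + b}.
Hypothesis sM : {morph s : a b / a * b}.
Variable n : nat.

Lemma map_mx_add (A B : 'M[R]_n) : map_mx s (A + B) = map_mx s A + map_mx s B.
Proof. by apply/matrixP=> i j; rewrite !mxE sD. Qed.

Lemma map_mx_mul (A B : 'M[R]_n) : map_mx s (A *m B) = map_mx s A *m map_mx s B.
Proof.
apply/matrixP=> i j; rewrite !mxE (big_morph s sD s0).
by apply: eq_bigr => l _; rewrite !mxE sM.
Qed.

Lemma map_mx_bij : bijective s -> bijective (fun A : 'M[R]_n => map_mx s A).
Proof.
move=> [s' sK s'K]; exists (fun A : 'M[R']_n => map_mx s' A) => A; apply/matrixP=> i j.
  by rewrite !mxE sK.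
by rewrite !mxE s'K.
Qed.

End MapMx.

Lemma proj_sum (R : nzRingType) n (E : glmx R n) (I : {set 'I_n}) :
  proj E I = \sum_(l in I) proj E [set l].
Proof.
have H J : proj E J = \sum_(l in J) proj E [set l].
  rewrite /proj /conj_mx -mulmx_suml -mulmx_sumr; congr (_ *m _ *m _).
  apply/matrixP=> i j; rewrite summxE set_mxE.
  have [iJ|iJ] := boolP (i \in J); last first.
    rewrite andbF big1 // => l lJ; rewrite set_mxE inE.
    by case: (i =P l) => [il|]; rewrite ?andbF //; rewrite il lJ in iJ.
  rewrite (bigD1 i) //= big1 ?addr0 => [|l /andP[_ li]]; first by rewrite set_mxE inE eqxx.
  by rewrite set_mxE inE [i == l]eq_sym (negPf li) andbF.
exact: H.
Qed.

Lemma conj_mx_bij (R : nzRingType) n (E : glmx R n) : bijective (conj_mx E).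
Proof. by exists (conj_mx (glI E)) => A; [exact: conj_mxI|exact: conj_mxIV]. Qed.

Definition mx_ring_auto (R : nzRingType) n (theta : 'M[R]_n -> 'M[R]_n) :=
  [/\ {morph theta : A B / A + B}, bijective theta &
      (forall A B, theta (A *m B) = theta A *m theta B) \/
      (forall A B, theta (A *m B) = theta B *m theta A)].

(** * Extension to ring automorphisms and anti-automorphisms *)

Section Transpose.
Variable R : unitRingType.
Variable n : nat.

Lemma trmx_mulc (A B : 'M[R^c]_n) : ((A *m B)^T : 'M[R]_n) = (B^T : 'M[R]_n) *m (A^T : 'M[R]_n).
Proof.
apply: (@trmx_inj R n n); by rewrite [RHS]trmx_mul_rev !trmxK.
Qed.

Lemma trmx_mulr (A B : 'M[R]_n) : (A *m B)^T = (B^T : 'M[R^c]_n) *m (A^T : 'M[R^c]_n) :> 'M[R^c]_n.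
Proof. exact: (@trmx_mul_rev R n n n A B). Qed.

Fact gl_tr_subproof (A B : 'M[R]_n) : A *m B = 1%:M ->
  (B^T : 'M[R^c]_n) *m (A^T : 'M[R^c]_n) = 1%:M.
Proof. by move=> AB; rewrite -trmx_mulr AB; exact: (@trmx1 R n). Qed.

Definition gl_tr (E : glmx R n) : glmx R^c n :=
  Glmx (gl_tr_subproof (glmxV E)) (gl_tr_subproof (glVmx E)).

Lemma rank1_tr (x : 'rV[R]_n) (y : 'cV[R]_n) :
  (rank1 x y)^T = @rank1 R^c n (y^T) (x^T).
Proof. exact: (@trmx_mul_rev R n 1 n y x). Qed.

Lemma pairing_tr (x : 'rV[R]_n) (y : 'cV[R]_n) : @pairing R^c n (y^T) (x^T) = pairing x y.
Proof.
rewrite /pairing; have := @trmx_mul_rev R 1 n 1 x y => /matrixP/(_ 0 0).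
by rewrite mxE => ->.
Qed.

Hypothesis divR : forall x : R, x != 0 -> x \is a GRing.unit.

Lemma div_conv (x : R^c) : x != 0 -> x \is a GRing.unit.
Proof. exact: divR. Qed.

Lemma idem_rank1_tr (r : 'M[R]_n) : @idem_rank R^c n 1 r^T <-> idem_rank 1 r.
Proof.
split.
  move=> /(idem_rank1P div_conv)[x [y [xy rE]]]; apply/(idem_rank1P divR).
  exists (y^T : 'rV[R]_n), (x^T : 'cV[R]_n); split.
    by rewrite -pairing_tr !trmxK.
  by apply: (@trmx_inj R n n); rewrite rank1_tr !trmxK.
move=> /(idem_rank1P divR)[x [y [xy ->]]]; apply/(idem_rank1P div_conv).
by exists y^T, x^T; rewrite pairing_tr rank1_tr.
Qed.

End Transpose.

Section Extension.
Variable R : unitRingType.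
Hypothesis divR : forall x : R, x != 0 -> x \is a GRing.unit.
Variable n : nat.
Hypothesis n3 : (3 <= n)%N.

Implicit Types (r s : 'M[R]_n) (phi psi : 'M[R]_n -> 'M[R]_n).

(** Frames control only pairs with both products zero. Keeping the point of [r] and moving its
    hyperplane through the point of [s] makes one-sided orthogonality two-sided. *)
Lemma orth_partner r s : idem_rank 1 r -> idem_rank 1 s -> r *m s = 0 ->
  exists r1 : 'M[R]_n, [/\ idem_rank 1 r1, samept r r1, r1 *m s = 0 & s *m r1 = 0].
Proof.
move=> /(idem_rank1P divR)[x [y [xy ->]]] /(idem_rank1P divR)[x' [y' [xy' ->]]].
move=> /(rank1_mul0 _ _ xy xy') H.
pose y1 := y - y' *m (pairing x' y)%:M.
have xy1 : pairing x y1 = 1.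
  by rewrite /pairing mulmxBr mxB -!/(pairing _ _) pairingZr H mul0r subr0.
have x'y1 : pairing x' y1 = 0.
  by rewrite /pairing mulmxBr mxB -!/(pairing _ _) pairingZr xy' mul1r subrr.
exists (rank1 x y1); split; first exact: rank1_idem_rank.
- by apply/(samept_rank1 xy xy1); exists 1; rewrite scale1r.
- by rewrite rank1M H scale0r mulmx0.
by rewrite rank1M x'y1 scale0r mulmx0.
Qed.

Lemma straight_mul0 phi psi r s : frame_bij phi psi ->
  (forall r, idem_rank 1 r -> straight phi r) -> idem_rank 1 r -> idem_rank 1 s ->
  r *m s = 0 -> phi r *m phi s = 0.
Proof.
move=> [F _ _] St rr rs /(orth_partner rr rs)[r1 [rr1 rp o1 o2]].
by have [/(_ _ rr1 rp) <- _] := St _ rr; rewrite -mulmxA (frame_map_orth divR F rr1 rs o1 o2) mulmx0.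
Qed.

Lemma crossed_mul0 phi psi r s : frame_bij phi psi ->
  (forall r, idem_rank 1 r -> crossed phi r) -> idem_rank 1 r -> idem_rank 1 s ->
  r *m s = 0 -> phi s *m phi r = 0.
Proof.
move=> [F _ _] Cr rr rs /(orth_partner rr rs)[r1 [rr1 rp o1 o2]].
have [/(_ _ rr1 rp) H _] := Cr _ rr; have rk := frame_map_rank F.
rewrite -(samehyp_sym divR (rk _ rr) (rk _ rr1) H) mulmxA.
by rewrite (frame_map_orth divR F rs rr1 o2 o1) mul0mx.
Qed.

(** Incidence has to be reflected, not only preserved, so the type of the inverse matters. If the
    types differed, two distinct idempotents with a common point would also share their
    hyperplane. *)
Lemma inverse_type phi psi : frame_bij phi psi ->
  ((forall r, idem_rank 1 r -> straight phi r) -> forall r, idem_rank 1 r -> straight psi r) /\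
  ((forall r, idem_rank 1 r -> crossed phi r) -> forall r, idem_rank 1 r -> crossed psi r).
Proof.
move=> pp; have [F G C] := pp.
have r0 := proj_rank1 (gl1 R n) (Ordinal (ltnW (ltnW n3))).
have [s [rs rNs rsp]] := ex_samept divR n3 r0; have rk := frame_map_rank F.
have [Er _] := C _ r0; have [Es _] := C _ rs.
have [S|Cr] := all_straight_or_crossed divR n3 (frame_bij_sym pp); split=> //.
  move=> Cr; have [/(_ _ rs rsp) H _] := Cr _ r0; have [_ /(_ _ (rk _ rs) H)] := S _ (rk _ r0).
  by rewrite Er Es => /(samept_samehyp rsp).
move=> S; have [/(_ _ rs rsp) H _] := S _ r0; have [/(_ _ (rk _ rs) H) + _] := Cr _ (rk _ r0).
by rewrite Er Es => /(samept_samehyp rsp).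
Qed.

Lemma frame_bij_semilinear phi psi : frame_bij phi psi ->
  exists2 theta : 'M[R]_n -> 'M[R]_n, mx_ring_auto theta &
    forall r, idem_rank 1 r -> phi r = theta r.
Proof.
move=> pp; have [F G C] := pp; have rk := frame_map_rank F.
have surj r' : idem_rank 1 r' -> exists2 r, idem_rank 1 r & phi r = r'.
  move=> rr; exists (psi r'); first exact: frame_map_rank.
  by have [] := C _ rr.
have [T1 T2] := inverse_type pp.
have [E FE] := F (gl1 R n).
have [St|Cr] := all_straight_or_crossed divR n3 pp.
  have Stp := T1 St.
  have pt r s : idem_rank 1 r -> idem_rank 1 s -> samept r s -> samept (phi r) (phi s).
    by move=> rr rs; case: (St _ rr) => + _; apply.
  have hyp r s : idem_rank 1 r -> idem_rank 1 s -> samehyp r s -> samehyp (phi r) (phi s).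
    by move=> rr rs; case: (St _ rr) => _; apply.
  have inc r s : idem_rank 1 r -> idem_rank 1 s -> r *m s = 0 <-> phi r *m phi s = 0.
    move=> rr rs; split; first exact: (straight_mul0 pp St).
    move=> /(straight_mul0 (frame_bij_sym pp) Stp (rk _ rr) (rk _ rs)).
    by have [-> _] := C _ rr; have [-> _] := C _ rs.
  have fr l : phi (set_mx R [set l]) = proj E [set l].
    by rewrite -(maps_frame1 l FE) proj_gl1.
  have [s [D [[s0 s1 sD sM] sbij sE]]] := collineation_semilinear divR divR n3 rk pt hyp inc fr surj.
  exists (fun A => conj_mx D (map_mx s A)) => //; split.
  - by move=> A B; rewrite map_mx_add ?conj_mxD.
  - exact: (bij_comp (conj_mx_bij D) (map_mx_bij n sbij)).
  by left=> A B; rewrite map_mx_mul ?conj_mxM.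
have Crp := T2 Cr.
(* Transposition into matrices over [R^c] reverses products and so exchanges points with
   hyperplanes: the crossed map becomes a straight one. *)
pose phi' : 'M[R]_n -> 'M[R^c]_n := fun A => (phi A)^T.
have rk' r : idem_rank 1 r -> idem_rank 1 (phi' r) by move=> /rk rr; apply/(idem_rank1_tr divR).
have pt r s : idem_rank 1 r -> idem_rank 1 s -> samept r s -> samept (phi' r) (phi' s).
  move=> rr rs rel; have [/(_ _ rs rel) H _] := Cr _ rr.
  have {}H : phi s *m phi r = phi r := samehyp_sym divR (rk _ rr) (rk _ rs) H.
  by rewrite /samept /phi' -trmx_mulr H.
have hyp r s : idem_rank 1 r -> idem_rank 1 s -> samehyp r s -> samehyp (phi' r) (phi' s).
  move=> rr rs rel; have [_ /(_ _ rs rel) H] := Cr _ rr.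
  have {}H : phi s *m phi r = phi s := samept_sym divR (rk _ rr) (rk _ rs) H.
  by rewrite /samehyp /phi' -trmx_mulr H.
have inc r s : idem_rank 1 r -> idem_rank 1 s -> r *m s = 0 <-> phi' r *m phi' s = 0.
  move=> rr rs; rewrite /phi' -trmx_mulr; split.
    by move=> /(crossed_mul0 pp Cr rr rs) ->; rewrite trmx0.
  move=> /(congr1 trmx); rewrite trmxK trmx0 => /(crossed_mul0 (frame_bij_sym pp) Crp (rk _ rs) (rk _ rr)).
  by have [-> _] := C _ rr; have [-> _] := C _ rs.
have fr l : phi' (set_mx R [set l]) = proj (gl_tr E) [set l].
  rewrite /phi' -proj_gl1 (maps_frame1 l FE) !proj_set1E trmx_mulr trmx_mulr mulmxA.
  by rewrite trmx_delta.
have surj' (r' : 'M[R^c]_n) : idem_rank 1 r' -> exists2 r, idem_rank 1 r & phi' r = r'.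
  move=> rr; have [|r rrk E1] := surj r'^T; last by exists r; rewrite // /phi' E1 trmxK.
  by apply/(idem_rank1_tr divR); have -> : (r'^T)^T = r' := trmxK r'; exact: rr.
have [s [D [[s0 s1 sD sM] sbij sE]]] :=
  collineation_semilinear divR (div_conv divR) n3 rk' pt hyp inc fr surj'.
exists (fun A => (conj_mx D (map_mx s A))^T); last first.
  by move=> r rr; rewrite -sE // /phi' trmxK.
split.
- by move=> A B; rewrite (map_mx_add sD) conj_mxD linearD.
- apply: (@bij_comp _ _ _ (fun A : 'M[R^c]_n => A^T : 'M[R]_n)); last first.
    exact: (bij_comp (conj_mx_bij D) (map_mx_bij n sbij)).
  by exists (fun A : 'M[R]_n => A^T : 'M[R^c]_n) => A; exact: trmxK.
by right=> A B; rewrite (map_mx_mul s0 sD sM) conj_mxM trmx_mulc.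
Qed.

End Extension.

(** * From rank 1 back to rank k *)

Section KIdempotents.
Variable R : unitRingType.
Hypothesis divR : forall x : R, x != 0 -> x \is a GRing.unit.
Hypothesis nz2 : 2%:R != 0 :> R.
Variables (n k : nat).
Hypothesis (n3 : (3 <= n)%N) (k_gt0 : (0 < k)%N).

(** [phi] follows [f] on frames, and a projection of rank [k] is the sum of [k] members of a frame,
    so additivity of [theta] carries the agreement from rank 1 to rank [k]. *)
Lemma comm_bij_extends_small (f g : 'M[R]_n -> 'M[R]_n) : (2 * k < n)%N -> comm_bij k f g ->
  exists2 theta : 'M[R]_n -> 'M[R]_n, mx_ring_auto theta &
    forall A, idem_rank k A -> f A = theta A.
Proof.
case: n n3 f g => // m m3 f g kn fg.
have [phi phiP] := rank1_map divR nz2 (n := m) k_gt0 kn fg.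
have [psi psiP] := rank1_map divR nz2 (n := m) k_gt0 kn (comm_bij_sym fg).
have single h E E' : (forall l, h (proj E [set l]) = proj E' [set l]) -> maps_frame 1 h E E'.
  by move=> H I /eqP/cards1P[l ->]; exact: H.
have ex E := maps_frame_ex divR k_gt0 kn fg nz2 E.
have ex' E := maps_frame_ex divR k_gt0 kn (comm_bij_sym fg) nz2 E.
have pp : frame_bij phi psi.
  split.
  - by move=> E; have [E' H] := ex E; exists E'; apply: single; exact: phiP.
  - by move=> E; have [E' H] := ex' E; exists E'; apply: single; exact: psiP.
  move=> r [E [I [/eqP/cards1P[l ->] ->]]]; split.
    have [E' H] := ex E; rewrite (phiP _ _ H).
    exact: psiP (maps_frame_sym fg H) l.
  have [E' H] := ex' E; rewrite (psiP _ _ H).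
  exact: phiP (maps_frame_sym (comm_bij_sym fg) H) l.
have [theta thA thE] := frame_bij_semilinear divR m3 pp.
exists theta => // A [E [I [Ik ->]]]; have [E' H] := ex E.
have [thD _ _] := thA.
have th0 : theta 0 = 0 by apply: (addrI (theta 0)); rewrite -thD !addr0.
rewrite H // proj_sum [in RHS]proj_sum (big_morph theta thD th0).
by apply: eq_bigr => l _; rewrite -thE ?(phiP _ _ H) //; exact: proj_rank1.
Qed.

End KIdempotents.

Section MxRingAuto.
Variables (R : nzRingType) (n : nat) (theta : 'M[R]_n -> 'M[R]_n).
Hypothesis th : mx_ring_auto theta.

(** [theta 1%:M] is neutral on the image of [theta], which is everything. *)
Lemma mx_ring_auto1 : theta 1%:M = 1%:M.
Proof.
have [_ [theta' thK thK'] [thM|thM]] := th.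
  by rewrite -[LHS]mulmx1 -{2}[1%:M]thK' -thM mul1mx thK'.
by rewrite -[LHS]mul1mx -{1}[1%:M]thK' -thM mul1mx thK'.
Qed.

Lemma mx_ring_autoB : {morph theta : A B / A - B}.
Proof.
have [thD _ _] := th; move=> A B; apply: (addIr (theta B)).
by rewrite -thD !subrK.
Qed.

Lemma mx_ring_auto_inv theta' : cancel theta theta' -> cancel theta' theta -> mx_ring_auto theta'.
Proof.
have [thD _ thM] := th; move=> thK thK'; split.
- by move=> A B; apply: (can_inj thK); rewrite thD !thK'.
- by exists theta.
case: thM => thM; [left|right] => A B; by rewrite -{1}(thK' A) -{1}(thK' B) -thM thK.
Qed.

End MxRingAuto.

Section Complement.
Variable R : unitRingType.
Hypothesis divR : forall x : R, x != 0 -> x \is a GRing.unit.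
Variable n : nat.

Lemma idem_rank_compl k (A : 'M[R]_n) : (k <= n)%N -> idem_rank (n - k) (1%:M - A) <-> idem_rank k A.
Proof.
have H m B : idem_rank m B -> idem_rank (n - m) (1%:M - B : 'M[R]_n).
  move=> [E [I [Im ->]]]; exists E, (~: I); split; last by rewrite projC.
  by have := cardsC I; rewrite card_ord Im; lia.
by move=> kn; split=> /H; rewrite ?subKr ?subKn // opprB addrC subrK.
Qed.

Lemma comm_bij_compl k (f g : 'M[R]_n -> 'M[R]_n) : (k <= n)%N -> comm_bij k f g ->
  comm_bij (n - k) (fun A => 1%:M - f (1%:M - A)) (fun A => 1%:M - g (1%:M - A)).
Proof.
have c2 (A : 'M[R]_n) : 1%:M - (1%:M - A) = A by rewrite opprB addrC subrK.
move=> kn [F G C].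
have rk (A : 'M[R]_n) : idem_rank (n - k) A -> idem_rank k (1%:M - A).
  by move=> rA; have := (@idem_rank_compl k (1%:M - A) kn).1; rewrite c2; apply.
have cc (A B : 'M[R]_n) : (1%:M - A) *m (1%:M - B) = (1%:M - B) *m (1%:M - A) <-> A *m B = B *m A.
  have E (X Y : 'M[R]_n) : (1%:M - X) *m (1%:M - Y) = 1%:M - (X + Y) + X *m Y.
    rewrite mulmxBl mul1mx mulmxBr mulmx1 opprB [X *m Y - X]addrC addrA.
    by rewrite [X + Y]addrC opprD addrA.
  by rewrite !E [B + A]addrC; split=> [/addrI|->].
split=> [A /rk rA|A /rk rA|A B /rk rA /rk rB].
- by have [rf gf] := F _ rA; rewrite c2 gf c2; split=> //; apply: (idem_rank_compl _ kn).2.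
- by have [rf gf] := G _ rA; rewrite c2 gf c2; split=> //; apply: (idem_rank_compl _ kn).2.
split=> [/cc/(C _ _ rA rB)/cc//|/cc/(C _ _ rA rB)/cc//].
Qed.

Hypothesis nz2 : 2%:R != 0 :> R.
Hypothesis n3 : (3 <= n)%N.

(** If 2k > n, the complements have rank n - k with 2(n - k) < n. As [theta] is additive and fixes
    1, it commutes with passing to the complement. *)
Lemma comm_bij_extends k (f g : 'M[R]_n -> 'M[R]_n) : (0 < k < n)%N -> n <> (2 * k)%N ->
  comm_bij k f g ->
  exists2 theta : 'M[R]_n -> 'M[R]_n, mx_ring_auto theta &
    forall A, idem_rank k A -> f A = theta A.
Proof.
move=> /andP[k0 kn] n2k fg; have [small|large] := ltnP (2 * k) n.
  exact: (comm_bij_extends_small divR nz2 n3 k0 small fg).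
have nk0 : (0 < n - k)%N by lia.
have small : (2 * (n - k) < n)%N by lia.
have [theta thA thE] := comm_bij_extends_small divR nz2 n3 nk0 small (comm_bij_compl (ltnW kn) fg).
exists theta => // A rA; have rA' := (idem_rank_compl A (ltnW kn)).2 rA.
have := thE _ rA'; rewrite (mx_ring_autoB thA) (mx_ring_auto1 thA).
have -> : 1%:M - (1%:M - A) = A by rewrite opprB addrC subrK.
by move=> /subrI.
Qed.

End Complement.

(** * Linear automorphisms and involutions *)

Section GLMatrix.
Variables (R : unitRingType) (V : vectType R).
Implicit Types (u v : GL V).
Local Notation N := (dim V).

Definition GL_mx u : 'M[R]_N := f2mx (GL_val u).

Lemma v2r_lfun (f : 'End(V)) x : v2r (f x) = v2r x *m f2mx f.
Proof. by rewrite unlock /= r2vK. Qed.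

Lemma GL_mxE u x : v2r (u x) = v2r x *m GL_mx u.
Proof. exact: v2r_lfun. Qed.

Lemma mulmx_inj (A B : 'M[R]_N) : (forall x : 'rV_N, x *m A = x *m B) -> A = B.
Proof. by move=> H; apply/row_matrixP=> i; rewrite !rowE. Qed.

(** Row vectors reverse the order of composition; the reversal occurs before and after [theta], so a
    multiplicative [theta] still induces a morphism. *)
Lemma GL_mxM u v : GL_mx (u * v)%g = GL_mx v *m GL_mx u.
Proof.
apply: mulmx_inj => x; rewrite -[x]r2vK mulmxA -!GL_mxE; congr v2r.
by rewrite /= comp_lfunE.
Qed.

Lemma GL_mx1 : GL_mx 1%g = 1%:M.
Proof.
by apply: mulmx_inj => x; rewrite -[x]r2vK mulmx1 -GL_mxE /= id_lfunE.
Qed.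

Lemma GL_mx_inj : injective GL_mx.
Proof.
move=> u v uv; apply/val_inj/lfunP => x; apply: v2r_inj.
by rewrite !v2r_lfun -!/(GL_mx _) uv.
Qed.

Lemma GL_mx_surj (A : glmx R N) : exists u, GL_mx u = A.
Proof.
pose f (M : 'M[R]_N) : 'End(V) := Hom M.
have fM (M M' : 'M[R]_N) x : f M (f M' x) = f (M' *m M) x.
  by apply: v2r_inj; rewrite !v2r_lfun /= mulmxA.
have f1 x : f 1%:M x = x by apply: v2r_inj; rewrite v2r_lfun /= mulmx1.
have bij : `[< bijective (f A) >].
  apply/asboolP; exists (f (glmx_inv A)) => x.
    by rewrite fM glmxV f1.
  by rewrite fM glVmx f1.
by exists (MkGL bij).
Qed.

Lemma GL_mx_gl u : exists A : glmx R N, GL_mx u = A.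
Proof.
have H1 : GL_mx u *m GL_mx u^-1%g = 1%:M by rewrite -GL_mxM mulVg GL_mx1.
have H2 : GL_mx u^-1%g *m GL_mx u = 1%:M by rewrite -GL_mxM mulgV GL_mx1.
by exists (Glmx H1 H2).
Qed.

Hypothesis divR : forall x : R, x != 0 -> x \is a GRing.unit.

(** The coordinates of each family in the other form matrices [A] and [B]; freeness of [e] gives
    [A *m B = 1%:M], and [mulmx1_leq] bounds the sizes. *)
Lemma has_dim_leq (S : set V) k l : has_dim S k -> has_dim S l -> (k <= l)%N.
Proof.
move=> [e [e_free eS]] [e' [_ e'S]].
have H i : exists c : 'rV[R]_l, lincomb e' c = e i.
  have : S (e i).
    rewrite -eS; exists (delta_mx 0 i) => //; rewrite /lincomb (bigD1 i) //= big1 ?addr0 => [|j ji].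
      by rewrite mxE !eqxx scale1r.
    by rewrite mxE (negPf ji) andbF scale0r.
  by rewrite -e'S => -[c _ cE]; exists c.
have H' j : exists c : 'rV[R]_k, lincomb e c = e' j.
  have : S (e' j).
    rewrite -e'S; exists (delta_mx 0 j) => //; rewrite /lincomb (bigD1 j) //= big1 ?addr0 => [|i ij].
      by rewrite mxE !eqxx scale1r.
    by rewrite mxE (negPf ij) andbF scale0r.
  by rewrite -eS => -[c _ cE]; exists c.
have [c cE] := choice H; have [c' c'E] := choice H'.
pose A := \matrix_(i, j) c i 0 j; pose B := \matrix_(j, i) c' j 0 i.
apply: (@mulmx1_leq _ divR _ _ A B); apply/row_matrixP=> i.
rewrite -[LHS](subrK (row i 1%:M)) -[RHS]add0r; congr (_ + _); apply: e_free.
rewrite /lincomb; under eq_bigr => j _ do rewrite mxB scalerBl.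
rewrite sumrB; apply/eqP; rewrite subr_eq0; apply/eqP.
rewrite [RHS](bigD1 i) //= [X in _ + X]big1 ?addr0 => [|j ji]; last first.
  by rewrite !mxE eq_sym (negPf ji) scale0r.
rewrite !mxE eqxx scale1r -cE /lincomb.
transitivity (\sum_j \sum_m (c i 0 m * c' m 0 j) *: e j).
  apply: eq_bigr => j _; rewrite !mxE scaler_suml; apply: eq_bigr => m _.
  by rewrite !mxE.
rewrite exchange_big; apply: eq_bigr => m _; rewrite -c'E /lincomb scaler_sumr.
by apply: eq_bigr => j _; rewrite scalerA.
Qed.

Lemma has_dim_uniq (S : set V) k l : has_dim S k -> has_dim S l -> k = l.
Proof. by move=> Sk Sl; apply/eqP; rewrite eqn_leq !(has_dim_leq Sk Sl, has_dim_leq Sl Sk). Qed.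

Lemma has_dim_proj (E : glmx R N) (I : {set 'I_N}) :
  has_dim [set x : V | v2r x *m proj E I = v2r x]%classic #|I|.
Proof.
(* The rows of [E] in [I] are the basis, and the columns of [M'] are the dual coordinates. *)
pose M : 'M[R]_(#|I|, N) := \matrix_(j, b) E (enum_val j) b.
pose M' : 'M[R]_(N, #|I|) := \matrix_(a, j) glmx_inv E a (enum_val j).
have MM' : M *m M' = 1%:M.
  apply/matrixP=> i j; rewrite [RHS]mxE -(inj_eq enum_val_inj).
  have <- : (E *m glmx_inv E) (enum_val i) (enum_val j) = (enum_val i == enum_val j)%:R.
    by rewrite glmxV mxE.
  by rewrite !mxE; apply: eq_bigr => l _; rewrite !mxE.
have M'M : M' *m M = proj E I.
  rewrite proj_sum; apply/matrixP=> a b; rewrite [LHS]mxE summxE [RHS]big_enum_val.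
  apply: eq_bigr => j _; rewrite proj_set1E !mxE (bigD1 (enum_val j)) //=.
  rewrite big1 ?addr0 => [|l lj].
    rewrite mxE (bigD1 (enum_val j)) //= big1 ?addr0 => [|l lj]; first by rewrite !mxE !eqxx mulr1.
    by rewrite !mxE (negPf lj) mulr0.
  rewrite mxE big1 ?mul0r // => m _; by rewrite mxE (negPf lj) andbF mulr0.
pose e (j : 'I_#|I|) := r2v (row j M).
have eE c : lincomb e c = r2v (c *m M).
  rewrite /lincomb mulmx_sum_row linear_sum; apply: eq_bigr => j _.
  by rewrite linearZ.
exists e; split=> [c|].
  rewrite eE => /(congr1 v2r); rewrite r2vK linear0 => /(congr1 (mulmx ^~ M')).
  by rewrite /= -mulmxA MM' mulmx1 mul0mx.
apply/seteqP; split=> [_ [c _ <-]|x /= xE].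
  by rewrite /= eE r2vK -M'M mulmxA -[c *m M *m M']mulmxA MM' mulmx1.
exists (v2r x *m M') => //; rewrite eE -mulmxA M'M xE.
exact: v2rK.
Qed.

Hypothesis nz2 : 2%:R != 0 :> R.

Lemma mulr2n_inj m p : injective (fun A : 'M[R]_(m, p) => A *+ 2).
Proof.
move=> A B /matrixP AB; apply/matrixP=> i j; apply: (mulrI (divR nz2)).
by have := AB i j; rewrite !mxE ![2%:R * _]mulr_natl.
Qed.

Lemma double_subr1_comm m (A B : 'M[R]_m) :
  (A *+ 2 - 1%:M) *m (B *+ 2 - 1%:M) = (B *+ 2 - 1%:M) *m (A *+ 2 - 1%:M) <-> A *m B = B *m A.
Proof.
have E (X Y : 'M[R]_m) :
    (X *+ 2 - 1%:M) *m (Y *+ 2 - 1%:M) = (X *m Y) *+ 2 *+ 2 + (1%:M - (X + Y) *+ 2).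
  have -> : (X *m Y) *+ 2 *+ 2 = (X *+ 2) *m (Y *+ 2).
    by rewrite !mulr2n !(mulmxDl, mulmxDr).
  rewrite mulmxBl mul1mx mulmxBr mulmx1 opprB -addrA; congr (_ + _).
  by rewrite addrCA mulrnDl [in RHS]opprD.
split=> [|AB]; last by rewrite !E AB [A + B]addrC.
by rewrite !E [A + B]addrC => /addIr /mulr2n_inj /mulr2n_inj.
Qed.

(** 2 is a sum of ones, hence central, and so is its inverse; this lets the factor 1/2 pass through
    products of matrices. *)
Lemma half_comm (x : R) : x * 2%:R^-1 = 2%:R^-1 * x.
Proof.
apply: (mulrI (divR nz2)); rewrite !mulrA mulrV ?divR // mul1r.
by rewrite mulr_natl -mulr_natr -mulrA mulrV ?divR // mulr1.
Qed.

Lemma half_double m p (A : 'M[R]_(m, p)) : (2%:R^-1 *: A) *+ 2 = A.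
Proof.
by rewrite scalerMnl -[_^-1 *+ 2]mulr_natl mulrV ?divR // scale1r.
Qed.

Lemma half_idem m (A : 'M[R]_m) : A *m A = 1%:M ->
  (2%:R^-1 *: (A + 1%:M)) *m (2%:R^-1 *: (A + 1%:M)) = 2%:R^-1 *: (A + 1%:M).
Proof.
move=> AA; have scaleAr (X Y : 'M[R]_m) : X *m (2%:R^-1 *: Y) = 2%:R^-1 *: (X *m Y).
  apply/matrixP=> i j; rewrite !mxE mulr_sumr; apply: eq_bigr => l _.
  by rewrite !mxE !mulrA half_comm.
rewrite -scalemxAl scaleAr mulmxDl !mulmxDr AA !mulmx1 mul1mx [1%:M + A]addrC -mulr2n.
by rewrite -scalerMnr half_double.
Qed.

Lemma S_plusE u E I : GL_mx u = proj E I *+ 2 - 1%:M ->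
  S_plus u = [set x : V | v2r x *m proj E I = v2r x]%classic.
Proof.
move=> uE; have E2 x : v2r (u x) = (v2r x *m proj E I) *+ 2 - v2r x.
  by rewrite GL_mxE uE mulmxBr mulmx1 !mulr2n mulmxDr.
apply/seteqP; split=> x /=.
  move=> /(congr1 v2r); rewrite E2 => /eqP; rewrite subr_eq -mulr2n => /eqP.
  exact: mulr2n_inj.
by move=> xE; apply: v2r_inj; rewrite E2 xE mulr2n addrK.
Qed.

Lemma S_minusE u E I : GL_mx u = proj E I *+ 2 - 1%:M ->
  S_minus u = [set x : V | v2r x *m proj E (~: I) = v2r x]%classic.
Proof.
move=> uE; have E2 x : v2r (u x) = (v2r x *m proj E I) *+ 2 - v2r x.
  by rewrite GL_mxE uE mulmxBr mulmx1 !mulr2n mulmxDr.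
apply/seteqP; split=> x /=; rewrite projC mulmxBr mulmx1.
  move=> /(congr1 v2r); rewrite E2 linearN => /eqP; rewrite subr_eq addNr => /eqP.
  by rewrite -[0](mul0rn _ 2) => /mulr2n_inj ->; rewrite subr0.
move=> /eqP; rewrite subr_eq -subr_eq0 opprD addrA subrr sub0r oppr_eq0 => /eqP xE.
by apply: v2r_inj; rewrite E2 xE mul0rn sub0r linearN.
Qed.

Lemma involutionsP k u : (k <= N)%N ->
  involutions V k u <-> exists2 A, idem_rank k A & GL_mx u = A *+ 2 - 1%:M.
Proof.
move=> kN; split=> [[uu plus _]|[A [E [I [Ik AE]]] uE]].
  have UU : GL_mx u *m GL_mx u = 1%:M by rewrite -GL_mxM uu GL_mx1.
  have [m [E [I [Im AE]]]] := idem_rank_ex divR (half_idem UU).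
  have uE : GL_mx u = proj E I *+ 2 - 1%:M by rewrite -AE half_double addrK.
  exists (proj E I) => //; exists E, I; split=> //.
  by apply: has_dim_uniq (has_dim_proj E I) _; rewrite -(S_plusE uE).
rewrite AE in uE; split.
- apply: GL_mx_inj; rewrite GL_mxM GL_mx1 uE mulmxBl mul1mx mulmxBr mulmx1 !mulr2n.
  by rewrite mulmxDl mulmxDr proj_idem addrK opprD opprK addrA subrr add0r.
- by rewrite (S_plusE uE) -Ik; exact: has_dim_proj.
rewrite (S_minusE uE); have -> : (N - k = #|~: I|)%N by have := cardsC I; rewrite card_ord Ik; lia.
exact: has_dim_proj.
Qed.

Lemma mx_auto_GL theta : mx_ring_auto theta -> exists2 g : GL V -> GL V, bijective g &
  forall u, GL_mx (g u) = theta (GL_mx u).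
Proof.
move=> thA.
have ex theta' : mx_ring_auto theta' -> exists g : GL V -> GL V, forall u, GL_mx (g u) = theta' (GL_mx u).
  move=> thA'; suff /choice[g gP] : forall u, exists v, GL_mx v = theta' (GL_mx u) by exists g.
  move=> u; have [A ->] := GL_mx_gl u; have th1 := mx_ring_auto1 thA'.
  have [B ->] : exists B : glmx R N, theta' A = B.
    have [_ _ [thM|thM]] := thA'.
      have H1 : theta' A *m theta' (glmx_inv A) = 1%:M by rewrite -thM glmxV.
      have H2 : theta' (glmx_inv A) *m theta' A = 1%:M by rewrite -thM glVmx.
      by exists (Glmx H1 H2).
    have H1 : theta' A *m theta' (glmx_inv A) = 1%:M by rewrite -thM glVmx.
    have H2 : theta' (glmx_inv A) *m theta' A = 1%:M by rewrite -thM glmxV.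
    by exists (Glmx H1 H2).
  exact: GL_mx_surj.
have [_ [theta' thK thK'] _] := thA.
have [g gP] := ex _ thA; have [g' gP'] := ex _ (mx_ring_auto_inv thA thK thK').
exists g => //; exists g' => u; apply: GL_mx_inj.
  by rewrite gP' gP thK.
by rewrite gP gP' thK'.
Qed.

(** If [theta] reverses products, composing with inversion restores the order; an involution is its
    own inverse, so the values on involutions stay the same. *)
Lemma mx_auto_automorphism theta : mx_ring_auto theta -> exists2 g : GL V -> GL V,
  is_automorphism g & forall u, (u * u = 1)%g -> GL_mx (g u) = theta (GL_mx u).
Proof.
move=> thA; have [g g_bij gP] := mx_auto_GL thA; have [_ _ [thM|thM]] := thA.
  exists g => //; split=> // u v; apply: GL_mx_inj.
  by rewrite gP !GL_mxM thM !gP.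
exists (fun u => g u^-1%g) => [|u uu]; last by rewrite (mulg1_eq uu) gP.
split=> [u v|]; last by apply: bij_comp g_bij _; exact: inv_bij invgK.
by apply: GL_mx_inj; rewrite gP invgM !GL_mxM thM !gP.
Qed.

End GLMatrix.

Theorem corollary1 (R : unitRingType)
    (divR : forall x : R, x != 0 -> x \is a GRing.unit)
    (charR : 2%N \notin [pchar R])
    (V : vectType R) (n k : nat) (dimV : dim V = n)
    (n_ge3 : (3 <= n)%N) (k_ge1 : (1 <= k)%N) (k_le : (k <= n - 1)%N)
    (n_neq2k : n <> (2 * k)%N)
    (f : involutions V k -> involutions V k)
    (f_bij : bijective f) (f_comm : commutativity_preserving f) :
  exists g : GL V -> GL V,
    is_automorphism g /\ forall u : involutions V k, g (val u) = val (f u).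
Proof.
have nz2 : 2%:R != 0 :> R by move: charR; rewrite inE.
subst n; have kN : (0 < k < dim V)%N by lia.
have kN' : (k <= dim V)%N by lia.
have inP (w : involutions V k) : involutions V k (val w) by exact: set_mem (valP w).
have ex (w : involutions V k) : exists2 A, idem_rank k A & GL_mx (val w) = A *+ 2 - 1%:M.
  exact: (involutionsP divR nz2 _ kN').1 (inP w).
have of_idem A : idem_rank k A -> exists w : involutions V k, GL_mx (val w) = A *+ 2 - 1%:M.
  move=> rA; have [E [I [Ik AE]]] := rA.
  have AA : A *m A = A by rewrite AE proj_idem.
  have H : (A *+ 2 - 1%:M) *m (A *+ 2 - 1%:M) = 1%:M.
    rewrite mulmxBl mul1mx mulmxBr mulmx1 !mulr2n.
    by rewrite mulmxDl mulmxDr AA addrK opprD opprK addrA subrr add0r.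
  have [u uE] := GL_mx_surj (Glmx H H).
  have uI : u \in involutions V k by apply: mem_set; apply/(involutionsP divR nz2 _ kN'); exists A.
  by exists (Sub u uI); rewrite SubK.
have /choice[c cP] : forall A, exists w : involutions V k,
    idem_rank k A -> GL_mx (val w) = A *+ 2 - 1%:M.
  (* [w0] serves as the value of [c] outside the idempotents of rank [k]. *)
  have [I _ Ik] : exists2 I : {set 'I_(dim V)}, I \subset [set: 'I_(dim V)] & #|I| = k.
    by apply: subset_of_card; rewrite cardsT card_ord.
  have [w0 _] : exists w : involutions V k, GL_mx (val w) = proj (gl1 _ _) I *+ 2 - 1%:M.
    by apply: of_idem; exists (gl1 _ _), I.
  move=> A; have [/of_idem[w wE]|nA] := EM (idem_rank k A); first by exists w.
  by exists w0.
have /choice[e eP] : forall w : involutions V k, exists A, idem_rank k A /\ GL_mx (val w) = A *+ 2 - 1%:M.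
  by move=> w; have [A rA AE] := ex w; exists A.
have double_inj A B : A *+ 2 - 1%:M = B *+ 2 - 1%:M :> 'M[R]_(dim V) -> A = B.
  by move=> /addIr; exact: mulr2n_inj.
have ec A : idem_rank k A -> e (c A) = A.
  by move=> rA; apply: double_inj; rewrite -(cP _ rA) -(eP _).2.
have ce w : c (e w) = w.
  by apply/val_inj/GL_mx_inj; rewrite (cP _ (eP w).1) -(eP w).2.
have [f' fK f'K] := f_bij.
have commE w w' : commute (val w) (val w') <-> e w *m e w' = e w' *m e w.
  rewrite -(double_subr1_comm divR nz2) -!(eP _).2 -!GL_mxM.
  by split=> [->|/GL_mx_inj].
(* [e] and [c] translate between involutions and idempotents of rank [k]; [f] and its inverse are
   transported along them. *)
have fg : comm_bij k (fun A => e (f (c A))) (fun A => e (f' (c A))).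
  split=> [A rA|A rA|A B rA rB].
  - by split; [exact: (eP _).1 | rewrite ce fK ec].
  - by split; [exact: (eP _).1 | rewrite ce f'K ec].
  by rewrite -commE -f_comm commE !ec.
have [theta thA thP] := comm_bij_extends divR nz2 n_ge3 kN n_neq2k fg.
have [g gA gP] := mx_auto_automorphism thA; exists g; split=> // w.
have [ww _ _] := inP w; apply: GL_mx_inj; rewrite (gP _ ww) !(eP _).2.
have [thD _ _] := thA.
by rewrite (mx_ring_autoB thA) (mx_ring_auto1 thA) mulr2n thD -mulr2n -(thP _ (eP w).1) ce.
Qed.
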